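(* Let $X$ be a CB process with branching mechanism $\Phi$ given by $(\alpha,\beta,\pi)$, with $\pi\neq0$, and let $x>0$. If $\alpha\ge0$, then the restriction to $(0,\infty)$ of the distribution of $\sup_{s\in(0,\infty)}\Delta X_s$ under $\mathbf{P}_x$ and the Lévy measure $\pi$ are absolutely continuous with respect to each other.
   Context: A branching mechanism is a function $\Phi(\lambda)=\alpha\lambda+\beta\lambda^2+\int_{(0,\infty)}(e^{-\lambda\theta}-1+\lambda\theta)\,\pi(d\theta)$, $\lambda\ge0$, with $\alpha\in\mathbb{R}$, $\beta\ge0$ and $\pi$ a $\sigma$-finite measure on $(0,\infty)$ (the Lévy measure) with $\int_{(0,\infty)}(\theta\wedge\theta^2)\,\pi(d\theta)<\infty$; the case $\Phi\equiv0$ is excluded. A CB process with branching mechanism $\Phi$ is an rcll $[0,\infty)$-valued Markov process $X=(X_t)_{t\ge0}$ such that, writing $\mathbf{P}_x$ for its law when $X_0=x$ and $\mathbf{E}_x$ for the expectation, $\mathbf{E}_x[e^{-\lambda X_t}]=e^{-xv_t(\lambda)}$ for $\lambda\ge0$, where $v_t(\lambda)$ is the unique locally bounded nonnegative solution of $v_t(\lambda)=\lambda-\int_0^t\Phi(v_s(\lambda))\,ds$. $\Delta X_s=X_s-X_{s-}$ for $s>0$. *)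

(* Defs.v *)
From HB Require Import structures.
From mathcomp Require Import all_boot all_order all_algebra.
From mathcomp Require Import all_classical all_reals all_analysis.
From mathcomp Require Import measurable_realfun.

Set Implicit Arguments.
Unset Strict Implicit.
Unset Printing Implicit Defensive.

Import Order.TTheory GRing.Theory Num.Theory.
Import numFieldNormedType.Exports.

Local Open Scope classical_set_scope.
Local Open Scope ring_scope.

Definition branching_mechanism (R : realType) (alpha beta : R)
    (pi : {measure set R -> \bar R}) (lambda : R) : R :=
  alpha * lambda + beta * lambda ^+ 2 +
  \int[pi]_(theta in `]0, +oo[)
     (expR (- (lambda * theta)) - 1 + lambda * theta).

(* A measure on (0, oo) is represented by its extension by zero to R. *)
Record is_branching_triple (R : realType) (alpha beta : R)
    (pi : {measure set R -> \bar R}) : Prop := {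
  bt_beta_ge0 : 0 <= beta ;
  bt_support : pi `]-oo, 0]%classic = 0%E ;
  bt_sigma_finite : sigma_finite setT pi ;
  bt_moment :
    (\int[pi]_(theta in (`]0%R, +oo[ : set R)) (Num.min theta (theta ^+ 2))%:E < +oo)%E ;
  bt_neq0 : exists2 lambda : R, 0 <= lambda &
    branching_mechanism alpha beta pi lambda != 0 }.

(* [v t lambda] stands for v_t(lambda).  Measurability in t is what makes the
   integral in the equation meaningful. *)
Definition is_cumulant_semigroup (R : realType) (Phi : R -> R)
    (v : R -> R -> R) : Prop :=
  forall lambda : R, 0 <= lambda ->
  [/\ measurable_fun `[(0 : R), +oo[ (fun t => v t lambda),
      forall t : R, 0 <= t -> 0 <= v t lambda,
      forall T : R, 0 <= T ->
        exists M : R, forall t : R, 0 <= t <= T -> v t lambda <= M &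
      forall t : R, 0 <= t ->
        v t lambda =
        lambda - \int[lebesgue_measure]_(s in `[0, t]) Phi (v s lambda)].

(* Paths are indexed by R; only nonnegative times are relevant. *)
Definition rcll (R : realType) (f : R -> R) : Prop :=
  (forall t : R, 0 <= t -> f s @[s --> t^'+] --> f t) /\
  (forall t : R, 0 < t -> cvg (f s @[s --> t^'-])).

Definition jump (R : realType) (f : R -> R) (t : R) : R :=
  f t - lim (f s @[s --> t^'-]).

Definition sup_jump (R : realType) (f : R -> R) : \bar R :=
  ereal_sup [set (jump f s)%:E | s in `]0, +oo[].

(* The natural filtration: sigma(X_u, 0 <= u <= t). *)
Definition history (R : realType) (d : measure_display)
    (Omega : measurableType d) (X : R -> Omega -> R) (t : R) :
    set (set Omega) :=
  <<s \bigcup_(u in `[0, t]) preimage_set_system setT (X u) measurable >>.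

(* A time-homogeneous Markov process on [0, oo) is given together with the
   family of its laws [P x], x >= 0, under which it starts at x.  The last field
   says that P_(X_t)(X_s \in B) is a version of P_x(X_(t+s) \in B | history t).
   The values of [P] at negative points are irrelevant. *)
Record is_rcll_markov (R : realType) (d : measure_display)
    (Omega : measurableType d) (X : R -> Omega -> R)
    (P : R -> probability Omega R) : Prop := {
  mk_measurable : forall t : R, 0 <= t -> measurable_fun setT (X t) ;
  mk_ge0 : forall (t : R) w, 0 <= t -> 0 <= X t w ;
  mk_rcll : forall w, rcll (fun t => X t w) ;
  mk_start : forall x : R, 0 <= x -> P x [set w | X 0 w = x] = 1%E ;
  mk_kernel : forall (t : R) (B : set R), 0 <= t -> measurable B ->
    measurable_fun `[(0 : R), +oo[ (fun y : R => P y (X t @^-1` B) : \bar R) ;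
  mk_markov : forall (x s t : R) (A : set Omega) (B : set R),
    0 <= x -> 0 <= s -> 0 <= t ->
    history X t A -> measurable B ->
    P x (A `&` X (t + s) @^-1` B) =
    (\int[P x]_(w in A) P (X t w) (X s @^-1` B))%E }.

Definition is_CB_process (R : realType) (d : measure_display)
    (Omega : measurableType d) (Phi : R -> R) (X : R -> Omega -> R)
    (P : R -> probability Omega R) : Prop :=
  is_rcll_markov X P /\
  exists2 v : R -> R -> R, is_cumulant_semigroup Phi v &
    forall x t lambda : R, 0 <= x -> 0 <= t -> 0 <= lambda ->
      'E_(P x)[fun w => expR (- (lambda * X t w))]%E =
      (expR (- (x * v t lambda)))%:E.

(* The supremum is extended-real valued, so its distribution lives on [\bar R];
   [EFin @` _] transports Borel subsets of R there, leaving out +oo. *)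
Definition sup_jump_law (R : realType) (d : measure_display)
    (Omega : measurableType d) (X : R -> Omega -> R)
    (Q : probability Omega R) (B : set R) : \bar R :=
  pushforward Q (fun w => sup_jump (fun t => X t w)) (EFin @` B).

(* Main.v *)
(* Write M for the supremum of the jumps, T_r(l) for the integral of e^{-l theta} over
   (r, oo) against pi, and Phi for the branching mechanism.  Cutting (0, T] into steps of length h and
   weighting e^{-l X} with a product that kills the paths having an increment larger than about r gives
   a chain of means whose drift is proportional to Phi(l) - T_r(l), up to o(h) per step.  As h -> 0,
   the sign of Phi(l) - T_r(l) therefore decides whether P_x(M <= r) is above or below e^{-x l};
   writing P_x(M <= r) = e^{-x q(r)}, the exponent q(r) is a root of Phi(l) = T_r(l).  Comparing the
   roots at a < b bounds the law of M on (a, b] by a multiple of pi, and conversely.  The bound of the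
   law by pi degenerates only where pi(r, oo) = 0; there the law vanishes because q(r) = 0, and the
   right end point of the support of pi, a possible atom, is treated by hand. *)

(* Only the Laplace transform of the process is explicit, so the conditional mean over a step is
   computable only for e^{-l X} times a polynomial in u = e^{-increment}. A sharp cutoff of the
   increments is therefore replaced by a ramp in u, and the ramp by a polynomial. The approximation
   is affordable because the ramp vanishes near u = 1 and so contains a factor (1 - u)^2: this
   factor produces second differences of [Phi], in which the terms of order zero and the
   compensation cancel and a finite measure remains, so that a uniform error of the polynomial costs
   a small multiple of h. As increments may be negative, u is unbounded, and the approximation is
   confined to a bounded range of X. The drift multiplies a nonnegative mean of which only the sign
   is used. The assumption [0 <= alpha] makes [Phi] nondecreasing, so [v] becomes arbitrarily small:
   e^{-l X_T} is then close to 1 in mean at some time T, which removes the horizon from the bound.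
   Half-open intervals suffice for the comparison, since a null set is covered by such intervals of
   small total mass. *)
Require Import Defs.
From HB Require Import structures.
From mathcomp Require Import all_boot all_order all_algebra.
From mathcomp Require Import all_classical all_reals all_analysis.
From mathcomp Require Import measurable_realfun ring lra.
Import Order.TTheory GRing.Theory Num.Theory.
Import numFieldNormedType.Exports.
Local Open Scope classical_set_scope.
Local Open Scope ring_scope.

(** * Bernstein approximation of Lipschitz functions *)

Section bernstein.
Context {R : realType}.

(** The mean of [f] at the number of successes in [n] independent trials of success probability 'X,
    computed by conditioning on one trial. Positivity, linearity and moments then follow by
    induction, without binomial coefficients. *)
Fixpoint bernstein (n : nat) (f : nat -> R) : {poly R} :=
  if n is n'.+1 then
    'X * bernstein n' (f \o succn) + (1 - 'X) * bernstein n' f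
  else (f 0)%:P.

Lemma bernsteinS n f x : (bernstein n.+1 f).[x] =
  x * (bernstein n (f \o succn)).[x] + (1 - x) * (bernstein n f).[x].
Proof. by rewrite /= !hornerE. Qed.

Lemma ge0_bernstein n f x : 0 <= x <= 1 -> (forall k, 0 <= f k) ->
  0 <= (bernstein n f).[x].
Proof.
move=> /andP[x0 x1]; elim: n f => [|n IH] f f0; first by rewrite hornerE.
by rewrite bernsteinS addr_ge0// mulr_ge0 ?subr_ge0 ?IH// => k; exact: f0.
Qed.

Lemma bernsteinD n f g x : (bernstein n (fun k => f k + g k)).[x] =
  (bernstein n f).[x] + (bernstein n g).[x].
Proof.
elim: n f g => [|n IH] f g; first by rewrite /= !hornerE.
by rewrite !bernsteinS (IH (f \o succn) (g \o succn)) (IH f g); ring.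
Qed.

Lemma bernsteinZ n c f x : (bernstein n (fun k => c * f k)).[x] =
  c * (bernstein n f).[x].
Proof.
elim: n f => [|n IH] f; first by rewrite /= !hornerE.
by rewrite !bernsteinS (IH (f \o succn)) (IH f); ring.
Qed.

Lemma bernstein_cst n c x : (bernstein n (fun=> c)).[x] = c.
Proof.
elim: n => [|n IH]; first by rewrite hornerE.
by rewrite bernsteinS (_ : _ \o _ = fun=> c)// IH; ring.
Qed.

(** Variance plus squared bias. The centre [c] is arbitrary because a successful trial replaces it
    by [c - 1] in the induction. *)
Lemma bernstein_variance n c x :
  (bernstein n (fun k => (k%:R - c) ^+ 2)).[x] =
  n%:R * (x * (1 - x)) + (n%:R * x - c) ^+ 2.
Proof.
elim: n c => [|n IH] c; first by rewrite /= hornerE; ring.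
rewrite bernsteinS IH (_ : _ \o _ = fun k => (k%:R - (c - 1)) ^+ 2).
  by rewrite IH -natr1; ring.
by apply/funext => k /=; rewrite -natr1; ring.
Qed.

(** Chebyshev's argument: deviations below [eta] cost [L * eta], larger ones are paid by the
    variance. *)
Lemma lipschitz_bernstein (f : R -> R) L n x eta :
  (forall u v, `|f u - f v| <= L * `|u - v|) -> 0 <= x <= 1 -> 0 < eta ->
  `|(bernstein n.+1 (fun k => f (k%:R / n.+1%:R))).[x] - f x| <=
    L * (eta + (n.+1%:R * eta)^-1).
Proof.
move=> fL /[dup] x01 /andP[x0 x1] eta0.
have L0 : 0 <= L.
  by have := fL 1 0; rewrite subr0 normr1 mulr1; apply: le_trans.
set N : R := n.+1%:R; have N0 : 0 < N by rewrite ltr0n.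
(* With t = k/N - x, this is [L] times eta + t^2 / eta, which dominates [L] times |t| and has a mean
   given by [bernstein_variance]. *)
pose V k : R := L * (eta + (N ^+ 2 * eta)^-1 * (k%:R - N * x) ^+ 2).
have fV k : `|f (k%:R / N) - f x| <= V k.
  apply: (le_trans (fL _ _)); rewrite ler_wpM2l//.
  set t := k%:R / N - x.
  have -> : (N ^+ 2 * eta)^-1 * (k%:R - N * x) ^+ 2 = t ^+ 2 / eta.
    by rewrite /t; field; rewrite !gt_eqF.
  rewrite -(real_normK (num_real t)).
  have [te|et] := leP `|t| eta.
    by rewrite (le_trans te)// lerDl divr_ge0// ?ltW// sqr_ge0.
  rewrite -[leLHS]add0r; apply: lerD; first exact: ltW.
  by rewrite expr2 -mulrA ler_peMr// ler_pdivlMr// mul1r ltW.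
have BV : (bernstein n.+1 V).[x] <= L * (eta + (N * eta)^-1).
  rewrite /V bernsteinZ bernsteinD bernstein_cst bernsteinZ bernstein_variance.
  rewrite ler_wpM2l// lerD2l subrr expr0n addr0.
  have -> : (N ^+ 2 * eta)^-1 * (N * (x * (1 - x))) = (N * eta)^-1 * (x * (1 - x)).
    by field; rewrite !gt_eqF.
  rewrite ler_piMr ?invr_ge0 ?mulr_ge0 ?(ltW eta0) ?(ltW N0)//.
  by rewrite mulr_ile1// ?subr_ge0// lerBlDr lerDl.
rewrite (le_trans _ BV)// -{1}[f x](bernstein_cst n.+1 (f x) x).
have BE c : (bernstein n.+1 V).[x] + c * ((bernstein n.+1
      (fun k => f (k%:R / N))).[x] - (bernstein n.+1 (fun=> f x)).[x]) =
    (bernstein n.+1 (fun k => V k + c * (f (k%:R / N) + (-1) * f x))).[x].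
  rewrite (bernsteinD n.+1 V) (bernsteinZ n.+1 c).
  have E := bernsteinD n.+1 (fun k => f (k%:R / N)) (fun=> -1 * f x) x.
  by cbv beta in E; rewrite E (bernsteinZ n.+1 (-1)) mulN1r.
have key c : `|c| = 1 -> 0 <= (bernstein n.+1 V).[x] + c * ((bernstein n.+1
      (fun k => f (k%:R / N))).[x] - (bernstein n.+1 (fun=> f x)).[x]).
  move=> c1; rewrite BE ge0_bernstein// => k.
  rewrite mulN1r -lerBlDr sub0r (le_trans _ (fV k))// (le_trans (ler_norm _))//.
  by rewrite normrN normrM c1 mul1r.
have := key 1 (normr1 _); have := key (-1) (normrN1 _).
by rewrite ler_norml; lra.
Qed.

Lemma lipschitz_poly_approx (G : R -> R) (L M eps : R) :
  (forall u v, `|G u - G v| <= L * `|u - v|) -> 0 < M -> 0 < eps ->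
  exists p : {poly R}, forall u, 0 <= u <= M -> `|p.[u] - G u| <= eps.
Proof.
move=> GL M0 e0.
have L0 : 0 <= L.
  by have := GL 1 0; rewrite subr0 normr1 mulr1; apply: le_trans.
pose f u := G (M * u).
have fL u v : `|f u - f v| <= (L * M) * `|u - v|.
  by rewrite (le_trans (GL _ _))// -mulrBr normrM gtr0_norm// mulrA.
(* The two error terms are made at most [eta] each by taking n + 1 > eta^{-2}; the summand 1 covers
   the case L M = 0. *)
pose eta := eps / (2 * (L * M + 1)).
have LM0 : 0 <= L * M by rewrite mulr_ge0// ltW.
have eta0 : 0 < eta by rewrite divr_gt0// mulr_gt0// ltr_wpDl.
pose n := Num.truncn (eta ^+ 2)^-1.
have nE : (n.+1%:R * eta)^-1 <= eta.
  rewrite invfM -ler_pdivlMr ?invr_gt0// invrK -expr2.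
  rewrite invf_ple ?posrE ?exprn_gt0 ?ltr0n//.
  by rewrite ltW// truncnS_gt.
exists (bernstein n.+1 (fun k => f (k%:R / n.+1%:R)) \Po (M^-1 *: 'X)).
move=> u /andP[u0 uM]; rewrite horner_comp hornerZ hornerX.
have ME : M * (M^-1 * u) = u by rewrite mulrA mulfV ?gt_eqF// mul1r.
have Mu : 0 <= M^-1 * u <= 1.
  by rewrite mulrC ler_pdivrMr// mul1r uM andbT divr_ge0// ltW.
have := @lipschitz_bernstein f (L * M) n (M^-1 * u) eta fL Mu eta0.
rewrite /f ME => /le_trans; apply.
apply: (@le_trans _ _ (L * M * (eta + eta))); first by rewrite ler_wpM2l// lerD2l.
have -> : L * M * (eta + eta) = eps * (L * M / (L * M + 1)).
  by rewrite /eta; field; rewrite gt_eqF// ltr_wpDl.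
rewrite ler_piMr ?(ltW e0)//.
by rewrite ler_pdivrMr ?ltr_wpDl// mul1r lerDl.
Qed.

End bernstein.

(** * The branching mechanism and the tails of the Levy measure *)

Section exponential_inequalities.
Context {R : realType}.
Implicit Types a b : R.

Lemma expR_tangent a b : expR a * (1 + b - a) <= expR b.
Proof.
have -> : expR b = expR a * expR (b - a) by rewrite -expRD; congr expR; ring.
by rewrite ler_wpM2l ?expR_ge0// -addrA expR_ge1Dx.
Qed.

(** The compensated integrand of the branching mechanism, as a function of the product of [lambda]
    and [theta]. *)
Definition comp_exp a : R := expR (- a) - 1 + a.

Lemma comp_exp_ge0 a : 0 <= comp_exp a.
Proof. by rewrite /comp_exp; have := expR_ge1Dx (- a); lra. Qed.

Lemma comp_exp_gt0 a : a != 0 -> 0 < comp_exp a.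
Proof.
by move=> a0; rewrite /comp_exp; have := @expR_gt1Dx R (- a); rewrite oppr_eq0 => /(_ a0); lra.
Qed.

Lemma comp_exp_sub_le a b : comp_exp a - comp_exp b <= (a - b) * (1 - expR (- a)).
Proof. by rewrite /comp_exp; have := expR_tangent (- a) (- b); lra. Qed.

Lemma comp_exp_sub_ge a b : (a - b) * (1 - expR (- b)) <= comp_exp a - comp_exp b.
Proof. by rewrite /comp_exp; have := expR_tangent (- b) (- a); lra. Qed.

Lemma subr1_expRN_le a : 0 <= a -> 0 <= 1 - expR (- a) <= Num.min 1 a.
Proof.
move=> a0; have := expR_ge1Dx (- a); have := expR_ge0 (- a).
have : expR (- a) <= 1 by rewrite expR_le1 oppr_le0.
by rewrite le_min; lra.
Qed.

(** Convexity together with the value 0 at 0: the chord over [0, b] is no steeper than the tangent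
    at b, hence no steeper than the chord over [b, a]. *)
Lemma comp_exp_slope a b : 0 <= b <= a ->
  (a - b) * comp_exp b <= b * (comp_exp a - comp_exp b).
Proof.
move=> /andP[b0 ba]; apply: (@le_trans _ _ (b * ((a - b) * (1 - expR (- b))))).
  rewrite mulrCA ler_wpM2l ?subr_ge0// /comp_exp.
  by have := expR_tangent (- b) 0; rewrite expR0; lra.
by rewrite ler_wpM2l// comp_exp_sub_ge.
Qed.

(** The derivative in [a] is theta (1 - e^{-a theta}), at most theta min(1, a theta); this is how
    the integrable function min(theta, theta^2) of the moment condition appears. *)
Lemma comp_exp_lipschitz a b (theta : R) : 0 <= b <= a -> 0 < theta ->
  0 <= comp_exp (a * theta) - comp_exp (b * theta) <=
    (a - b) * (Num.max 1 a * Num.min theta (theta ^+ 2)).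
Proof.
move=> /andP[b0 ba] t0; have a0 := le_trans b0 ba; apply/andP; split.
  apply: le_trans (comp_exp_sub_ge _ _).
  have /subr1_expRN_le/andP[h _] : 0 <= b * theta by rewrite mulr_ge0// ltW.
  by rewrite mulr_ge0// -mulrBl mulr_ge0 ?subr_ge0// ltW.
apply: (le_trans (comp_exp_sub_le _ _)).
have /subr1_expRN_le/andP[_] : 0 <= a * theta by rewrite mulr_ge0// ltW.
rewrite le_min => /andP[h1 h2].
rewrite -mulrBl -mulrA ler_wpM2l ?subr_ge0//.
have m1 : 1 <= Num.max 1 a by rewrite le_max lexx.
have ma : a <= Num.max 1 a by rewrite le_max lexx orbT.
rewrite minEle; case: ifPn => _.
  apply: (@le_trans _ _ (theta * 1)); first by rewrite ler_wpM2l// ltW.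
  by rewrite mulr1 ler_peMl// ltW.
apply: (@le_trans _ _ (theta * (a * theta))); first by rewrite ler_wpM2l// ltW.
by rewrite mulrCA expr2 ler_wpM2r// mulr_ge0// ltW.
Qed.

End exponential_inequalities.

Section levy_measure.
Context {R : realType} {alpha beta : R} { pi : {measure set R -> \bar R}}.
Context (htriple : is_branching_triple alpha beta pi).

Local Notation D := (`]0, +oo[%classic : set R).
Local Notation Phi := (branching_mechanism alpha beta pi).

Lemma measurable_min_sq : measurable_fun D (fun t : R => Num.min t (t ^+ 2)).
Proof. by apply: measurable_minr => //; exact: measurable_funX. Qed.

Lemma min_sq_ge0 (t : R) : 0 <= t -> 0 <= Num.min t (t ^+ 2).
Proof. by move=> t0; rewrite le_min t0 sqr_ge0. Qed.

Lemma levy_integrable (f : R -> R) C : measurable_fun D f ->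
  (forall t, 0 < t -> `|f t| <= C * Num.min t (t ^+ 2)) ->
  pi.-integrable D (EFin \o f).
Proof.
move=> mf fC.
have mD : measurable D by exact: measurable_itv.
apply: (le_integrable mD (g := fun t : R => (C%:E * (Num.min t (t ^+ 2))%:E)%E)).
- exact/measurable_EFinP.
- move=> t /=; rewrite in_itv/= andbT => t0.
  by rewrite lee_fin (le_trans (fC t t0))// ler_norm.
- apply: integrableZl => //; apply/integrableP; split.
    by apply/measurable_EFinP; exact: measurable_min_sq.
  apply: le_lt_trans (bt_moment htriple).
  apply: ge0_le_integral => //.
  + by apply: measurableT_comp => //; apply/measurable_EFinP; exact: measurable_min_sq.
  + by apply/measurable_EFinP; exact: measurable_min_sq.
  + move=> t /=; rewrite in_itv/= andbT => t0.
    by rewrite lee_fin ger0_norm// min_sq_ge0// ltW.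
Qed.

Lemma measurable_expRN (l : R) (A : set R) :
  measurable_fun A (fun t : R => expR (- (l * t))).
Proof.
apply: measurable_funTS; apply: measurableT_comp => //.
apply: measurableT_comp => //; exact: measurable_funM.
Qed.

Lemma measurable_comp_exp (l : R) (A : set R) :
  measurable_fun A (fun t : R => comp_exp (l * t)).
Proof.
apply: measurable_funD; last by apply: measurable_funTS; exact: measurable_funM.
by apply: measurable_funB => //; exact: measurable_expRN.
Qed.

Lemma comp_exp_norm_le (l t : R) : 0 <= l -> 0 < t ->
  `|comp_exp (l * t)| <= l * Num.max 1 l * Num.min t (t ^+ 2).
Proof.
move=> l0 t0; have /(_ _ t0) := @comp_exp_lipschitz R l 0 t.
rewrite lexx l0 => /(_ isT)/andP[_]; rewrite mul0r {2}/comp_exp oppr0 expR0.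
by rewrite subrr !addr0 subr0 mulrA ger0_norm ?comp_exp_ge0.
Qed.

Lemma comp_exp_integrable (l : R) : 0 <= l ->
  pi.-integrable D (fun t => (comp_exp (l * t))%:E).
Proof.
move=> l0; apply: (@levy_integrable _ (l * Num.max 1 l)).
  exact: measurable_comp_exp.
by move=> t; exact: comp_exp_norm_le.
Qed.

Lemma branching_mechanismE (l : R) :
  Phi l = alpha * l + beta * l ^+ 2 + \int[pi]_(t in D) comp_exp (l * t).
Proof. by []. Qed.

Definition levy_moment : R := \int[pi]_(t in D) Num.min t (t ^+ 2).

Lemma levy_moment_integrable :
  pi.-integrable D (fun t => (Num.min t (t ^+ 2))%:E).
Proof.
apply: (@levy_integrable _ 1); first exact: measurable_min_sq.
by move=> t t0; rewrite mul1r ger0_norm// min_sq_ge0// ltW.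
Qed.

Lemma levy_moment_ge0 : 0 <= levy_moment.
Proof.
apply: Rintegral_ge0 => t /=; rewrite in_itv/= andbT => t0.
by rewrite min_sq_ge0// ltW.
Qed.

Hypothesis halpha : 0 <= alpha.

(** An upper bound on [0, l] for the derivative alpha + 2 beta l + int theta (1 - e^{-l theta})
    pi(dtheta) of [Phi]. *)
Definition mechanism_lipschitz (l : R) : R :=
  alpha + 2 * beta * l + Num.max 1 l * levy_moment.

Lemma mechanism_lipschitz_ge0 (l : R) : 0 <= l -> 0 <= mechanism_lipschitz l.
Proof.
move=> l0; rewrite /mechanism_lipschitz !addr_ge0// !mulr_ge0//.
- exact: bt_beta_ge0 htriple.
- by rewrite le_max ler01.
- exact: levy_moment_ge0.
Qed.

Lemma branching_mechanism0 : Phi 0 = 0.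
Proof.
rewrite branching_mechanismE expr0n !mulr0 !add0r.
under eq_Rintegral do rewrite mul0r /comp_exp oppr0 expR0 subrr addr0.
by rewrite /Rintegral integral0.
Qed.

Lemma branching_mechanism_sub (a b : R) : 0 <= b <= a ->
  Phi a - Phi b = alpha * (a - b) + beta * (a ^+ 2 - b ^+ 2) +
    \int[pi]_(t in D) (comp_exp (a * t) - comp_exp (b * t)).
Proof.
move=> /andP[b0 ba]; rewrite !branching_mechanismE RintegralB//; first ring.
- by apply: comp_exp_integrable; exact: le_trans ba.
- exact: comp_exp_integrable.
Qed.

Lemma comp_exp_sub_integrable (a b : R) : 0 <= b <= a ->
  pi.-integrable D (EFin \o (fun t => comp_exp (a * t) - comp_exp (b * t))).
Proof.
move=> /andP[b0 ba].
apply: (@integrableB _ _ _ pi _ _ (fun t => (comp_exp (a * t))%:E)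
  (fun t => (comp_exp (b * t))%:E)) => //; apply: comp_exp_integrable => //.
exact: le_trans ba.
Qed.

Lemma branching_mechanism_lipschitz (a b : R) : 0 <= b <= a ->
  0 <= Phi a - Phi b <= mechanism_lipschitz a * (a - b).
Proof.
move=> /[dup] ba /andP[b0 ab]; rewrite branching_mechanism_sub//.
have be0 := bt_beta_ge0 htriple; have a0 : 0 <= a := le_trans b0 ab.
apply/andP; split.
  rewrite !addr_ge0// ?mulr_ge0 ?subr_ge0// ?ler_sqr//.
  apply: Rintegral_ge0 => t /=; rewrite in_itv/= andbT => t0.
  by have /andP[] := comp_exp_lipschitz _ _ _ ba t0.
have : \int[pi]_(t in D) (comp_exp (a * t) - comp_exp (b * t)) <=
    (a - b) * Num.max 1 a * levy_moment.
  rewrite /levy_moment -RintegralZl//; last exact: levy_moment_integrable.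
  apply: le_Rintegral => //; first exact: comp_exp_sub_integrable.
    apply: (@integrableZl _ _ _ pi _ _ _ (fun t => (Num.min t (t ^+ 2))%:E)) => //.
    exact: levy_moment_integrable.
  move=> t /=; rewrite in_itv/= andbT => t0.
  by have /andP[_] := comp_exp_lipschitz _ _ _ ba t0; rewrite mulrA.
rewrite /mechanism_lipschitz => h.
have : beta * (a ^+ 2 - b ^+ 2) <= beta * (2 * a * (a - b)).
  rewrite ler_wpM2l// subr_sqr mulrC ler_wpM2r ?subr_ge0//; lra.
lra.
Qed.

Lemma branching_mechanism_le (a b : R) : 0 <= b <= a -> Phi b <= Phi a.
Proof. by move=> /branching_mechanism_lipschitz/andP[]; rewrite subr_ge0. Qed.

Lemma branching_mechanism_ge0 (a : R) : 0 <= a -> 0 <= Phi a.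
Proof.
by move=> a0; rewrite -branching_mechanism0 branching_mechanism_le// lexx.
Qed.

(** [comp_exp_slope] integrated against [pi]; the quadratic term obeys the same inequality and the
    linear one contributes equally to both sides. *)
Lemma branching_mechanism_slope (a b : R) : 0 <= b <= a ->
  (a - b) * Phi b <= b * (Phi a - Phi b).
Proof.
move=> /[dup] ba /andP[b0 ab]; rewrite branching_mechanism_sub// branching_mechanismE.
have be0 := bt_beta_ge0 htriple.
have : (a - b) * \int[pi]_(t in D) comp_exp (b * t) <=
    b * \int[pi]_(t in D) (comp_exp (a * t) - comp_exp (b * t)).
  rewrite -!RintegralZl//.
  - apply: le_Rintegral => //.
    + apply: (@integrableZl _ _ _ pi _ _ _ (fun t => (comp_exp (b * t))%:E)) => //.
      exact: comp_exp_integrable.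
    + apply: (@integrableZl _ _ _ pi _ _ _
        (EFin \o (fun t => comp_exp (a * t) - comp_exp (b * t)))) => //.
      exact: comp_exp_sub_integrable.
    + move=> t /=; rewrite in_itv/= andbT => t0.
      have := @comp_exp_slope R (a * t) (b * t).
      rewrite mulr_ge0 ?(ltW t0)//= ler_wpM2r ?(ltW t0)// => /(_ isT).
      by rewrite -mulrBl mulrAC [leRHS]mulrAC ler_pM2r.
  - exact: comp_exp_sub_integrable.
  - exact: comp_exp_integrable.
have : (a - b) * (beta * b ^+ 2) <= b * (beta * (a ^+ 2 - b ^+ 2)).
  have -> : b * (beta * (a ^+ 2 - b ^+ 2)) = (a - b) * (beta * (b * (a + b))) by ring.
  rewrite ler_wpM2l ?subr_ge0// ler_wpM2l// expr2 ler_wpM2l// lerDr.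
  exact: le_trans ab.
lra.
Qed.

End levy_measure.

Lemma indic_itv_oc {R : realType} (a b t : R) :
  (\1_(`]a, b]%classic : set R) t : R) = (a < t <= b)%R%:R.
Proof. by rewrite indicE mem_setE in_itv. Qed.

Lemma indic_itv_oy {R : realType} (a t : R) :
  (\1_(`]a, +oo[%classic : set R) t : R) = (a < t)%R%:R.
Proof. by rewrite indicE mem_setE in_itv/= andbT. Qed.

(** * Laplace transforms of the tails of the Levy measure, and the second difference of the
    mechanism *)

Section levy_tail.
Context {R : realType} {alpha beta : R} { pi : {measure set R -> \bar R}}.
Context (htriple : is_branching_triple alpha beta pi).

Local Notation D := (`]0, +oo[%classic : set R).
Local Notation Phi := (branching_mechanism alpha beta pi).

Lemma le_levy_Rintegral (f g : R -> R) C1 C2 :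
  measurable_fun D f -> measurable_fun D g ->
  (forall t, 0 < t -> `|f t| <= C1 * Num.min t (t ^+ 2)) ->
  (forall t, 0 < t -> `|g t| <= C2 * Num.min t (t ^+ 2)) ->
  (forall t, 0 < t -> f t <= g t) ->
  \int[pi]_(t in D) f t <= \int[pi]_(t in D) g t.
Proof.
move=> mf mg fC gC fg; apply: le_Rintegral => //.
- exact: (levy_integrable htriple _ _ mf fC).
- exact: (levy_integrable htriple _ _ mg gC).
- by move=> t /=; rewrite in_itv/= andbT => /fg.
Qed.

(** For t > r one has 1 <= t / r and t <= max(1, 1/r) min(t, t^2); the product of the two constants
    dominates the indicator of the tail by the integrable function. *)
Definition tail_cst (r : R) := r^-1 * Num.max 1 r^-1.

Lemma tail_cst_ge0 (r : R) : 0 < r -> 0 <= tail_cst r.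
Proof. by move=> r0; rewrite mulr_ge0 ?invr_ge0 ?(ltW r0)// le_max ler01. Qed.

Lemma le_max_min_sq (r t : R) : 0 < r -> r < t ->
  t <= Num.max 1 r^-1 * Num.min t (t ^+ 2).
Proof.
move=> r0 rt; have t0 := lt_trans r0 rt; set c := Num.max 1 r^-1.
have c1 : 1 <= c by rewrite le_max lexx.
have cr : r^-1 <= c by rewrite le_max lexx orbT.
rewrite minEle; case: ifPn => _; first by rewrite ler_peMl// ltW.
rewrite expr2 mulrA ler_peMl// ?(ltW t0)//.
apply: (@le_trans _ _ (r^-1 * r)); first by rewrite mulVf// gt_eqF.
by rewrite ler_pM ?invr_ge0 ?(ltW r0)// ltW.
Qed.

Lemma tail_cst_le (r t : R) : 0 < r -> r < t ->
  1 <= tail_cst r * Num.min t (t ^+ 2).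
Proof.
move=> r0 rt; rewrite -mulrA.
apply: (@le_trans _ _ (r^-1 * r)); first by rewrite mulVf// gt_eqF.
by rewrite ler_wpM2l ?invr_ge0 ?(ltW r0)// (le_trans (ltW rt))// le_max_min_sq.
Qed.

Lemma indic_tail_le (f : R -> R) (A : set R) C r t : 0 < r -> 0 <= C -> A `<=` `]r, +oo[ ->
  (A t -> `|f t| <= C) -> 0 < t ->
  `|f t * \1_A t| <= (C * tail_cst r) * Num.min t (t ^+ 2).
Proof.
move=> r0 C0 Ar fC t0; rewrite indicE.
have min0 : 0 <= Num.min t (t ^+ 2) by apply: min_sq_ge0; exact: ltW.
have [/set_mem At|_] := boolP (t \in A); last first.
  by rewrite /= mulr0 normr0 mulr_ge0// mulr_ge0// tail_cst_ge0.
have rt : r < t by have := Ar t At; rewrite /= in_itv/= andbT.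
by rewrite mulr1 (le_trans (fC At))// -mulrA ler_peMr// tail_cst_le.
Qed.

Lemma expRN_norm_le1 (l t : R) : 0 <= l -> 0 < t -> `|expR (- (l * t))| <= 1.
Proof.
by move=> l0 t0; rewrite ger0_norm ?expR_ge0// expR_le1 oppr_le0 mulr_ge0// ltW.
Qed.

(** T_r(l) of the overview. The indicator stands inside the integral so that tails with different
    [r] are subtracted under one integral sign. *)
Definition levy_tail (r l : R) : R :=
  \int[pi]_(t in D) (expR (- (l * t)) * \1_(`]r, +oo[%classic) t).

Lemma measurable_expRN_indic (l : R) (A E : set R) : measurable A ->
  measurable_fun E (fun t : R => expR (- (l * t)) * \1_A t : R).
Proof.
move=> mA; apply: measurable_funM; first exact: measurable_expRN.
exact: measurable_funTS.
Qed.

Lemma expRN_indic_le (l r : R) (A : set R) : 0 < r -> 0 <= l ->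
  A `<=` `]r, +oo[ -> forall t, 0 < t ->
  `|expR (- (l * t)) * \1_A t| <= tail_cst r * Num.min t (t ^+ 2).
Proof.
move=> r0 l0 Ar t t0; rewrite -[tail_cst r]mul1r.
apply: (indic_tail_le (fun t => expR (- (l * t)))) => // _.
exact: expRN_norm_le1.
Qed.

Lemma expRN_indic_integrable (l r : R) (A : set R) : 0 < r -> 0 <= l ->
  measurable A -> A `<=` `]r, +oo[ ->
  pi.-integrable D (EFin \o (fun t => expR (- (l * t)) * \1_A t)).
Proof.
move=> r0 l0 mA Ar.
apply: (levy_integrable htriple _ (tail_cst r) (measurable_expRN_indic _ _ _ mA)).
exact: expRN_indic_le.
Qed.

Lemma levy_set_fin (r : R) (A : set R) : 0 < r -> measurable A ->
  A `<=` `]r, +oo[ -> (pi A < +oo)%E.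
Proof.
move=> r0 mA Ar.
have := expRN_indic_integrable 0 r A r0 (lexx _) mA Ar.
move=> /integrableP[_].
rewrite (_ : (\int[pi]_(x in D) _)%E = pi A)//.
rewrite (eq_integral (fun t => (\1_A t)%:E)); last first.
  move=> t _ /=; rewrite mul0r oppr0 expR0 mul1r ger0_norm//.
rewrite integral_indic//; congr (pi _).
apply/setIidPl => t /Ar /=; rewrite !in_itv/= !andbT; exact: lt_trans.
Qed.

Lemma levy_setE (r : R) (A : set R) : 0 < r -> measurable A ->
  A `<=` `]r, +oo[ -> \int[pi]_(t in D) (\1_A t : R) = fine (pi A).
Proof.
move=> r0 mA Ar; rewrite /Rintegral integral_indic//; congr (fine (pi _)).
apply/setIidPl => t /Ar /=; rewrite !in_itv/= !andbT; exact: lt_trans.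
Qed.

Lemma levy_tail_ge0 (r l : R) : 0 <= levy_tail r l.
Proof. by apply: Rintegral_ge0 => t _; rewrite mulr_ge0// expR_ge0. Qed.

Lemma levy_tail_sub (r r' l : R) : 0 < r -> r <= r' -> 0 <= l ->
  levy_tail r l - levy_tail r' l =
  \int[pi]_(t in D) (expR (- (l * t)) * \1_(`]r, r']%classic) t).
Proof.
move=> r0 rr l0; rewrite /levy_tail -RintegralB//.
- apply: eq_Rintegral => t _; rewrite -mulrBr; congr (_ * _).
  rewrite indic_itv_oc !indic_itv_oy.
  have [rt|rt] /= := ltP r t; have [rt'|rt'] /= := ltP r' t; rewrite ?subr0 ?subrr//.
  by have := lt_le_trans rt' (le_trans rt rr); rewrite ltxx.
- exact: (expRN_indic_integrable _ r).
- apply: (expRN_indic_integrable _ r) => //.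
  by move=> t /=; rewrite !in_itv/= !andbT; exact: le_lt_trans.
Qed.

(** On []r, r']] the weight e^{-l t} lies between e^{-l r'} and 1. This is the passage between tails
    and values of [pi] on half-open intervals. *)
Lemma levy_tail_sub_le (r r' l : R) : 0 < r -> r <= r' -> 0 <= l ->
  expR (- (l * r')) * fine (pi `]r, r']%classic) <= levy_tail r l - levy_tail r' l
    <= fine (pi `]r, r']%classic).
Proof.
move=> r0 rr l0; rewrite levy_tail_sub//.
have sub : `]r, r']%classic `<=` (`]r, +oo[%classic : set R).
  by move=> t /=; rewrite !in_itv/= andbT => /andP[].
have h l' : 0 <= l' -> pi.-integrable D (EFin \o (fun t => expR (- (l' * t)) * \1_(`]r, r']%classic) t)).
  by move=> l'0; exact: (expRN_indic_integrable _ r).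
have h1 : pi.-integrable D (EFin \o (fun t => \1_(`]r, r']%classic) t : R)).
  apply: eq_integrable (h 0 (lexx _)) => // t _ /=.
  by rewrite mul0r oppr0 expR0 mul1r.
rewrite -(levy_setE r)// -RintegralZl//; apply/andP; split; apply: le_Rintegral => //.
- by apply: (@integrableZl _ _ _ pi _ _ _ (EFin \o (fun t => \1_(`]r, r']%classic) t : R))).
- exact: h.
- move=> t _; rewrite indic_itv_oc; case: (boolP (_ < _ <= _)) => /=; rewrite ?mulr0// !mulr1.
  by move=> /andP[_ tr]; rewrite ler_expR lerN2 ler_wpM2l.
- exact: h.
- move=> t /=; rewrite in_itv/= andbT => t0; rewrite ler_piMl//.
  by rewrite expR_le1 oppr_le0 mulr_ge0// ltW.
Qed.

Lemma levy_tail_lipschitz (r l l' : R) : 0 < r -> 0 <= l <= l' ->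
  0 <= levy_tail r l - levy_tail r l' <=
    Num.max 1 r^-1 * levy_moment (pi := pi) * (l' - l).
Proof.
move=> r0 /andP[l0 ll]; have l'0 := le_trans l0 ll.
rewrite /levy_tail -RintegralB//; [|exact: (expRN_indic_integrable _ r)..].
have tan t : 0 < t -> 0 <= expR (- (l * t)) - expR (- (l' * t)) <= (l' - l) * t.
  move=> t0; have lt : l * t <= l' * t by rewrite ler_wpM2r// ltW.
  rewrite subr_ge0 ler_expR lerN2 lt/=.
  have := expR_tangent (- (l * t)) (- (l' * t)) => h.
  have : expR (- (l * t)) * (l' * t - l * t) <= l' * t - l * t.
    by rewrite ler_piMl ?subr_ge0// expR_le1 oppr_le0 mulr_ge0// ltW.
  lra.
have t0P (t : R) : t \in D -> 0 < t by rewrite mem_setE in_itv/= andbT.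
apply/andP; split.
  apply: Rintegral_ge0 => t Dt; rewrite -mulrBl mulr_ge0//.
  by have /andP[] := tan t (t0P t (mem_set Dt)).
rewrite mulrAC -RintegralZl//; last exact: (levy_moment_integrable htriple).
apply: le_Rintegral => //.
- apply: (@integrableB _ _ _ pi _ _
    (EFin \o (fun t => expR (- (l * t)) * \1_(`]r, +oo[%classic) t))
    (EFin \o (fun t => expR (- (l' * t)) * \1_(`]r, +oo[%classic) t))) => //;
    exact: (expRN_indic_integrable _ r).
- apply: (@integrableZl _ _ _ pi _ _ _ (fun t => (Num.min t (t ^+ 2))%:E)) => //.
  exact: (levy_moment_integrable htriple).
- move=> t Dt; have t0 := t0P t (mem_set Dt); rewrite -mulrBl indic_itv_oy.
  have /andP[_ h] := tan t t0.
  have m0 : 0 <= Num.max 1 r^-1 * Num.min t (t ^+ 2).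
    by rewrite mulr_ge0 ?min_sq_ge0 ?(ltW t0)// le_max ler01.
  rewrite [leRHS](_ : _ = (l' - l) * (Num.max 1 r^-1 * Num.min t (t ^+ 2))); last by ring.
  case: (ltP r t) => rt /=.
    by rewrite mulr1 (le_trans h)// ler_wpM2l ?subr_ge0// le_max_min_sq.
  by rewrite mulr0 mulr_ge0 ?subr_ge0.
Qed.

Lemma levy_tail_set_le (r l : R) : 0 < r -> 0 <= l ->
  levy_tail r l <= fine (pi `]r, +oo[%classic).
Proof.
move=> r0 l0; rewrite -(levy_setE r)//; apply: le_Rintegral => //.
- exact: (expRN_indic_integrable _ r).
- have := expRN_indic_integrable 0 r `]r, +oo[%classic r0 (lexx _) (measurable_itv _).
  move=> /(_ (@subset_refl _ _)).
  by apply: eq_integrable => // t _ /=; rewrite mul0r oppr0 expR0 mul1r.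
- move=> t /=; rewrite in_itv/= andbT => t0; rewrite ler_piMl//.
  by rewrite expR_le1 oppr_le0 mulr_ge0// ltW.
Qed.

Lemma levy_tail0 (r : R) : 0 < r -> levy_tail r 0 = fine (pi `]r, +oo[%classic).
Proof.
move=> r0; rewrite -(levy_setE r)//; apply: eq_Rintegral => t _.
by rewrite mul0r oppr0 expR0 mul1r.
Qed.

Hypothesis halpha : 0 <= alpha.

(** As [pi] is not zero, it charges some []r, +oo[], where the integrand is at least
    [comp_exp (l * r) > 0]. *)
Lemma branching_mechanism_gt0 (l : R) : pi setT <> 0%E -> 0 < l -> 0 < Phi l.
Proof.
move=> hpi l0.
suff [r r0 pr] : exists2 r : R, 0 < r & 0 < fine (pi `]r, +oo[%classic).
  have be0 := bt_beta_ge0 htriple.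
  apply: (@lt_le_trans _ _ (comp_exp (l * r) * fine (pi `]r, +oo[%classic))).
    by rewrite mulr_gt0// comp_exp_gt0// gt_eqF// mulr_gt0.
  rewrite branching_mechanismE -[leLHS]add0r lerD ?addr_ge0 ?mulr_ge0 ?sqr_ge0 ?(ltW l0)//.
  rewrite -(levy_setE r)// -RintegralZl//; last first.
    have := expRN_indic_integrable 0 r `]r, +oo[%classic r0 (lexx _) (measurable_itv _).
    move=> /(_ (@subset_refl _ _)).
    by apply: eq_integrable => // t _ /=; rewrite mul0r oppr0 expR0 mul1r.
  apply: (le_levy_Rintegral _ _ (comp_exp (l * r) * tail_cst r) (l * Num.max 1 l)).
  - by apply: measurable_funM => //; exact: measurable_funTS.
  - exact: measurable_comp_exp.
  - move=> t t0; apply: (indic_tail_le (fun=> comp_exp (l * r))) => //.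
      exact: comp_exp_ge0.
    by rewrite ger0_norm// comp_exp_ge0.
  - by move=> t t0; apply: comp_exp_norm_le => //; exact: ltW.
  - move=> t t0; rewrite indic_itv_oy.
    case: ltP => rt /=; last by rewrite mulr0 comp_exp_ge0.
    rewrite mulr1 -subr_ge0.
    apply: le_trans (comp_exp_sub_ge _ _).
    rewrite mulr_ge0 ?subr_ge0 ?ler_wpM2l ?(ltW rt) ?(ltW l0)//.
    by rewrite expR_le1 oppr_le0 mulr_ge0 ?ltW.
(* Otherwise all the tails [](n.+1)^-1, +oo[] are null, and with the null half-line []-oo, 0]] they
   cover everything. *)
apply: contrapT => /forall2NP h; apply: hpi.
have hU : setT = `]-oo, 0]%classic `|` \bigcup_n `](n.+1%:R^-1 : R), +oo[%classic.
  apply/seteqP; split => // t _; have [t0|t0] := leP t 0.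
    by left; rewrite /= in_itv.
  right; exists (Num.truncn t^-1) => //=; rewrite in_itv/= andbT.
  by rewrite invf_plt ?posrE// truncnS_gt.
rewrite hU; apply/eqP; rewrite measureU0//.
- by rewrite (bt_support htriple).
- exact: bigcup_measurable.
- apply/eqP; rewrite -measure_le0.
  apply: le_trans (measure_sigma_subadditive _ _ _ (@subset_refl _ _)) _ => //.
    exact: bigcup_measurable.
  rewrite eseries0// => n _ _.
  have n0 : 0 < (n.+1%:R^-1 : R) by rewrite invr_gt0.
  have := h n.+1%:R^-1; rewrite invr_gt0 ltr0n => -[//|/negP]; rewrite -leNgt => h'.
  have fin : pi `](n.+1%:R^-1 : R), +oo[%classic \is a fin_num.
    by rewrite ge0_fin_numE// (levy_set_fin n.+1%:R^-1).
  by rewrite -(fineK fin); congr EFin; apply/eqP; rewrite eq_le h' fine_ge0.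
Qed.

(** Phi(l) / l is nondecreasing, by convexity and Phi(0) = 0. *)
Lemma branching_mechanism_superlinear (a b : R) : 0 <= b <= a ->
  a * Phi b <= b * Phi a.
Proof.
by move=> /(branching_mechanism_slope htriple); lra.
Qed.

Lemma sq_kernel_le (f : R -> R) C l t : 0 <= l -> 0 < t -> 0 <= C -> `|f t| <= C ->
  `|expR (- (l * t)) * (1 - expR (- t)) ^+ 2 * f t| <= C * Num.min t (t ^+ 2).
Proof.
move=> l0 t0 C0 fC; rewrite normrM mulrC ler_pM// normrM normrX.
have /andP[h0] := subr1_expRN_le _ (ltW t0); rewrite le_min => /andP[h1 ht].
have h : `|1 - expR (- t)| ^+ 2 <= Num.min t (t ^+ 2).
  rewrite ger0_norm// le_min; apply/andP; split; last by rewrite ler_sqr ?nnegrE// ltW.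
  by rewrite expr2 (le_trans _ ht)// ler_piMl.
rewrite -[leRHS]mul1r ler_pM ?normr_ge0 ?exprn_ge0//.
exact: expRN_norm_le1.
Qed.

(** The second difference annihilates the affine parts, including the compensation, and leaves the
    mass of a finite measure: an atom 2 beta at t = 0 plus e^{-l t} (1 - e^{-t})^2 pi(dt). *)
Lemma branching_mechanism_diff2 (l : R) : 0 <= l ->
  Phi l - 2 * Phi (l + 1) + Phi (l + 2) =
  2 * beta + \int[pi]_(t in D) (expR (- (l * t)) * (1 - expR (- t)) ^+ 2).
Proof.
move=> l0.
have i0 := comp_exp_integrable htriple l l0.
have i1 : pi.-integrable D (fun t => (comp_exp ((l + 1) * t))%:E).
  by apply: (comp_exp_integrable htriple); rewrite addr_ge0.
have i2 : pi.-integrable D (fun t => (comp_exp ((l + 2) * t))%:E).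
  by apply: (comp_exp_integrable htriple); rewrite addr_ge0.
have i1' : pi.-integrable D (EFin \o (fun t => 2 * comp_exp ((l + 1) * t))).
  by apply: (@integrableZl _ _ _ pi _ _ _ (fun t => (comp_exp ((l + 1) * t))%:E)).
rewrite (_ : \int[pi]_(t in D) (expR (- (l * t)) * (1 - expR (- t)) ^+ 2) =
  \int[pi]_(t in D) (comp_exp (l * t) - 2 * comp_exp ((l + 1) * t) + comp_exp ((l + 2) * t))).
  rewrite RintegralD//; last first.
    by apply: (@integrableB _ _ _ pi _ _ (fun t => (comp_exp (l * t))%:E)
     (EFin \o (fun t => 2 * comp_exp ((l + 1) * t)))).
  rewrite RintegralB// RintegralZl// !branching_mechanismE; ring.
apply: eq_Rintegral => t _; rewrite /comp_exp.
have -> : - ((l + 1) * t) = - (l * t) - t by ring.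
have -> : - ((l + 2) * t) = - (l * t) - t - t by ring.
by rewrite !expRD; ring.
Qed.

End levy_tail.

Lemma norm_le_integrable d (T : measurableType d) (R : realType)
    (mu : {measure set T -> \bar R}) (A : set T) (f : T -> R) (C : R) :
  measurable A -> (mu A < +oo)%E -> measurable_fun A f ->
  (forall x, A x -> `|f x| <= C) -> mu.-integrable A (EFin \o f).
Proof.
move=> mA Afin mf fC; apply: measurable_bounded_integrable => //.
by exists C; split; [exact: num_real|move=> y /ltW Cy x Ax /=; exact: (le_trans (fC x Ax))].
Qed.

Lemma lebesgue_measure_cc {R : realType} (a b : R) : a <= b ->
  (@lebesgue_measure R : {measure set _ -> \bar R}) `[a, b]%classic = (b - a)%:E.
Proof.
move=> ab; rewrite /= lebesgue_measure_itv/= lte_fin.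
by case: ltgtP ab => // -> _; rewrite subrr.
Qed.

(** * The cumulant semigroup *)

Section cumulant_semigroup.
Context {R : realType} {alpha beta : R} { pi : {measure set R -> \bar R}}.
Context (htriple : is_branching_triple alpha beta pi) (halpha : 0 <= alpha).
Context {v : R -> R -> R}.
Local Notation Phi := (branching_mechanism alpha beta pi).
Local Notation L := (mechanism_lipschitz (alpha := alpha) (beta := beta) (pi := pi)).
Context (hv : is_cumulant_semigroup Phi v).

Lemma cumulant_ge0 (t l : R) : 0 <= l -> 0 <= t -> 0 <= v t l.
Proof. by move=> /hv[_ h _ _]; exact: h. Qed.

Lemma cumulantE (t l : R) : 0 <= l -> 0 <= t ->
  v t l = l - \int[lebesgue_measure]_(s in `[0, t]) Phi (v s l).
Proof. by move=> /hv[_ _ _ h]; exact: h. Qed.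

Lemma cumulant_le (t l : R) : 0 <= l -> 0 <= t -> v t l <= l.
Proof.
move=> l0 t0; rewrite cumulantE// lerBlDr lerDl; apply: Rintegral_ge0 => s /=.
rewrite in_itv/= => /andP[s0 _].
by apply: (branching_mechanism_ge0 htriple halpha); exact: cumulant_ge0.
Qed.

Lemma measurable_mechanism_cumulant (t l : R) : 0 <= l -> 0 <= t ->
  measurable_fun `[0, t] (fun s => Phi (v s l)).
Proof.
move=> l0 t0.
have [mv _ _ _] := hv l l0.
(* [Phi] is monotone on the nonnegative half-line only; composed with the maximum with 0 it is
   monotone on the whole line, hence measurable. *)
apply: (@eq_measurable_fun _ _ _ _ _ ((fun y => Phi (Num.max y 0)) \o v^~ l)).
  move=> s; rewrite inE /= in_itv/= => /andP[s0 _].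
  by congr Phi; apply/max_idPl; exact: cumulant_ge0.
apply: measurableT_comp.
  apply: nondecreasing_measurable => // y z yz.
  apply: (branching_mechanism_le htriple halpha).
  by rewrite le_max lexx orbT/= ge_max !le_max yz lexx !orbT.
apply: measurable_funS mv => // s /=; rewrite !in_itv/= andbT.
by move=> /andP[].
Qed.

Lemma mechanism_cumulant_integrable (t l : R) : 0 <= l -> 0 <= t ->
  lebesgue_measure.-integrable `[0, t] (EFin \o (fun s => Phi (v s l))).
Proof.
move=> l0 t0; apply: (norm_le_integrable _ _ _ _ _ _ (Phi l)) => //.
- by rewrite lebesgue_measure_cc// ltry.
- exact: measurable_mechanism_cumulant.
- move=> s /=; rewrite in_itv/= => /andP[s0 _].
  have v0 := cumulant_ge0 s l l0 s0.
  rewrite ger0_norm ?(branching_mechanism_ge0 htriple halpha)//.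
  by apply: (branching_mechanism_le htriple halpha); rewrite v0 cumulant_le.
Qed.

Lemma Rintegral_itv_cst (t c : R) : 0 <= t ->
  \int[lebesgue_measure]_(s in `[0, t]) c = c * t.
Proof.
by move=> t0; rewrite Rintegral_cst// lebesgue_measure_cc// subr0.
Qed.

Lemma itv_cst_integrable (t c : R) : 0 <= t ->
  lebesgue_measure.-integrable `[0, t] (EFin \o (fun=> c)).
Proof.
move=> t0; apply: (norm_le_integrable _ _ _ _ _ _ `|c|) => //.
by rewrite lebesgue_measure_cc// ltry.
Qed.

Lemma cumulant_ge (t l : R) : 0 <= l -> 0 <= t -> l - t * Phi l <= v t l.
Proof.
move=> l0 t0; rewrite cumulantE// lerD2l lerN2 mulrC -Rintegral_itv_cst//.
apply: le_Rintegral => //.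
- exact: mechanism_cumulant_integrable.
- exact: itv_cst_integrable.
- move=> s /=; rewrite in_itv/= => /andP[s0 _].
  apply: (branching_mechanism_le htriple halpha).
  by rewrite cumulant_ge0// cumulant_le.
Qed.

(** On [0, t] the path of [v] is within t Phi(l) of l, so Phi(v_s) falls short of Phi(l) by at most
    L(l) t Phi(l). With [cumulant_ge] this gives v_t(l) = l - t Phi(l) + O(t^2). *)
Lemma cumulant_le2 (t l : R) : 0 <= l -> 0 <= t ->
  v t l <= l - t * Phi l + t ^+ 2 * (L l * Phi l).
Proof.
move=> l0 t0; 
have L0 : 0 <= L l by exact: (mechanism_lipschitz_ge0 htriple halpha).
have Phi0 : 0 <= Phi l by exact: (branching_mechanism_ge0 htriple halpha).
rewrite [leLHS]cumulantE// -addrA lerD2l -lerN2 opprK opprD opprK.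
have -> : t * Phi l - t ^+ 2 * (L l * Phi l) = (Phi l - L l * (t * Phi l)) * t by ring.
rewrite -Rintegral_itv_cst//; apply: le_Rintegral => //.
- exact: itv_cst_integrable.
- exact: mechanism_cumulant_integrable.
- move=> s /=; rewrite in_itv/= => /andP[s0 st].
  have v0 := cumulant_ge0 s l l0 s0; have vl := cumulant_le s l l0 s0.
  have /(branching_mechanism_lipschitz htriple halpha)/andP[_ h] : 0 <= v s l <= l.
    by rewrite v0.
  have : L l * (l - v s l) <= L l * (t * Phi l).
    rewrite ler_wpM2l// (le_trans _ (ler_wpM2r Phi0 st))//.
    by rewrite lerBlDr -lerBlDl cumulant_ge.
  lra.
Qed.

(** If v stayed above [delta] from [T0] on, it would lose at least [Phi delta > 0] per unit of time
    and become negative. *)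
Lemma cumulant_arbitrarily_small (l delta T0 : R) : pi setT <> 0%E -> 0 <= l ->
  0 < delta -> 0 <= T0 -> exists2 T, T0 <= T & v T l < delta.
Proof.
move=> hpi l0 d0 T00.
have Phid := branching_mechanism_gt0 htriple halpha _ hpi d0.
(* Over a time (l + 1) / Phi(delta) the loss is at least l + 1, more than the initial value l. *)
pose T := T0 + (l + 1) / Phi delta.
have TT : T0 <= T by rewrite /T lerDl (divr_ge0 (addr_ge0 l0 ler01) (ltW Phid)).
have T_ge0 : 0 <= T by exact: le_trans TT.
apply: contrapT => /forall2NP h.
have hge s : T0 <= s -> delta <= v s l.
  by move=> Ts; have [//|/negP] := h s; rewrite -leNgt.
have : v T l < 0.
  rewrite cumulantE// subr_lt0.
  apply: (@lt_le_trans _ _ (l + 1)); first by rewrite ltrDl.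
  have -> : l + 1 = \int[lebesgue_measure]_(s in `[0, T] `&` `[T0, T]) Phi delta.
    rewrite (_ : _ `&` _ = `[T0, T]%classic); last first.
      apply/setIidr => s /=; rewrite !in_itv/= => /andP[Ts ->].
      by rewrite (le_trans T00).
    rewrite Rintegral_cst// lebesgue_measure_cc//.
    by rewrite /T /= addrAC subrr add0r mulrCA divff ?mulr1// gt_eqF.
  rewrite Rintegral_mkcondr; apply: le_Rintegral => //.
  - apply: (norm_le_integrable _ _ _ _ _ _ (Phi delta)) => //.
    + by rewrite lebesgue_measure_cc// ltry.
    + by apply/measurable_restrict => //; exact: measurable_cst.
    + move=> s _; rewrite patchE.
      case: ifPn => _; first by rewrite ger0_norm// ltW.
      by rewrite -[point]/(0 : R) normr0 ltW.
  - exact: mechanism_cumulant_integrable.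
  - move=> s /=; rewrite in_itv/= => /andP[s0 sT]; rewrite patchE; case: ifPn => [|_].
      rewrite inE/= in_itv/= => /andP[Ts _].
      by apply: (branching_mechanism_le htriple halpha); rewrite (ltW d0) hge.
    by apply: (branching_mechanism_ge0 htriple halpha); exact: cumulant_ge0.
by apply/negP; rewrite -leNgt cumulant_ge0.
Qed.

End cumulant_semigroup.

(** * The Markov property for Laplace transforms *)

Section simple_approximation.
Context {d} {T : measurableType d} {R : realType}.
Import HBNNSimple.

Lemma nnsfun_sum (h : {nnsfun T >-> R}) :
  exists n (c : nat -> R) (A : nat -> set T),
    [/\ forall i, 0 <= c i, forall i, measurable (A i) &
        forall x, h x = \sum_(i < n) c i * \1_(A i) x].
Proof.
pose s : seq R := finmap.enum_fset (fset_set (range h)).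
(* The maximum with 0 makes nonnegativity immediate and changes no value, since [h] is
   nonnegative. *)
exists (size s), (fun i => Num.max 0 (nth 0 s i)), (fun i => h @^-1` [set nth 0 s i]).
split => [i|i|x]; first by rewrite le_max lexx.
  exact: measurable_sfunP.
rewrite fimfunE fsbig_finite//= (big_nth 0)/= big_mkord.
apply: eq_bigr => i _; rewrite -/s indicE; case: (boolP (x \in _)) => [|_]; last by rewrite !mulr0.
by rewrite inE /= => <-; congr (_ * _); apply/esym/max_idPr; exact: fun_ge0.
Qed.

Lemma ge0_simple_approx (f : T -> R) : measurable_fun setT f -> (forall x, 0 <= f x) ->
  exists (n : nat -> nat) (c : nat -> nat -> R) (A : nat -> nat -> set T),
    let h k x := \sum_(i < n k) c k i * \1_(A k i) x in
    [/\ forall k i, 0 <= c k i, forall k i, measurable (A k i),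
        forall x, nondecreasing_seq (h ^~ x) &
        forall x, (h k x)%:E @[k --> \oo] --> (f x)%:E].
Proof.
move=> mf f0.
have mEf : measurable_fun setT (EFin \o f) by exact/measurable_EFinP.
pose g := nnsfun_approx measurableT mEf.
have /choice[n /choice[c /choice[A hA]]] : forall k, exists n (c : nat -> R) (A : nat -> set T),
    [/\ forall i, 0 <= c i, forall i, measurable (A i) &
        forall x, g k x = \sum_(i < n) c i * \1_(A i) x].
  by move=> k; exact: nnsfun_sum.
exists n, c, A => h.
have hE k x : h k x = g k x by have [_ _ ->] := hA k.
split.
- by move=> k; have [] := hA k.
- by move=> k; have [] := hA k.
- move=> x k l kl; rewrite !hE.
  by have /(_ _ _ kl)/lefP/(_ x) := nd_nnsfun_approx measurableT mEf.
- move=> x; under eq_fun do rewrite hE.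
  by have := @cvg_nnsfun_approx _ _ _ _ measurableT _ mEf (fun x _ => f0 x) x I.
Qed.

End simple_approximation.

Section sub_sigma_algebra_integral.
Context {R : realType} {d d'} {Omega : measurableType d} {T : measurableType d'}.
Context (mu : {measure set Omega -> \bar R}) (phi : Omega -> T).
Context (mphi : measurable_fun setT phi).

(** Equality of conditional expectations given the sigma-algebra of [phi], extended from indicators
    to nonnegative weights by simple functions and monotone convergence. *)
Lemma ge0_integral_eq_sub (U V : Omega -> R) (Z : T -> R) :
  measurable_fun setT U -> measurable_fun setT V ->
  (forall w, 0 <= U w) -> (forall w, 0 <= V w) ->
  measurable_fun setT Z -> (forall x, 0 <= Z x) ->
  (forall A, measurable A ->
    \int[mu]_(w in phi @^-1` A) (U w)%:E = \int[mu]_(w in phi @^-1` A) (V w)%:E)%E ->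
  (\int[mu]_w (Z (phi w) * U w)%:E = \int[mu]_w (Z (phi w) * V w)%:E)%E.
Proof.
move=> mU mV U0 V0 mZ Z0 UV.
have [n [c [A [/= c0 mA ndh hZ]]]] := ge0_simple_approx Z mZ Z0.
pose h k x : R := \sum_(i < n k) c k i * \1_(A k i) x.
have h0 k x : 0 <= h k x by apply: sumr_ge0 => i _; rewrite mulr_ge0.
have mh k : measurable_fun setT (h k).
  by apply: measurable_sum => i; apply: measurable_funM => //; exact: measurable_cst.
have key (W : Omega -> R) : measurable_fun setT W -> (forall w, 0 <= W w) ->
    (\int[mu]_w (Z (phi w) * W w)%:E =
    limn (fun k => \sum_(i < n k) (c k i)%:E * \int[mu]_(w in phi @^-1` (A k i)) (W w)%:E))%E.
  move=> mW W0.
  have mAW k i : measurable_fun setT (fun w => \1_(A k i) (phi w) * W w).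
    apply: measurable_funM => //.
    by apply: (@measurableT_comp _ _ _ _ _ _ (\1_(A k i) : T -> R)).
  transitivity (limn (fun k => \int[mu]_w (h k (phi w) * W w)%:E))%E; last first.
    congr (limn _); apply/funext => k.
    under eq_integral => w _.
      rewrite /h mulr_suml -sumEFin.
      under eq_bigr do rewrite -mulrA.
      over.
    rewrite ge0_integral_sum//.
    - apply: eq_bigr => i _; under eq_integral do rewrite EFinM.
      rewrite ge0_integralZl//.
      + congr (_ * _)%E; rewrite [RHS]integral_mkcond; apply: eq_integral => w _.
        rewrite patchE indicE; have -> : (phi w \in A k i) = (w \in phi @^-1` A k i).
          by apply/idP/idP; rewrite !inE.
        by case: ifPn => _; rewrite ?mul1r ?mul0r.
      + exact/measurable_EFinP.
      + by move=> w _; rewrite lee_fin mulr_ge0.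
      + by rewrite lee_fin.
    - by move=> i; apply/measurable_EFinP; apply: measurable_funM.
    - by move=> i w _; rewrite lee_fin !mulr_ge0.
  rewrite -monotone_convergence//.
  - apply: eq_integral => w _; apply/esym/cvg_lim => //.
    under eq_fun do rewrite EFinM.
    by rewrite EFinM; apply: cvgeZr => //; exact: hZ.
  - move=> k; apply/measurable_EFinP; apply: measurable_funM => //.
    exact: measurableT_comp.
  - by move=> k w _; rewrite lee_fin mulr_ge0.
  - by move=> w _ k l kl; rewrite lee_fin ler_wpM2r//; exact: ndh.
rewrite key// key//; congr (limn _); apply/funext => k.
by apply: eq_bigr => i _; rewrite UV.
Qed.

End sub_sigma_algebra_integral.

Section markov.
Context {R : realType} {d : measure_display} {Omega : measurableType d}.
Context {X : R -> Omega -> R} {P : R -> probability Omega R}.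
Context (hM : is_rcll_markov X P).

(** The Markov property of sets passes to nonnegative functions by increasing simple approximations;
    measurability of the kernel integral is obtained along the same limit. *)
Lemma ge0_markov (x s t : R) (A : set Omega) (f : R -> R) :
  0 <= x -> 0 <= s -> 0 <= t -> history X t A -> measurable A ->
  measurable_fun setT f -> (forall y, 0 <= f y) ->
  measurable_fun A (fun w => \int[P (X t w)]_w' (f (X s w'))%:E)%E /\
  (\int[P x]_(w in A) (f (X (t + s) w))%:E =
   \int[P x]_(w in A) \int[P (X t w)]_w' (f (X s w'))%:E)%E.
Proof.
move=> x0 s0 t0 HA mA mf f0.
have mX u : 0 <= u -> measurable_fun setT (X u) by exact: mk_measurable hM _.
have ts0 : 0 <= t + s by rewrite addr_ge0.
have [n [c [B [/= c0 mB ndh hf]]]] := ge0_simple_approx f mf f0.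
pose h k x : R := \sum_(i < n k) c k i * \1_(B k i) x.
have h0 k y : 0 <= h k y by apply: sumr_ge0 => i _; rewrite mulr_ge0.
have mh k : measurable_fun setT (h k).
  by apply: measurable_sum => i; apply: measurable_funM => //; exact: measurable_cst.
have mpre u C : 0 <= u -> measurable C -> measurable (X u @^-1` C).
  by move=> u0 mC; rewrite -[_ @^-1` _]setTI; exact: mX.
have sumE (mu : {measure set Omega -> \bar R}) E u k : measurable E -> 0 <= u ->
    (\int[mu]_(w in E) (h k (X u w))%:E =
     \sum_(i < n k) (c k i)%:E * mu (E `&` X u @^-1` B k i))%E.
  move=> mE u0.
  under eq_integral do rewrite /h -sumEFin.
  rewrite ge0_integral_sum//.
  - apply: eq_bigr => i _; under eq_integral do rewrite EFinM.
    rewrite ge0_integralZl//.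
    + congr (_ * _)%E; rewrite setIC -integral_indic//; last exact: mpre.
    + apply/measurable_EFinP; apply: measurable_funTS.
      by apply: (@measurableT_comp _ _ _ _ _ _ (\1_(B k i) : R -> R)) => //; exact: mX.
    + by rewrite lee_fin.
  - move=> i; apply/measurable_EFinP; apply: measurable_funTS.
    apply: measurable_funM => //.
    by apply: (@measurableT_comp _ _ _ _ _ _ (\1_(B k i) : R -> R)) => //; exact: mX.
  - by move=> i w _; rewrite lee_fin mulr_ge0.
have cvgE (mu : {measure set Omega -> \bar R}) E u : measurable E -> 0 <= u ->
    (\int[mu]_(w in E) (h k (X u w))%:E @[k --> \oo] --> \int[mu]_(w in E) (f (X u w))%:E)%E.
  move=> mE u0.
  rewrite (eq_integral (fun w => limn (fun k => (h k (X u w))%:E))); last first.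
    by move=> w _; apply/esym/cvg_lim => //; exact: hf.
  apply: cvg_monotone_convergence => //.
  - move=> k; apply/measurable_EFinP; apply: measurable_funTS.
    by apply: (@measurableT_comp _ _ _ _ _ _ (h k)) => //; exact: mX.
  - by move=> k w _; rewrite lee_fin.
  - by move=> w _ k l kl; rewrite lee_fin; exact: ndh.
pose F k w : \bar R := (\int[P (X t w)]_w' (h k (X s w'))%:E)%E.
have FE k w : F k w = (\sum_(i < n k) (c k i)%:E * P (X t w) (X s @^-1` B k i))%E.
  by rewrite /F sumE//; apply: eq_bigr => i _; rewrite setTI.
have mPX C : measurable C -> measurable_fun setT (fun w => P (X t w) (X s @^-1` C)).
  move=> mC; rewrite (_ : (fun w => _) =
    (fun y => P y (X s @^-1` C) : \bar R) \o X t)//.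
  (* The kernel is measurable on the nonnegative half-line only, which is where [X t] takes its
     values. *)
  apply: (@measurable_comp _ _ _ Omega (measurableTypeR R) _ `[0, +oo[%classic) => //.
  - by move=> _ [w _ <-]; rewrite /= in_itv/= andbT; exact: (mk_ge0 hM).
  - exact: (mk_kernel hM).
  - exact: mX.
have mF k : measurable_fun A (F k).
  apply: measurable_funTS; rewrite (funext (FE k)).
  by apply: emeasurable_sum => i; apply: measurable_funeM; exact: mPX.
have F0 k w : (0 <= F k w)%E by apply: integral_ge0 => w' _; rewrite lee_fin.
have cvgF w : (F k w @[k --> \oo] --> \int[P (X t w)]_w' (f (X s w'))%:E)%E.
  exact: cvgE.
split.
  apply: (emeasurable_fun_cvg F) => // w _; exact: cvgF.
have := cvgE (P x) A (t + s) mA ts0.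
move=> /cvg_lim <- //.
rewrite (eq_integral (fun w => limn (F ^~ w))); last first.
  by move=> w _; apply/esym/cvg_lim => //; exact: cvgF.
rewrite monotone_convergence//; last first.
  move=> w _ k l kl; apply: ge0_le_integral => //.
  - by move=> w' _; rewrite lee_fin.
  - apply/measurable_EFinP.
    by apply: (@measurableT_comp _ _ _ _ _ _ (h k)) => //; exact: mX.
  - apply/measurable_EFinP.
    by apply: (@measurableT_comp _ _ _ _ _ _ (h l)) => //; exact: mX.
  - by move=> w' _; rewrite lee_fin; exact: ndh.
congr (limn _); apply/funext => k.
rewrite sumE//; under [RHS]eq_integral do rewrite FE.
rewrite ge0_integral_sum//.
- apply: eq_bigr => i _; rewrite ge0_integralZl//.
  + by congr (_ * _)%E; exact: (mk_markov hM).
  + by apply: measurable_funTS; exact: mPX.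
  + by rewrite lee_fin.
- by move=> i; apply: measurable_funTS; apply: measurable_funeM; exact: mPX.
- by move=> i w _; rewrite mule_ge0// lee_fin.
Qed.

End markov.

Section history.
Context {R : realType} {d : measure_display} {Omega : measurableType d}.
Context {X : R -> Omega -> R} {P : R -> probability Omega R}.
Context (hM : is_rcll_markov X P).

(** [Omega] carrying the sigma-algebra of the past up to [t], so that adaptedness becomes ordinary
    measurability of a function on this type. *)
Definition history_type (t : R) := g_sigma_algebraType
  (\bigcup_(u in `[0, t]) preimage_set_system setT (X u) measurable).

Lemma measurable_history_id t :
  measurable_fun (setT : set Omega) (id : Omega -> history_type t).
Proof.
move=> _ A hA; rewrite setTI preimage_id.
apply: (@smallest_sub _ (sigma_algebra setT) _ measurable) hA.
  exact: sigma_algebra_measurable.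
move=> B [u /=]; rewrite in_itv/= => /andP[u0 _] [C mC <-].
exact: (mk_measurable hM).
Qed.

Lemma measurable_history_fun t (Z : Omega -> R) :
  measurable_fun (setT : set (history_type t)) Z -> measurable_fun setT Z.
Proof.
by move=> mZ; apply: (measurableT_comp mZ (measurable_history_id t)).
Qed.

Lemma measurable_history_X u t : 0 <= u <= t ->
  measurable_fun (setT : set (history_type t)) (X u).
Proof.
move=> ut _ B mB; apply: sub_sigma_algebra; exists u; first by rewrite /= in_itv.
by exists B.
Qed.

Lemma history_type_le t t' (Z : Omega -> R) : t <= t' ->
  measurable_fun (setT : set (history_type t)) Z ->
  measurable_fun (setT : set (history_type t')) Z.
Proof.
move=> tt' mZ _ B mB.
have := mZ measurableT B mB.
apply: sub_sigma_algebra2 => C [u /=]; rewrite in_itv/= => /andP[u0 ut] hC.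
by exists u => //=; rewrite in_itv/= u0 (le_trans ut).
Qed.

Context {v : R -> R -> R}.
Context (hE : forall x t lambda : R, 0 <= x -> 0 <= t -> 0 <= lambda ->
      'E_(P x)[fun w => expR (- (lambda * X t w))]%E =
      (expR (- (x * v t lambda)))%:E).

(** Stated for extended integrals and without a bound on [Z]: in the expansion of a step, [Z]
    contains the unbounded factor e^{i X_t}. *)
Lemma laplace_markov (x s t mu : R) (Z : Omega -> R) :
  0 <= x -> 0 <= s -> 0 <= t -> 0 <= mu ->
  measurable_fun (setT : set (history_type t)) Z -> (forall w, 0 <= Z w) ->
  (\int[P x]_w (Z w * expR (- (mu * X (t + s) w)))%:E =
   \int[P x]_w (Z w * expR (- (X t w * v s mu)))%:E)%E.
Proof.
move=> x0 s0 t0 mu0 mZ Z0.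
have mX u : 0 <= u -> measurable_fun setT (X u) by move=> u0; exact: (mk_measurable hM).
have mexp : measurable_fun setT (fun y : R => expR (- (mu * y))).
  exact: measurable_expRN.
apply: (ge0_integral_eq_sub (P x) (id : Omega -> history_type t)
  (measurable_history_id t) (fun w => expR (- (mu * X (t + s) w)))
  (fun w => expR (- (X t w * v s mu))) Z) => //.
- by apply: (measurableT_comp mexp); apply: mX; rewrite addr_ge0.
- apply: measurableT_comp => //; apply: measurableT_comp => //.
  by apply: measurable_funM => //; exact: mX.
- move=> A hA; rewrite preimage_id.
  have mA : measurable (A : set Omega).
    by have := measurable_history_id t measurableT A hA; rewrite setTI preimage_id.
  have [_ ->] := ge0_markov hM x s t A (fun y => expR (- (mu * y)))
    x0 s0 t0 hA mA mexp (fun=> expR_ge0 _).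
  apply: eq_integral => w _.
  have := hE (X t w) s mu (mk_ge0 hM w t0) s0 mu0.
  by rewrite unlock.
Qed.

End history.

(** * Jumps of rcll paths and increments along grids *)

Section grid_increments.
Context {R : realType}.
Implicit Types (f : R -> R) (T r s t : R).

Definition grid T (n k : nat) : R := T * k%:R / n.+1%:R.

Definition grid_increment f T (n k : nat) : R := f (grid T n k.+1) - f (grid T n k).

Lemma right_limit_dist f t (eta : R) : f s @[s --> t^'+] --> f t -> 0 < eta ->
  exists2 delta, 0 < delta & forall s, t <= s < t + delta -> `|f t - f s| < eta.
Proof.
move=> /cvgrPdist_lt /(_ _ _) h eta0; have := h eta eta0.
move=> /nbhs_ballP[delta /= d0 hd]; exists delta => // s /andP[].
rewrite le_eqVlt => /predU1P[<- _|ts sd]; first by rewrite subrr normr0.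
apply: hd => //; rewrite /ball/= distrC ger0_norm ?subr_ge0 ?ltW//; lra.
Qed.

Lemma left_limit_dist f t (l eta : R) : f s @[s --> t^'-] --> l -> 0 < eta ->
  exists2 delta, 0 < delta & forall s, t - delta < s < t -> `|l - f s| < eta.
Proof.
move=> /cvgrPdist_lt /(_ _ _) h eta0; have := h eta eta0.
move=> /nbhs_ballP[delta /= d0 hd]; exists delta => // s /andP[sd st].
apply: hd => //; rewrite /ball/= ger0_norm ?subr_ge0 ?ltW//; lra.
Qed.

(** Two times on the same side of [t] have values close to a common one-sided limit; if [t]
    separates them, the increment is close to the jump at [t]. *)
Lemma rcll_local_increment f r t : rcll f -> 0 < r -> 0 <= t ->
  (0 < t -> jump f t < r) ->
  exists2 delta, 0 < delta & forall a b, 0 <= a <= b -> `|a - t| < delta ->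
    `|b - t| < delta -> f b - f a < r.
Proof.
move=> [fr fl] r0; rewrite le_eqVlt => /predU1P[<- _|t0 /(_ t0) jr].
  have [delta d0 hd] := right_limit_dist f 0 (r / 2) (fr 0 (lexx _)) (divr_gt0 r0 (ltr0n _ 2)).
  exists delta => // a b /andP[a0 ab].
  rewrite !subr0 !ger0_norm ?(le_trans a0)// => ad bd.
  have := hd a; have := hd b; rewrite add0r a0 ad bd (le_trans a0 ab)/=.
  by move=> /(_ isT); rewrite ltr_norml => h1 /(_ isT); rewrite ltr_norml; lra.
set l := lim (f s @[s --> t^'-]) in jr *.
(* Each value is within [eta] of its limit: [2 * eta <= r] serves two times on one side,
   [2 * eta <= r - jump] serves times separated by [t]. *)
pose eta := Num.min r (r - (f t - l)) / 2.
have [e1 e2] : 2 * eta <= r /\ 2 * eta <= r - (f t - l).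
  by rewrite /eta mulrC divfK// !ge_min !lexx orbT.
have eta0 : 0 < eta by rewrite divr_gt0// lt_min r0 subr_gt0.
have [d1 d10 h1] := right_limit_dist f t eta (fr t (ltW t0)) eta0.
have [d2 d20 h2] := left_limit_dist f t l eta (fl t t0) eta0.
exists (Num.min d1 d2); first by rewrite lt_min d10.
move=> a b /andP[a0 ab]; rewrite !lt_min => /andP[+ +] /andP[].
rewrite !ltr_norml => ad1 ad2 bd1 bd2.
have [at_|ta] := ltP a t; have [bt|tb] := ltP b t.
- have /h2 : t - d2 < a < t by lra.
  have /h2 : t - d2 < b < t by lra.
  by rewrite !ltr_norml; lra.
- have /h2 : t - d2 < a < t by lra.
  have /h1 : t <= b < t + d1 by lra.
  by rewrite !ltr_norml; lra.
- lra.
- have /h1 : t <= a < t + d1 by lra.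
  have /h1 : t <= b < t + d1 by lra.
  by rewrite !ltr_norml; lra.
Qed.

Lemma grid_ge0 T n k : 0 <= T -> 0 <= grid T n k.
Proof. by move=> T0; rewrite !mulr_ge0. Qed.

Lemma grid_le T n k : 0 <= T -> (k <= n.+1)%N -> grid T n k <= T.
Proof.
move=> T0 kn; rewrite /grid -mulrA ler_piMr// ler_pdivrMr ?ltr0n// mul1r.
by rewrite ler_nat.
Qed.

Lemma gridS T n k : grid T n k.+1 = grid T n k + T / n.+1%:R.
Proof. by rewrite /grid -natr1; ring. Qed.

Lemma grid0 T n : grid T n 0 = 0.
Proof. by rewrite /grid mulr0 mul0r. Qed.

Lemma grid_max T n : grid T n n.+1 = T.
Proof. by rewrite /grid mulfK. Qed.

Lemma mesh_small T (delta : R) : 0 <= T -> 0 < delta ->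
  \forall n \near \oo, T / n.+1%:R < delta.
Proof.
move=> T0 d0; near=> n.
rewrite ltr_pdivrMr ?ltr0n// mulrC -ltr_pdivrMr// (@lt_le_trans _ _ n%:R)//; last first.
  by rewrite ler_nat.
near: n; exact: nbhs_infty_gtr.
Unshelve. all: by end_near. Qed.

(** Compactness of [0, T] turns the local bounds into a bound valid for every step of a fine enough
    grid. *)
Lemma small_jumps_grid f T r : rcll f -> 0 < r -> 0 <= T ->
  (forall s, 0 < s <= T -> jump f s < r) ->
  \forall n \near \oo, forall k, (k < n.+1)%N -> grid_increment f T n k < r.
Proof.
move=> rf r0 T0 jr.
have /compact_near_coveringP/(_ nat \oo (fun n t => forall a b, 0 <= a <= b ->
   `|a - t| <= T / n.+1%:R -> `|b - t| <= T / n.+1%:R -> f b - f a < r) _) h :=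
  @segment_compact R 0 T.
have : \forall n \near \oo, `[0, T]%classic `<=` (fun t => forall a b, 0 <= a <= b ->
   `|a - t| <= T / n.+1%:R -> `|b - t| <= T / n.+1%:R -> f b - f a < r).
  apply: h => t /=; rewrite in_itv/= => /andP[t0 tT].
  have [|delta d0 hd] := rcll_local_increment f r t rf r0 t0.
    by move=> t_gt0; apply: jr; rewrite t_gt0.
  have d2 : 0 < delta / 2 by rewrite divr_gt0.
  near=> t' n => a b ab ha hb.
  have tt : `|t' - t| < delta / 2 by rewrite distrC; near: t'; exact: nbhsx_ballx.
  have Tn : T / n.+1%:R < delta / 2 by near: n; exact: mesh_small.
  apply: hd => //.
    by rewrite (le_lt_trans (ler_distD t' _ _))// [ltRHS]splitr ltrD// (le_lt_trans ha).
  by rewrite (le_lt_trans (ler_distD t' _ _))// [ltRHS]splitr ltrD// (le_lt_trans hb).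
apply: filterS => n hn k kn.
have h0 : 0 <= T / n.+1%:R by rewrite divr_ge0.
apply: (hn (grid T n k)).
- by rewrite /= in_itv/= grid_ge0// grid_le// ltnW.
- by rewrite grid_ge0//= gridS lerDl.
- by rewrite subrr normr0.
- by rewrite gridS addrAC subrr add0r ger0_norm.
Unshelve. all: by end_near. Qed.

Lemma big_jump_grid f T r s : rcll f -> 0 < s <= T -> r < jump f s ->
  \forall n \near \oo, exists2 k, (k < n.+1)%N & r < grid_increment f T n k.
Proof.
move=> [fr fl] /andP[s0 sT] rj; have T0 := lt_le_trans s0 sT.
set l := lim (f u @[u --> s^'-]) in rj *.
pose eta := (jump f s - r) / 2.
have eta0 : 0 < eta by rewrite divr_gt0// subr_gt0.
have [d1 d10 h1] := right_limit_dist f s eta (fr s (ltW s0)) eta0.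
have [d2 d20 h2] := left_limit_dist f s l eta (fl s s0) eta0.
near=> n.
have Tn1 : T / n.+1%:R < d1 by near: n; exact: mesh_small (ltW T0) _.
have Tn2 : T / n.+1%:R < d2 by near: n; exact: mesh_small (ltW T0) _.
(* The step wanted is the one with grid(k) < s <= grid(k+1): its left end approximates the left
   limit at s, its right end the value at s. *)
have hex : exists m : nat, s <= grid T n m by exists n.+1; rewrite grid_max.
case: (ex_minnP hex) => -[|k] sk kmin; first by move: sk; rewrite grid0 leNgt s0.
have ks : grid T n k < s.
  by rewrite ltNge; apply/negP => /kmin; rewrite ltnn.
exists k; first by apply: kmin; rewrite grid_max.
have gS := gridS T n k; set mesh := T / _ in gS Tn1 Tn2.
have /h2 : s - d2 < grid T n k < s by lra.
have /h1 : s <= grid T n k.+1 < s + d1 by lra.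
have : 2 * eta = f s - l - r by rewrite /eta mulrC divfK.
by rewrite /grid_increment !ltr_norml; lra.
Unshelve. all: by end_near. Qed.

End grid_increments.

Section jump_events.
Context {R : realType} {d : measure_display} {Omega : measurableType d}.
Context {X : R -> Omega -> R}.
Context (mX : forall t, 0 <= t -> measurable_fun setT (X t)).
Context (rX : forall w, rcll (fun t => X t w)).

Definition grid_event (T r : R) (n : nat) : set Omega :=
  [set w | exists2 k, (k < n.+1)%N & r < grid_increment (X ^~ w) T n k].

Lemma measurable_grid_increment (T : R) n k : 0 <= T ->
  measurable_fun setT (fun w => grid_increment (X ^~ w) T n k).
Proof. by move=> T0; apply: measurable_funB; apply: mX; exact: grid_ge0. Qed.

Lemma measurable_grid_event T r n : 0 <= T -> measurable (grid_event T r n).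
Proof.
move=> T0; rewrite (_ : grid_event T r n = \bigcup_(k in [set k | (k < n.+1)%N])
    [set w | r < grid_increment (X ^~ w) T n k]); last first.
  by apply/seteqP; split => w [k kn h]; exists k.
apply: bigcup_measurable => k _.
rewrite -[X in measurable X]setTI.
have -> : [set w | r < grid_increment (X^~ w) T n k] =
    (fun w => grid_increment (X ^~ w) T n k) @^-1` `]r, +oo[%classic.
  by apply/seteqP; split => w /=; rewrite in_itv/= andbT.
exact: measurable_grid_increment.
Qed.

Definition jump_event (T r : R) : set Omega :=
  [set w | exists2 s, 0 < s <= T & r < jump (X ^~ w) s].

(** The margin 1/(j+1) reconciles the two grid lemmas: a jump above [r] exceeds [r] by some margin
    and is seen by all fine grids, while jumps at most [r] are strictly below [r] plus the margin
    and leave no trace on fine grids. Measurability follows, as only countably many grids occur. *)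
Lemma jump_eventE T r : 0 <= T -> 0 <= r ->
  jump_event T r = \bigcup_j \bigcup_N \bigcap_(n in [set n | (N <= n)%N])
    grid_event T (r + j.+1%:R^-1) n.
Proof.
move=> T0 r0; apply/seteqP; split => w.
  move=> [s sT rs].
  have j0 : 0 < jump (X ^~ w) s - r by rewrite subr_gt0.
  exists (Num.truncn (jump (X ^~ w) s - r)^-1) => //.
  have : r + (Num.truncn (jump (X ^~ w) s - r)^-1).+1%:R^-1 < jump (X ^~ w) s.
    by rewrite -ltrBrDl invf_plt ?posrE// truncnS_gt.
  move=> /(big_jump_grid _ _ _ _ (rX w) sT)[N _ hN].
  by exists N => // n /= Nn; exact: hN.
move=> [j _ [N _ hN]]; apply: contrapT => /forall2NP h.
have : forall s, 0 < s <= T -> jump (X ^~ w) s < r + j.+1%:R^-1.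
  move=> s sT; have [//|/negP] := h s; rewrite -leNgt => /le_lt_trans; apply.
  by rewrite ltrDl invr_gt0.
move=> /(small_jumps_grid _ _ _ (rX w))[||M _ hM]//; first by rewrite ltr_wpDl.
have [k kn] := hN (maxn N M) (leq_maxl _ _).
by apply/negP; rewrite -leNgt ltW// hM//= leq_maxr.
Qed.

Lemma measurable_jump_event T r : 0 <= T -> 0 <= r -> measurable (jump_event T r).
Proof.
move=> T0 r0; rewrite jump_eventE//; apply: bigcup_measurable => j _.
apply: bigcup_measurable => N _; apply: bigcap_measurable => [|n _].
  by exists N => /=.
exact: measurable_grid_event.
Qed.

Lemma sup_jump_gtE r : [set w | (r%:E < sup_jump (X ^~ w))%E] =
  \bigcup_m jump_event m%:R r.
Proof.
apply/seteqP; split => w /=.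
  move=> /ereal_sup_gt[y [s /= + <-]]; rewrite in_itv/= andbT lte_fin => s0 rs.
  exists (Num.truncn s).+1 => //.
  by exists s => //; rewrite s0 ltW// truncnS_gt.
move=> [m _ [s /andP[s0 _] rs]].
apply: (@lt_le_trans _ _ (jump (X ^~ w) s)%:E); first by rewrite lte_fin.
by apply: ereal_sup_ubound; exists s => //=; rewrite in_itv/= andbT.
Qed.

Lemma measurable_sup_jump_gt r : 0 <= r ->
  measurable [set w | (r%:E < sup_jump (X ^~ w))%E].
Proof.
move=> r0; rewrite sup_jump_gtE; apply: bigcup_measurable => m _.
exact: measurable_jump_event.
Qed.

Lemma le_jump_event T T' r : T <= T' -> jump_event T r `<=` jump_event T' r.
Proof.
by move=> TT w [s /andP[s0 sT] rs]; exists s => //; rewrite s0 (le_trans sT).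
Qed.

End jump_events.

(** * One step of the chain *)

Section probability_integrals.
Context {R : realType} {d : measure_display} {T : measurableType d}.
Context (Q : probability T R).

Lemma prob_integrable (f : T -> R) C : measurable_fun setT f ->
  (forall w, `|f w| <= C) -> Q.-integrable setT (EFin \o f).
Proof.
move=> mf fC; apply: (norm_le_integrable _ _ _ _ _ _ C) => //.
by apply: (le_lt_trans (probability_le1 Q measurableT)); rewrite ltry.
Qed.

Lemma prob_Rintegral_cst (c : R) : \int[Q]_w c = c.
Proof.
rewrite Rintegral_cst//; have /(congr1 fine) := @probability_setT _ _ _ Q.
by move=> /= ->; rewrite mulr1.
Qed.

Lemma prob_Rintegral_norm_le (f : T -> R) C : measurable_fun setT f ->
  (forall w, `|f w| <= C) -> `|\int[Q]_w f w| <= C.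
Proof.
move=> mf fC; have fi := prob_integrable f C mf fC.
rewrite (le_trans (le_normr_Rintegral _ fi))// -[leRHS]prob_Rintegral_cst.
apply: le_Rintegral => //.
- apply: (prob_integrable _ C); first exact: measurableT_comp.
  by move=> w; rewrite normr_id.
- by apply: (prob_integrable _ `|C|).
Qed.

End probability_integrals.

Section exponential_bounds.
Context {R : realType}.
Implicit Types (l y w : R).

(** The constant comes from z <= e^z, squared, at z = l y / 4. *)
Lemma sq_expRN_le l y : 0 < l -> 0 <= y -> y ^+ 2 * expR (- (l * y / 2)) <= 16 / l ^+ 2.
Proof.
move=> l0 y0; have ly : 0 <= l * y / 4 by rewrite divr_ge0// mulr_ge0// ltW.
have h : (l * y / 4) ^+ 2 <= expR (l * y / 2).
  have -> : l * y / 2 = l * y / 4 + l * y / 4 by field.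
  rewrite expRD expr2 ler_pM//;
    by rewrite (le_trans _ (expR_ge1Dx _))// lerDr.
rewrite expRN ler_pdivrMr ?expR_gt0//.
have -> : y ^+ 2 = 16 / l ^+ 2 * (l * y / 4) ^+ 2 by field; rewrite gt_eqF.
by rewrite ler_wpM2l// divr_ge0// sqr_ge0.
Qed.

Lemma mul_expRN_le l y : 0 < l -> 0 <= y -> y * expR (- (l * y)) <= l^-1.
Proof.
move=> l0 y0; rewrite expRN ler_pdivrMr ?expR_gt0//.
have {1}-> : y = l^-1 * (l * y) by rewrite mulrA mulVf ?mul1r// gt_eqF.
rewrite ler_wpM2l ?invr_ge0 ?ltW//.
by rewrite (lt_le_trans _ (expR_ge1Dx _))// ltrDr.
Qed.

Lemma mul_expRN_tail_le l y K : 0 < l -> 0 < K -> K <= y ->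
  y * expR (- (l * y)) <= 16 / l ^+ 2 / K.
Proof.
move=> l0 K0 Ky; have y0 := lt_le_trans K0 Ky.
rewrite ler_pdivlMr//; apply: le_trans (sq_expRN_le l y l0 (ltW y0)).
rewrite mulrAC ler_pM ?expR_ge0 ?mulr_ge0 ?(ltW y0) ?(ltW K0)//.
  by rewrite expr2 ler_wpM2l// ltW.
by rewrite ler_expR lerN2 ler_piMr ?mulr_ge0 ?ltW// invf_lt1// ltr1n.
Qed.

(** The condition [w <= l / 2] leaves half of the exponential decay after multiplication by e^{y w},
    enough to absorb the factor y^2 of the second-order remainder uniformly in y. *)
Lemma expR_linearization l y w : 0 < l -> 0 <= y -> 0 <= w <= l / 2 ->
  `|expR (- (l * y)) * expR (y * w) - expR (- (l * y)) * (1 + y * w)| <= 16 / l ^+ 2 * w ^+ 2.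
Proof.
move=> l0 y0 /andP[w0 wl]; set a := y * w.
have a0 : 0 <= a by rewrite mulr_ge0.
rewrite -mulrBr normrM ger0_norm ?expR_ge0//.
have -> : expR a - (1 + a) = comp_exp (- a) by rewrite /comp_exp opprK; ring.
rewrite ger0_norm ?comp_exp_ge0//.
have h : comp_exp (- a) <= a ^+ 2 * expR a.
  have := comp_exp_sub_le (- a) 0; rewrite opprK /comp_exp oppr0 expR0.
  have h1 := expR_tangent a 0; rewrite expR0 in h1.
  have : a * (expR a - 1) <= a * (a * expR a) by rewrite ler_wpM2l//; lra.
  by lra.
apply: (@le_trans _ _ (expR (- (l * y)) * (a ^+ 2 * expR a))).
  by rewrite ler_wpM2l// expR_ge0.
have -> : expR (- (l * y)) * (a ^+ 2 * expR a) = (y ^+ 2 * expR (- (l * y) + a)) * w ^+ 2.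
  by rewrite expRD /a; ring.
rewrite ler_wpM2r ?sqr_ge0// (le_trans _ (sq_expRN_le l y l0 y0))//.
rewrite ler_wpM2l ?sqr_ge0// ler_expR.
have : a <= y * (l / 2) by rewrite ler_wpM2l.
lra.
Qed.

End exponential_bounds.

(** * First-order expansion over one step for polynomials in e^{-increment} *)

Section step_expansion.
Context {R : realType} {alpha beta : R} { pi : {measure set R -> \bar R}}.
Context (htriple : is_branching_triple alpha beta pi) (halpha : 0 <= alpha).
Local Notation Phi := (branching_mechanism alpha beta pi).
Local Notation L := (mechanism_lipschitz (alpha := alpha) (beta := beta) (pi := pi)).
Local Notation D := (`]0, +oo[%classic : set R).
Context {d : measure_display} {Omega : measurableType d}.
Context {X : R -> Omega -> R} {P : R -> probability Omega R}.
Context (hM : is_rcll_markov X P).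
Context {v : R -> R -> R} (hv : is_cumulant_semigroup Phi v).
Context (hE : forall x t lambda : R, 0 <= x -> 0 <= t -> 0 <= lambda ->
      'E_(P x)[fun w => expR (- (lambda * X t w))]%E =
      (expR (- (x * v t lambda)))%:E).
Context (l : R) (l0 : 0 < l).

Definition history_weight (t : R) (Z : Omega -> R) : Prop :=
  measurable_fun (setT : set (history_type (X := X) t)) Z /\ forall w, 0 <= Z w <= 1.

Local Notation decay t h w :=
  (expR (- (X (t + h) w - X t w))).

(* In terms of conditional expectations given the history up to time t:
   E[e^{-l X_{t+h}} q(e^{-(X_{t+h} - X_t)})] = e^{-l X_t} (q1 + h c X_t) + O(h^2). *)
Definition step_expansion (q : R -> R) (q1 c : R) : Prop :=
  exists C delta, [/\ 0 <= C, 0 < delta &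
    forall h x t Z, 0 < h <= delta -> 0 <= x -> 0 <= t -> history_weight t Z ->
    (P x).-integrable setT
      (EFin \o (fun w => Z w * expR (- (l * X (t + h) w)) * q (decay t h w))) /\
    `|\int[P x]_w (Z w * expR (- (l * X (t + h) w)) * q (decay t h w)) -
      (q1 * \int[P x]_w (Z w * expR (- (l * X t w))) +
       h * c * \int[P x]_w (Z w * (X t w * expR (- (l * X t w)))))| <= C * h ^+ 2].

Lemma measurable_X t : 0 <= t -> measurable_fun setT (X t).
Proof. by move=> t0; exact: (mk_measurable hM). Qed.

Lemma measurable_weight t Z : history_weight t Z -> measurable_fun setT Z.
Proof. by move=> [mZ _]; exact: (measurable_history_fun hM t). Qed.

Lemma measurable_expRN_X (c t : R) : 0 <= t ->
  measurable_fun setT (fun w => expR (- (c * X t w))).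
Proof.
move=> t0; apply: measurableT_comp => //; apply: measurableT_comp => //.
by apply: measurable_funM => //; exact: measurable_X.
Qed.

Lemma weight_exp_le1 t Z w : 0 <= t -> history_weight t Z ->
  `|Z w * expR (- (l * X t w))| <= 1.
Proof.
move=> t0 [_ /(_ w)/andP[Z0 Z1]].
rewrite ger0_norm ?mulr_ge0 ?expR_ge0// mulr_ile1 ?expR_ge0// expR_le1 oppr_le0.
by rewrite mulr_ge0 ?(mk_ge0 hM)// ltW.
Qed.

Lemma weight_mul_exp_le t Z w : 0 <= t -> history_weight t Z ->
  `|Z w * (X t w * expR (- (l * X t w)))| <= l^-1.
Proof.
move=> t0 [_ /(_ w)/andP[Z0 Z1]]; have X0 := mk_ge0 hM w t0.
rewrite ger0_norm ?mulr_ge0 ?expR_ge0// -[leRHS]mul1r ler_pM ?mulr_ge0 ?expR_ge0//.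
exact: mul_expRN_le.
Qed.

Lemma weight_exp_integrable x t Z : 0 <= t -> history_weight t Z ->
  (P x).-integrable setT (EFin \o (fun w => Z w * expR (- (l * X t w)))).
Proof.
move=> t0 hZ; apply: (prob_integrable _ _ 1).
  by apply: measurable_funM; [exact: measurable_weight hZ|exact: measurable_expRN_X].
by move=> w; exact: weight_exp_le1.
Qed.

Lemma weight_mul_exp_integrable x t Z : 0 <= t -> history_weight t Z ->
  (P x).-integrable setT (EFin \o (fun w => Z w * (X t w * expR (- (l * X t w))))).
Proof.
move=> t0 hZ; apply: (prob_integrable _ _ l^-1).
  apply: measurable_funM; first exact: measurable_weight hZ.
  by apply: measurable_funM; [exact: measurable_X|exact: measurable_expRN_X].
by move=> w; exact: weight_mul_exp_le.
Qed.

Lemma step_expansionD q q' q1 q1' c c' : step_expansion q q1 c ->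
  step_expansion q' q1' c' ->
  step_expansion (fun u => q u + q' u) (q1 + q1') (c + c').
Proof.
move=> [C [delta [C0 d0 hq]]] [C' [delta' [C'0 d'0 hq']]].
exists (C + C'), (Num.min delta delta'); split; rewrite ?addr_ge0 ?lt_min ?d0//.
move=> h x t Z /andP[h0]; rewrite le_min => /andP[hd hd'] x0 t0 hZ.
have [|i1 e1] := hq h x t Z _ x0 t0 hZ; first by rewrite h0.
have [|i2 e2] := hq' h x t Z _ x0 t0 hZ; first by rewrite h0.
split.
  have := integrableD measurableT i1 i2; apply: eq_integrable => // w _ /=.
  by rewrite -EFinD -mulrDr.
under eq_Rintegral do rewrite mulrDr.
rewrite RintegralD//; move: e1 e2; rewrite !ler_norml; lra.
Qed.

Lemma step_expansionZ a q q1 c : step_expansion q q1 c ->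
  step_expansion (fun u => a * q u) (a * q1) (a * c).
Proof.
move=> [C [delta [C0 d0 hq]]]; exists (`|a| * C), delta; split; rewrite ?mulr_ge0//.
move=> h x t Z hd x0 t0 hZ; have [i1 e1] := hq h x t Z hd x0 t0 hZ; split.
  have := integrableZl measurableT a i1; apply: eq_integrable => // w _ /=.
  by rewrite -EFinM mulrCA.
under eq_Rintegral do rewrite mulrCA.
rewrite RintegralZl//; set I := \int[P x]_w _; set N := \int[P x]_w _.
set J := \int[P x]_w _.
have -> : a * I - (a * q1 * N + h * (a * c) * J) = a * (I - (q1 * N + h * c * J)) by ring.
by rewrite normrM -[leRHS]mulrA ler_wpM2l.
Qed.

Lemma eq_step_expansion q q' q1 q1' c c' : step_expansion q q1 c ->
  q =1 q' -> q1 = q1' -> c = c' -> step_expansion q' q1' c'.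
Proof. by move=> hq /funext <- <- <-. Qed.

(** With mu = l + i the quantity is e^{i X_t} e^{-mu X_{t+h}}. Its conditional mean is e^{-l X_t}
    e^{X_t (mu - v_h(mu))}, and mu - v_h(mu) = h Phi(mu) + O(h^2). *)
Lemma step_expansion_exp (i : nat) : step_expansion (fun u => u ^+ i) 1 (Phi (l + i%:R)).
Proof.
set mu := l + i%:R; have mu0 : 0 <= mu by rewrite addr_ge0// ltW.
have Phi0 : 0 <= Phi mu := branching_mechanism_ge0 htriple halpha mu mu0.
have L0 : 0 <= L mu := mechanism_lipschitz_ge0 htriple halpha mu mu0.
exists (16 / l ^+ 2 * Phi mu ^+ 2 + l^-1 * (L mu * Phi mu)).
(* This step size gives h Phi(mu) <= l / 2, the condition under which [expR_linearization]
   applies. *)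
have d0 : 0 < l / 2 / (Phi mu + 1) by rewrite !divr_gt0// ltr_wpDl.
exists (l / 2 / (Phi mu + 1)); split => //.
  rewrite addr_ge0 ?mulr_ge0 ?sqr_ge0 ?invr_ge0 ?sqr_ge0 ?(ltW l0)//.
move=> h x t Z /andP[h0 hd] x0 t0 hZ; have th0 : 0 <= t + h by rewrite addr_ge0// ltW.
have [mhZ Z01] := hZ; have mZ := measurable_weight t Z hZ.
have hPhi : h * Phi mu <= l / 2.
  apply: (@le_trans _ _ (h * (Phi mu + 1))); first by rewrite ler_wpM2l ?lerDl// ltW.
  by rewrite -ler_pdivlMr// ltr_wpDl.
pose wh := mu - v h mu.
have wh1 : wh <= h * Phi mu.
  by rewrite lerBlDr -lerBlDl (cumulant_ge htriple halpha hv)// ltW.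
have wh0 : 0 <= wh by rewrite subr_ge0 (cumulant_le htriple halpha hv)// ltW.
have wh2 : h * Phi mu - wh <= h ^+ 2 * (L mu * Phi mu).
  have := cumulant_le2 htriple halpha hv h mu mu0 (ltW h0); rewrite /wh; lra.
have whl : wh <= l / 2 by exact: le_trans hPhi.
pose F w := Z w * (expR (- (l * X t w)) * expR (X t w * wh)).
have mF : measurable_fun setT F.
  apply: measurable_funM => //; apply: measurable_funM; first exact: measurable_expRN_X.
  by apply: measurableT_comp => //; apply: measurable_funM => //; exact: measurable_X.
have F01 w : 0 <= F w <= 1.
  have /andP[Z0 Z1] := Z01 w; have X0 := mk_ge0 hM w t0.
  rewrite /F -expRD mulr_ge0 ?expR_ge0//= mulr_ile1 ?expR_ge0// expR_le1.
  have : X t w * wh <= X t w * (l / 2) by rewrite ler_wpM2l.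
  have : 0 <= X t w * (l / 2) by rewrite mulr_ge0// divr_ge0// ltW.
  lra.
pose Zi w := Z w * expR (i%:R * X t w).
have mZi : measurable_fun (setT : set (history_type (X := X) t)) Zi.
  apply: measurable_funM => //; apply: measurableT_comp => //.
  apply: measurable_funM => //.
  by apply: measurable_history_X; rewrite t0 lexx.
have Zi0 w : 0 <= Zi w by have /andP[Z0 _] := Z01 w; rewrite mulr_ge0 ?expR_ge0.
pose G w := Z w * expR (- (l * X (t + h) w)) * decay t h w ^+ i.
have GE w : G w = Zi w * expR (- (mu * X (t + h) w)).
  rewrite /G /Zi -!mulrA -expRM_natl -!expRD; congr (_ * expR _).
  by rewrite /mu; ring.
have FE w : F w = Zi w * expR (- (X t w * v h mu)).
  rewrite /F /Zi -!mulrA -!expRD; congr (_ * expR _).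
  by rewrite /wh /mu; ring.
have GF : (\int[P x]_w (G w)%:E = \int[P x]_w (F w)%:E)%E.
  under eq_integral do rewrite GE; under [RHS]eq_integral do rewrite FE.
  apply: (laplace_markov hM) => //; last exact: ltW.
have iF : (P x).-integrable setT (EFin \o F).
  by apply: (prob_integrable _ _ 1) => // w; rewrite ger0_norm; have /andP[] := F01 w.
have mG : measurable_fun setT G.
  apply: measurable_funM; first by apply: measurable_funM => //; exact: measurable_expRN_X.
  apply: measurable_funX; apply: measurableT_comp => //; apply: measurableT_comp => //.
  by apply: measurable_funB; exact: measurable_X.
have G0 w : 0 <= G w by rewrite GE mulr_ge0 ?expR_ge0.
(* [G] has no evident bound, as the increment may be very negative; its integral is finite because
   it equals that of [F], which is at most 1. *)
have iG : (P x).-integrable setT (EFin \o G).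
  apply/integrableP; split; first exact/measurable_EFinP.
  under eq_integral do rewrite /= ger0_norm//.
  rewrite GF; have /integrableP[_] := iF; apply: le_lt_trans.
  apply: ge0_le_integral => //.
  - by move=> w _; have /andP[] := F01 w; rewrite lee_fin.
  - exact/measurable_EFinP.
  - by apply: measurableT_comp => //; exact/measurable_EFinP.
  - by move=> w _ /=; rewrite lee_fin ler_norm.
split => //.
rewrite [X in `|X - _|](_ : _ = \int[P x]_w F w); last by rewrite /Rintegral GF.
rewrite mul1r -RintegralZl//; last exact: weight_mul_exp_integrable.
rewrite -RintegralD//; last first.
- have := integrableZl measurableT (h * Phi mu) (weight_mul_exp_integrable x t Z t0 hZ).
  by apply: eq_integrable.
- exact: weight_exp_integrable.
rewrite -RintegralB//; last first.
  have := integrableD measurableT (weight_exp_integrable x t Z t0 hZ)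
    (integrableZl measurableT (h * Phi mu) (weight_mul_exp_integrable x t Z t0 hZ)).
  by apply: eq_integrable.
apply: prob_Rintegral_norm_le.
  apply: measurable_funB => //; apply: measurable_funD.
    by apply: measurable_funM => //; exact: measurable_expRN_X.
  apply: measurable_funM; first exact: measurable_cst.
  apply: measurable_funM => //; apply: measurable_funM; first exact: measurable_X.
  exact: measurable_expRN_X.
move=> w; have /andP[Z0 Z1] := Z01 w; have X0 := mk_ge0 hM w t0.
set e := expR (- (l * X t w)).
have -> : F w - (Z w * e + h * Phi mu * (Z w * (X t w * e))) =
    Z w * ((e * expR (X t w * wh) - e * (1 + X t w * wh)) - X t w * e * (h * Phi mu - wh)).
  by rewrite /F -/e; ring.
rewrite normrM ger0_norm// -[leRHS]mul1r ler_pM//.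
rewrite (le_trans (ler_normB _ _))// mulrDl lerD//.
  have hw : 0 <= wh <= l / 2 by rewrite wh0.
  rewrite (le_trans (expR_linearization l (X t w) wh l0 X0 hw))// -[leRHS]mulrA ler_wpM2l//.
    by rewrite divr_ge0// sqr_ge0.
  by rewrite -exprMn ler_sqr ?nnegrE ?mulr_ge0 ?(ltW h0)// mulrC.
rewrite normrM -mulrA ler_pM//.
  rewrite ger0_norm ?mulr_ge0 ?expR_ge0//; exact: mul_expRN_le.
by rewrite ger0_norm ?subr_ge0// [leRHS]mulrC.
Qed.

(** (1 - u)^2 u^i is a second difference of powers: the leading coefficients 1 - 2 + 1 cancel and
    the drift is the second difference of [Phi]. *)
Lemma step_expansion_sq (i : nat) :
  step_expansion (fun u => (1 - u) ^+ 2 * u ^+ i) 0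
    (Phi (l + i%:R) - 2 * Phi (l + i%:R + 1) + Phi (l + i%:R + 2)).
Proof.
apply: (eq_step_expansion _ _ _ _ _ _ (step_expansionD _ _ _ _ _ _ (step_expansionD _ _ _ _ _ _
  (step_expansion_exp i) (step_expansionZ (- 2) _ _ _ (step_expansion_exp i.+1)))
  (step_expansion_exp i.+2))).
- by move=> u; rewrite !exprS; ring.
- ring.
- rewrite (_ : l + i.+1%:R = l + i%:R + 1); last by rewrite -addrA natr1.
  by rewrite (_ : l + i.+2%:R = l + i%:R + 2) ?mulNr// -addrA -natrD addn2.
Qed.

Definition sq_kernel (i : nat) (p : {poly R}) (t : R) : R :=
  expR (- ((l + i%:R) * t)) * (1 - expR (- t)) ^+ 2 * p.[expR (- t)].

(** The integral of p(e^{-t}) against the finite measure of [branching_mechanism_diff2] at l + i;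
    the atom 2 beta sits at t = 0, that is at u = 1. *)
Definition poly_drift (i : nat) (p : {poly R}) : R :=
  2 * beta * p.[1] + \int[pi]_(t in D) sq_kernel i p t.

Lemma sq_kernel_const_integrable i :
  pi.-integrable D (EFin \o (fun t => expR (- ((l + i%:R) * t)) * (1 - expR (- t)) ^+ 2)).
Proof.
apply: (levy_integrable htriple _ 1).
  apply: measurable_funM; first exact: measurable_expRN.
  apply: measurable_funX; apply: measurable_funB => //.
  by apply: measurable_funTS; apply: measurableT_comp => //; exact: measurableT_comp.
move=> t t0; have := @sq_kernel_le R (fun=> 1) 1 (l + i%:R) t.
by rewrite mulr1; apply; rewrite ?normr1// addr_ge0// ltW.
Qed.

(** Induction along Horner's scheme. The exponent [i] is universally quantified because the factor
    'X is absorbed by passing to [i.+1]. *)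
Lemma step_expansion_poly (p : {poly R}) : forall i : nat,
  pi.-integrable D (EFin \o sq_kernel i p) /\
  step_expansion (fun u => (1 - u) ^+ 2 * u ^+ i * p.[u]) 0 (poly_drift i p).
Proof.
elim/poly_ind: p => [|p c IH] i.
  have E t : sq_kernel i 0 t = 0 by rewrite /sq_kernel horner0 mulr0.
  split.
    by apply: eq_integrable (integrable0 pi D) => // t _ /=; rewrite E.
  apply: (eq_step_expansion _ _ _ _ _ _ (step_expansionZ 0 _ _ _ (step_expansion_sq i))).
  - by move=> u; rewrite horner0 mulr0 mul0r.
  - by rewrite mulr0.
  - rewrite mul0r /poly_drift horner0 mulr0 add0r.
    by under eq_Rintegral do rewrite E; rewrite Rintegral_cst// mul0r.
have [iS hS] := IH i.+1.
have E t : sq_kernel i (p * 'X + c%:P) t = sq_kernel i.+1 p t +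
    c * (expR (- ((l + i%:R) * t)) * (1 - expR (- t)) ^+ 2).
  rewrite /sq_kernel hornerMXaddC.
  have -> : - ((l + i.+1%:R) * t) = - ((l + i%:R) * t) + - t by rewrite -natr1; ring.
  by rewrite expRD; ring.
have ic : pi.-integrable D (EFin \o (fun t => c * (expR (- ((l + i%:R) * t)) * (1 - expR (- t)) ^+ 2))).
  have := integrableZl (measurable_itv _) c (sq_kernel_const_integrable i).
  by apply: eq_integrable.
split.
  have := integrableD (measurable_itv _) iS ic; apply: eq_integrable => // t _ /=.
  by rewrite E EFinD.
apply: (eq_step_expansion _ _ _ _ _ _ (step_expansionD _ _ _ _ _ _ hS
  (step_expansionZ c _ _ _ (step_expansion_sq i)))).
- by move=> u; rewrite hornerMXaddC (exprS u); ring.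
- by rewrite mulr0 addr0.
- rewrite (branching_mechanism_diff2 htriple) ?addr_ge0 ?(ltW l0)//.
  rewrite /poly_drift; under [in RHS]eq_Rintegral do rewrite E.
  rewrite RintegralD// RintegralZl//; last exact: sq_kernel_const_integrable.
  by rewrite hornerMXaddC; ring.
Qed.

End step_expansion.

(** * Continuous cutoffs of large increments *)

Section ramp.
Context {R : realType} (a b : R).
Hypotheses (ab : a < b) (b1 : b < 1).
Implicit Types u w : R.

Definition clamp (x : R) : R := Num.max 0 (Num.min 1 x).

Lemma clamp_lipschitz (x y : R) : `|clamp x - clamp y| <= `|x - y|.
Proof.
have h1 : x - y <= `|x - y| := ler_norm _.
have h2 : y - x <= `|x - y| by rewrite distrC ler_norm.
move: h1 h2; set n := `|x - y| => h1 h2.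
rewrite /clamp ler_norml; have [] := leP 1 x; have [] := leP 1 y => h3 h4;
  rewrite ?(max_idPr ler01).
- lra.
- have [] := leP 0 y; lra.
- have [] := leP 0 x; lra.
- have [] := leP 0 x; have [] := leP 0 y; lra.
Qed.

Lemma clamp01 (x : R) : 0 <= clamp x <= 1.
Proof. by rewrite /clamp le_max lexx ge_max ler01 ge_min lexx. Qed.

(** Used with [a] = e^{-r2} and [b] = e^{-r1} at u = e^{-increment}: it is 1 when the increment is
    at least r2 and 0 when it is at most r1. *)
Definition ramp u : R := clamp ((b - u) / (b - a)).

Lemma ramp01 u : 0 <= ramp u <= 1. Proof. exact: clamp01. Qed.

Lemma ramp1 u : u <= a -> ramp u = 1.
Proof.
move=> ua; rewrite /ramp /clamp (min_idPl _) ?(max_idPr ler01)//.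
by rewrite ler_pdivlMr ?subr_gt0// mul1r lerD2l lerN2.
Qed.

Lemma ramp0 u : b <= u -> ramp u = 0.
Proof.
move=> bu; rewrite /ramp /clamp; apply/max_idPl.
by rewrite ge_min ler_pdivrMr ?subr_gt0// mul0r subr_le0 bu orbT.
Qed.

Lemma ramp_lipschitz u w : `|ramp u - ramp w| <= (b - a)^-1 * `|u - w|.
Proof.
rewrite (le_trans (clamp_lipschitz _ _))// -mulrBl normrM mulrC.
rewrite ger0_norm ?invr_ge0 ?subr_ge0 ?(ltW ab)//.
by rewrite (_ : b - u - (b - w) = - (u - w)) ?normrN//; ring.
Qed.

Lemma measurable_ramp : measurable_fun setT ramp.
Proof.
apply: measurable_maxr => //; apply: measurable_minr => //.
by apply: measurable_funM => //; exact: measurable_funB.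
Qed.

(** The ramp divided by (1 - u)^2. Capping u at [b], beyond which the ramp vanishes, removes the
    singularity at u = 1 and makes the quotient Lipschitz on the whole line. *)
Definition ramp_quotient u : R := ramp u * (1 - Num.min u b) ^- 2.

Let c := 1 - b.
Let c0 : 0 < c. Proof. by rewrite subr_gt0. Qed.

Lemma subr1_min_ge u : c <= 1 - Num.min u b.
Proof. by rewrite /c lerD2l lerN2 ge_min lexx orbT. Qed.

Lemma subr1_min_gt0 u : 0 < 1 - Num.min u b.
Proof. exact: lt_le_trans (subr1_min_ge u). Qed.

Lemma ramp_quotientE u : ramp u = (1 - u) ^+ 2 * ramp_quotient u.
Proof.
rewrite /ramp_quotient; have [ub|bu] := leP u b.
  have h : 1 - u != 0 by rewrite gt_eqF// subr_gt0 (le_lt_trans ub).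
  by field.
by rewrite ramp0 ?(ltW bu)// mul0r mulr0.
Qed.

Lemma ramp_quotient_bound u : 0 <= ramp_quotient u <= c ^- 2.
Proof.
have /andP[r0 r1] := ramp01 u; have s0 := subr1_min_gt0 u.
rewrite mulr_ge0 ?invr_ge0 ?sqr_ge0//= -[leRHS]mul1r ler_pM ?invr_ge0 ?sqr_ge0//.
by rewrite lef_pV2 ?posrE ?exprn_gt0// ler_sqr ?nnegrE ?(ltW c0) ?(ltW s0)// subr1_min_ge.
Qed.

Lemma ramp_quotient_lipschitz : exists L, forall u w,
  `|ramp_quotient u - ramp_quotient w| <= L * `|u - w|.
Proof.
(* Product rule: the ramp has slope 1/(b - a) and the inverse square is at most c^{-2}; the ramp is
   at most 1 and the inverse square has slope at most 2 c^{-3}. *)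
exists ((b - a)^-1 * c ^- 2 + 2 * c ^- 3) => u w.
set A := 1 - Num.min u b; set B := 1 - Num.min w b.
have A0 : 0 < A := subr1_min_gt0 u; have B0 : 0 < B := subr1_min_gt0 w.
have cA : A^-1 <= c^-1 by rewrite lef_pV2 ?posrE// subr1_min_ge.
have cB : B^-1 <= c^-1 by rewrite lef_pV2 ?posrE// subr1_min_ge.
have iA : 0 <= A^-1 by rewrite invr_ge0 ltW.
have iB : 0 <= B^-1 by rewrite invr_ge0 ltW.
have AB : `|A - B| <= `|u - w|.
  rewrite /A /B (_ : 1 - Num.min u b - (1 - Num.min w b) = Num.min w b - Num.min u b).
    have h1 : u - w <= `|u - w| := ler_norm _.
    have h2 : w - u <= `|u - w| by rewrite distrC ler_norm.
    move: h1 h2; set n := `|u - w| => h1 h2; rewrite ler_norml.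
    by have [] := leP u b; have [] := leP w b; lra.
  by ring.
have -> : ramp_quotient u - ramp_quotient w =
    (ramp u - ramp w) * A^-1 ^+ 2 + ramp w * ((B - A) * (A^-1 ^+ 2 * B^-1 + A^-1 * B^-1 ^+ 2)).
  by rewrite /ramp_quotient -/A -/B; field; rewrite !gt_eqF.
rewrite (le_trans (ler_normD _ _))// [leRHS]mulrDl lerD//.
  rewrite normrM mulrAC ler_pM// ?ramp_lipschitz//.
  rewrite ger0_norm ?sqr_ge0// -exprVn ler_sqr ?nnegrE// invr_ge0 ltW//.
have /andP[r0 r1] := ramp01 w.
rewrite normrM ger0_norm// -[leRHS]mul1r ler_pM// normrM mulrC ler_pM//; last by rewrite distrC.
have cc : 0 <= c^-1 by rewrite invr_ge0 ltW.
rewrite ger0_norm ?addr_ge0 ?mulr_ge0 ?sqr_ge0// mulr_natl mulr2n -exprVn lerD//.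
  by rewrite [leRHS]exprSr ler_pM ?sqr_ge0// ler_sqr ?nnegrE.
by rewrite [leRHS]exprS ler_pM ?sqr_ge0// ler_sqr ?nnegrE.
Qed.

End ramp.

Section error_bookkeeping.
Context {R : realType}.

Lemma three_quarters_le (e : R) : 0 < e -> e / 4 + e / 4 + e / 4 <= e.
Proof. lra. Qed.

Lemma error_sum_le (A B C E s i : R) (c1 c2 c3 v ed gv gd gc e : R) :
  `|A| <= c3 -> `|B| <= v -> v <= ed + c2 -> `|C| <= c1 -> `|E| <= ed ->
  0 <= s <= gv -> gv <= gd + gc -> 0 <= i -> 0 <= gd -> 0 <= gc -> 0 <= ed ->
  c1 + c2 + c3 + gc + 2 * ed + (gd + i) <= e ->
  `|A - B - C - E - (s - i)| <= e.
Proof. by rewrite !ler_norml; lra. Qed.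

End error_bookkeeping.

Section one_step.
Context {R : realType} {alpha beta : R} { pi : {measure set R -> \bar R}}.
Context (htriple : is_branching_triple alpha beta pi) (halpha : 0 <= alpha).
Local Notation Phi := (branching_mechanism alpha beta pi).
Local Notation D := (`]0, +oo[%classic : set R).
Context {d : measure_display} {Omega : measurableType d}.
Context {X : R -> Omega -> R} {P : R -> probability Omega R}.
Context (hM : is_rcll_markov X P).
Context {v : R -> R -> R} (hv : is_cumulant_semigroup Phi v).
Context (hE : forall x t lambda : R, 0 <= x -> 0 <= t -> 0 <= lambda ->
      'E_(P x)[fun w => expR (- (lambda * X t w))]%E =
      (expR (- (x * v t lambda)))%:E).
Context (l : R) (l0 : 0 < l) (a b : R) (ab : a < b) (b1 : b < 1).

(** A continuous version of T_r(l), lying between the tails at the two levels of the ramp. *)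
Definition ramp_integral : R :=
  \int[pi]_(t in D) (expR (- (l * t)) * ramp a b (expR (- t))).

Lemma ramp_integrable :
  pi.-integrable D (EFin \o (fun t => expR (- (l * t)) * ramp a b (expR (- t)))).
Proof.
apply: (levy_integrable htriple _ ((1 - b) ^- 2)).
  apply: measurable_funM; first exact: measurable_expRN.
  apply: measurable_funTS; apply: (measurableT_comp (measurable_ramp a b)).
  by apply: measurableT_comp => //; exact: measurableT_comp.
move=> t t0; rewrite (ramp_quotientE a b ab b1) mulrA.
have /andP[q0 q1] := ramp_quotient_bound a b b1 (expR (- t)).
apply: (sq_kernel_le (fun t => ramp_quotient a b (expR (- t)))) => //.
- exact: ltW.
- exact: le_trans q1.
- by rewrite ger0_norm.
Qed.

Local Notation decay t h w := (expR (- (X (t + h) w - X t w))).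

(* The ramp is (1 - u)^2 times a bounded Lipschitz function of u = e^{-increment}, which is replaced by
   a polynomial on {X_t <= K}, where u <= e^K; on {X_t > K} the factor e^{-l X} makes everything small. *)
Lemma one_step (eps : R) : 0 < eps -> exists2 delta, 0 < delta &
  forall h x t Z, 0 < h <= delta -> 0 <= x -> 0 <= t -> history_weight (X := X) t Z ->
  `|\int[P x]_w (Z w * expR (- (l * X (t + h) w)) * (1 - ramp a b (decay t h w))) -
    (\int[P x]_w (Z w * expR (- (l * X t w))) +
     h * (Phi l - ramp_integral) * \int[P x]_w (Z w * (X t w * expR (- (l * X t w)))))|
  <= eps * h.
Proof.
move=> e0.
pose D2 := Phi l - 2 * Phi (l + 1) + Phi (l + 2).
have [G [G0 hG]] : exists G, 0 <= G /\ forall u, 0 <= ramp_quotient a b u <= G.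
  exists ((1 - b) ^- 2); split; first by rewrite invr_ge0 sqr_ge0.
  exact: ramp_quotient_bound.
have D2E : D2 = 2 * beta + \int[pi]_(t in D) (expR (- (l * t)) * (1 - expR (- t)) ^+ 2).
  by rewrite /D2 (branching_mechanism_diff2 htriple) ?ltW.
have be0 := bt_beta_ge0 htriple.
have D20 : 0 <= D2.
  rewrite D2E addr_ge0 ?mulr_ge0//; apply: Rintegral_ge0 => t _.
  by rewrite mulr_ge0 ?expR_ge0 ?sqr_ge0.
have I0 : 0 <= ramp_integral.
  apply: Rintegral_ge0 => t _; rewrite mulr_ge0 ?expR_ge0//.
  by have /andP[] := ramp01 a b (expR (- t)).
set I := ramp_integral in I0 *.
pose c16 : R := 16 / l ^+ 2.
have c160 : 0 <= c16 by rewrite divr_ge0// sqr_ge0.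
(* Chosen so that the part {X_t > K}, where the mean of X e^{-l X} is at most [c16 / K], contributes
   at most eps / 4. *)
pose K := (G * D2 + I + 1) * (c16 + 1) * 4 / eps.
have GDI : 0 < G * D2 + I + 1 by rewrite ltr_wpDl// addr_ge0// mulr_ge0.
have K0 : 0 < K by rewrite !mulr_gt0 ?invr_gt0// ltr_wpDl.
have frac (z : R) : 0 <= z -> 0 <= z / (z + 1) <= 1.
  by move=> z0; rewrite divr_ge0 ?addr_ge0//= ler_pdivrMr ?ltr_wpDl// mul1r lerDl.
have hK : (G * D2 + I) * (c16 / K) <= eps / 4.
  set z := G * D2 + I in GDI *; have z0 : 0 <= z by rewrite addr_ge0// mulr_ge0.
  have -> : z * (c16 / K) = eps / 4 * (z / (z + 1) * (c16 / (c16 + 1))).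
    by rewrite /K -/z; field; rewrite !gt_eqF// ltr_wpDl.
  rewrite -[leRHS]mulr1 ler_wpM2l ?divr_ge0 ?(ltW e0)//.
  have /andP[z1 z2] := frac z z0; have /andP[y1 y2] := frac c16 c160.
  by rewrite mulr_ile1.
(* Accuracy of the polynomial. It is paid twice, in the drift and in the mean, against a mean of X
   e^{-l X} at most 1/l, hence the 8; the cap 1 bounds [et * C2] by [C2]. *)
pose et := Num.min 1 (eps * l / (8 * (D2 + 1))).
have D21 : 0 < D2 + 1 by rewrite ltr_wpDl.
have et0 : 0 < et by rewrite lt_min ltr01 divr_gt0// mulr_gt0.
have et1 : et <= 1 by rewrite ge_min lexx.
have het : 2 * (et * D2 / l) <= eps / 4.
  apply: (@le_trans _ _ (2 * (eps * l / (8 * (D2 + 1)) * (D2 + 1) / l))).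
    rewrite ler_wpM2l// ler_wpM2r ?invr_ge0 ?(ltW l0)//.
    rewrite ler_pM ?(ltW et0)// ?lerDl//.
    by rewrite ge_min lexx orbT.
  by rewrite le_eqVlt; apply/orP; left; apply/eqP; field; rewrite !gt_eqF.
have [Lq hLq] := ramp_quotient_lipschitz a b ab b1.
have [p hp] := lipschitz_poly_approx (ramp_quotient a b) Lq (expR K) et hLq (expR_gt0 K) et0.
have [_ [C1 [d1 [C10 d10 h1]]]] := step_expansion_poly htriple halpha hM hv hE l l0 p 0.
have [C2 [d2 [C20 d20 h2]]] := step_expansion_sq htriple halpha hM hv hE l l0 0.
have [C3 [d3 [C30 d30 h3]]] := step_expansion_exp htriple halpha hM hv hE l l0 0.
set cp := poly_drift _ _ _ in h1.
have h1K : 1 <= expR K :> R by rewrite (le_trans _ (expR_ge1Dx _))// lerDl ltW.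
(* [D2] is the total mass of the measure integrated in [cp], so a uniform error [et] costs at most
   [et * D2]. The atom is harmless since [ramp_quotient] vanishes at u = 1. *)
have hcp : `|cp - I| <= et * D2.
  have mq : measurable_fun D (fun t : R => expR (- (l * t)) * (1 - expR (- t)) ^+ 2).
    apply: measurable_funM; first exact: measurable_expRN.
    apply: measurable_funX; apply: measurable_funB => //.
    by apply: measurable_funTS; apply: measurableT_comp => //; exact: measurableT_comp.
  have iS := (step_expansion_poly htriple halpha hM hv hE l l0 p 0).1.
  have iq : pi.-integrable D (EFin \o (fun t : R => expR (- (l * t)) * (1 - expR (- t)) ^+ 2)).
    have := sq_kernel_const_integrable htriple l l0 0.
    by apply: eq_integrable => // t _ /=; rewrite addr0.
  have idiff : pi.-integrable D (EFin \o (fun t : R =>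
      sq_kernel l 0 p t - expR (- (l * t)) * ramp a b (expR (- t)))).
    by have := integrableB (measurable_itv _) iS ramp_integrable; apply: eq_integrable.
  rewrite /cp /poly_drift -/I -addrA /I /ramp_integral -RintegralB//; last exact: ramp_integrable.
  rewrite (le_trans (ler_normD _ _))// D2E mulrDr lerD//.
    rewrite normrM ger0_norm ?mulr_ge0// mulrC ler_wpM2r ?mulr_ge0//.
    have := hp 1; rewrite ler01 h1K => /(_ isT).
    by rewrite /ramp_quotient (ramp0 _ _ ab) ?(ltW b1)// mul0r subr0.
  rewrite (le_trans (le_normr_Rintegral _ idiff))// -RintegralZl//.
  apply: le_Rintegral => //.
  - by have := integrable_norm idiff; apply: eq_integrable.
  - by have := integrableZl (measurable_itv _) et iq; apply: eq_integrable.
  - move=> t /=; rewrite in_itv/= andbT => t0.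
    rewrite [X in `|X|](_ : _ = (expR (- (l * t)) * (1 - expR (- t)) ^+ 2) *
        (p.[expR (- t)] - ramp_quotient a b (expR (- t)))); last first.
      by rewrite /sq_kernel addr0 (ramp_quotientE a b ab b1 (expR (- t))); ring.
    have k0 : 0 <= expR (- (l * t)) * (1 - expR (- t)) ^+ 2.
      by rewrite mulr_ge0 ?expR_ge0 ?sqr_ge0.
    rewrite normrM (ger0_norm k0) mulrC ler_wpM2r//.
    apply: hp; rewrite expR_ge0/= (le_trans _ h1K)// expR_le1 oppr_le0; exact: ltW.
have Ctot : 0 < 4 * (C1 + C2 + C3 + G * C2 + 1).
  by rewrite mulr_gt0// ltr_wpDl// !addr_ge0// mulr_ge0.
(* Makes all remainders of order h^2 together at most h eps / 4. *)
pose d4 := eps / (4 * (C1 + C2 + C3 + G * C2 + 1)).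
have d40 : 0 < d4 by rewrite divr_gt0.
exists (Num.min (Num.min d1 d2) (Num.min d3 d4)); first by rewrite !lt_min d10 d20 d30.
move=> h x t Z /andP[h0]; rewrite !le_min => /andP[/andP[hd1 hd2] /andP[hd3 hd4]] x0 t0 hZ.
have th0 : 0 <= t + h by rewrite addr_ge0// ltW.
have [mhZ Z01] := hZ.
(* The split according to X_t <= K depends on the past only, so both parts of [Z] are again
   admissible weights. *)
pose i1 (y : R) : R := \1_(`]-oo, K]%classic) y.
pose i2 (y : R) : R := \1_(`]K, +oo[%classic) y.
have i1E y : i1 y = (y <= K)%R%:R by rewrite /i1 indicE mem_setE in_itv.
have i2E y : i2 y = (K < y)%R%:R by rewrite /i2 indic_itv_oy.
have i12 y : i1 y + i2 y = 1.
  by rewrite i1E i2E; have [] := leP y K => _ /=; rewrite ?addr0 ?add0r.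
pose Z1 w := Z w * i1 (X t w); pose Z2 w := Z w * i2 (X t w).
have mhX : measurable_fun (setT : set (history_type (X := X) t)) (X t).
  by apply: measurable_history_X; rewrite t0 lexx.
have hZ1 : history_weight (X := X) t Z1.
  split; first by apply: measurable_funM => //; apply: (measurableT_comp _ mhX); exact: measurable_indic.
  move=> w; have /andP[z0 z1] := Z01 w; rewrite /Z1 i1E.
  by case: (X t w <= K); rewrite ?mulr1 ?mulr0 ?z0 ?lexx ?ler01.
have hZ2 : history_weight (X := X) t Z2.
  split; first by apply: measurable_funM => //; apply: (measurableT_comp _ mhX); exact: measurable_indic.
  move=> w; have /andP[z0 z1] := Z01 w; rewrite /Z2 i2E.
  by case: (K < X t w); rewrite ?mulr1 ?mulr0 ?z0 ?lexx ?ler01.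
pose e w := expR (- (l * X (t + h) w)); pose u w := decay t h w.
have e0' w : 0 <= e w by exact: expR_ge0.
have e1' w : e w <= 1 by rewrite expR_le1 oppr_le0 mulr_ge0 ?(mk_ge0 hM)// ltW.
have me : measurable_fun setT e by exact: (measurable_expRN_X hM).
have mu : measurable_fun setT u.
  apply: measurableT_comp => //; apply: measurableT_comp => //.
  by apply: measurable_funB; exact: (measurable_X hM).
pose N := \int[P x]_w (Z w * expR (- (l * X t w))).
pose J (Z' : Omega -> R) := \int[P x]_w (Z' w * (X t w * expR (- (l * X t w)))).
pose S0 := \int[P x]_w (Z w * e w).
pose V (Z' : Omega -> R) := \int[P x]_w (Z' w * e w * (1 - u w) ^+ 2).
pose Q := \int[P x]_w (Z1 w * e w * ((1 - u w) ^+ 2 * p.[u w])).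
pose S (Z' : Omega -> R) := \int[P x]_w (Z' w * e w * ramp a b (u w)).
have [iS0 eS0] : (P x).-integrable setT (EFin \o (fun w => Z w * e w)) /\
    `|S0 - (N + h * Phi l * J Z)| <= C3 * h ^+ 2.
  have [|i3 e3] := h3 h x t Z _ x0 t0 hZ; first by rewrite h0.
  split; first by apply: eq_integrable i3 => // w _ /=; rewrite expr0 mulr1.
  move: e3; rewrite addr0 mul1r; congr (`|_ - _| <= _).
  by apply: eq_Rintegral => w _; rewrite expr0 mulr1.
have hV Z' : history_weight (X := X) t Z' ->
    (P x).-integrable setT (EFin \o (fun w => Z' w * e w * (1 - u w) ^+ 2)) /\
    V Z' <= h * D2 * J Z' + C2 * h ^+ 2.
  move=> hZ'; have [|i3 e3] := h2 h x t Z' _ x0 t0 hZ'; first by rewrite h0.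
  split; first by apply: eq_integrable i3 => // w _ /=; rewrite expr0 mulr1.
  have : `|V Z' - h * D2 * J Z'| <= C2 * h ^+ 2.
    move: e3; rewrite mul0r add0r addr0; congr (`|_ - _| <= _).
    by apply: eq_Rintegral => w _; rewrite expr0 mulr1.
  by move=> /(le_trans (ler_norm _)); rewrite lerBlDl.
have [iQ eQ] : (P x).-integrable setT (EFin \o (fun w => Z1 w * e w * ((1 - u w) ^+ 2 * p.[u w]))) /\
    `|Q - h * cp * J Z1| <= C1 * h ^+ 2.
  have [|i3 e3] := h1 h x t Z1 _ x0 t0 hZ1; first by rewrite h0.
  split; first by apply: eq_integrable i3 => // w _ /=; rewrite expr0 mulr1.
  move: e3; rewrite mul0r add0r; congr (`|_ - _| <= _).
  by apply: eq_Rintegral => w _; rewrite expr0 mulr1.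
have iS Z' : history_weight (X := X) t Z' ->
    (P x).-integrable setT (EFin \o (fun w => Z' w * e w * ramp a b (u w))).
  move=> hZ'; have [_ Z'01] := hZ'; apply: (prob_integrable _ _ 1).
    apply: measurable_funM; last exact: (measurableT_comp (measurable_ramp a b)).
    by apply: measurable_funM => //; exact: (measurable_weight hM t Z' hZ').
  move=> w; have /andP[z0 z1] := Z'01 w; have /andP[r0 r1] := ramp01 a b (u w).
  by rewrite ger0_norm ?mulr_ge0// !mulr_ile1 ?mulr_ge0.
have Z12 w : Z w = Z1 w + Z2 w by rewrite /Z1 /Z2 -mulrDr i12 mulr1.
have JE : J Z = J Z1 + J Z2.
  rewrite /J -RintegralD//; [|exact: (weight_mul_exp_integrable hM l l0)..].
  by apply: eq_Rintegral => w _; rewrite Z12 mulrDl.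
have iZ12 : (P x).-integrable setT
    (EFin \o (fun w => Z1 w * e w * ramp a b (u w) + Z2 w * e w * ramp a b (u w))).
  by have := integrableD measurableT (iS _ hZ1) (iS _ hZ2); apply: eq_integrable.
have SE : \int[P x]_w (Z w * e w * (1 - ramp a b (u w))) = S0 - (S Z1 + S Z2).
  rewrite /S -RintegralD//; [|exact: iS..].
  rewrite /S0 -RintegralB//; apply: eq_Rintegral => w _.
  have -> : Z1 w = Z w - Z2 w by rewrite Z12 addrK.
  by ring.
have J0 Z' : history_weight (X := X) t Z' -> 0 <= J Z'.
  move=> [_ Z'01]; apply: Rintegral_ge0 => w _; have /andP[z0 _] := Z'01 w.
  by rewrite mulr_ge0// mulr_ge0 ?expR_ge0 ?(mk_ge0 hM).
have mJ Z' : history_weight (X := X) t Z' ->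
    measurable_fun setT (fun w => Z' w * (X t w * expR (- (l * X t w)))).
  move=> hZ'; apply: measurable_funM; first exact: (measurable_weight hM t Z' hZ').
  by apply: measurable_funM; [exact: (measurable_X hM)|exact: (measurable_expRN_X hM)].
have J1b : J Z1 <= l^-1.
  apply: le_trans (ler_norm _) _; apply: prob_Rintegral_norm_le; first exact: mJ.
  by move=> w; exact: (weight_mul_exp_le hM l l0 t Z1 w t0 hZ1).
have J2b : J Z2 <= c16 / K.
  apply: le_trans (ler_norm _) _; apply: prob_Rintegral_norm_le; first exact: mJ.
  move=> w; have /andP[z0 z1] := Z01 w; have X0 := mk_ge0 hM w t0.
  rewrite /Z2 i2E; case: ltP => Kx /=; last by rewrite mulr0 mul0r normr0 divr_ge0// ltW.
  rewrite mulr1 ger0_norm ?mulr_ge0 ?expR_ge0// -[leRHS]mul1r ler_pM ?mulr_ge0 ?expR_ge0//.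
  by apply: mul_expRN_tail_le => //; exact: ltW.
have V1 := (hV _ hZ1).2; have V2 := (hV _ hZ2).2.
have SQ : `|S Z1 - Q| <= et * V Z1.
  have iSQ : (P x).-integrable setT (EFin \o (fun w =>
      Z1 w * e w * ramp a b (u w) - Z1 w * e w * ((1 - u w) ^+ 2 * p.[u w]))).
    by have := integrableB measurableT (iS _ hZ1) iQ; apply: eq_integrable.
  rewrite /S /Q -RintegralB//; last exact: iS.
  rewrite (le_trans (le_normr_Rintegral _ iSQ))// /V -RintegralZl//; last exact: (hV _ hZ1).1.
  apply: le_Rintegral => //.
  - by have := integrable_norm iSQ; apply: eq_integrable.
  - by have := integrableZl measurableT et (hV _ hZ1).1; apply: eq_integrable.
  - move=> w _; have /andP[z0 z1] := Z01 w.
    rewrite /Z1 i1E; case: (leP (X t w) K) => Xk /=; last by rewrite !mulr0 !mul0r subr0 normr0 mulr0.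
    rewrite mulr1 [X in `|X|](_ : _ = Z w * e w * (1 - u w) ^+ 2 *
        (ramp_quotient a b (u w) - p.[u w])); last first.
      by rewrite (ramp_quotientE a b ab b1 (u w)); ring.
    have k0 := mulr_ge0 (mulr_ge0 z0 (e0' w)) (sqr_ge0 (1 - u w)).
    rewrite normrM (ger0_norm k0) mulrC ler_wpM2r// distrC.
    (* Nonnegativity of X_{t+h} bounds minus the increment by X_t <= K, so u stays in the interval
       of approximation. *)
    apply: hp; rewrite expR_ge0/= ler_expR opprB lerBlDr (le_trans Xk)// lerDl.
    exact: (mk_ge0 hM).
(* Beyond K no polynomial is used: the ramp is at most G (1 - u)^2, whose mean is known from
   [step_expansion_sq]. *)
have S20 : 0 <= S Z2 <= G * V Z2.
  apply/andP; split.
    apply: Rintegral_ge0 => w _; have [_ /(_ w)/andP[z0 _]] := hZ2.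
    have /andP[r0 _] := ramp01 a b (u w).
    exact: (mulr_ge0 (mulr_ge0 z0 (e0' w)) r0).
  rewrite /S /V -RintegralZl//; last exact: (hV _ hZ2).1.
  apply: le_Rintegral => //; first exact: iS.
  - by have := integrableZl measurableT G (hV _ hZ2).1; apply: eq_integrable.
  - move=> w _; have [_ /(_ w)/andP[z0 _]] := hZ2.
    rewrite (ramp_quotientE a b ab b1 (u w)) [leLHS]mulrA [leLHS]mulrC.
    apply: ler_wpM2r; first exact: (mulr_ge0 (mulr_ge0 z0 (e0' w)) (sqr_ge0 _)).
    by have /andP[] := hG (u w).
have J10 := J0 _ hZ1; have J20 := J0 _ hZ2.
have hJ1 : 2 * (et * D2 * J Z1) <= eps / 4.
  apply: le_trans het; rewrite ler_wpM2l// ler_wpM2l ?mulr_ge0 ?(ltW et0)//.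
have hJ2 : (G * D2 + I) * J Z2 <= eps / 4.
  by apply: le_trans hK; rewrite ler_wpM2l// addr_ge0// mulr_ge0.
have hC : (C1 + C2 + C3 + G * C2) * h <= eps / 4.
  apply: (@le_trans _ _ ((C1 + C2 + C3 + G * C2 + 1) * h)).
    by rewrite ler_wpM2r ?lerDl// ltW.
  by rewrite mulrC -ler_pdivlMr ?ltr_wpDl ?addr_ge0 ?mulr_ge0// -mulrA -invfM.
have hcpJ : `|(cp - I) * J Z1| <= et * D2 * J Z1.
  by rewrite normrM (ger0_norm J10) ler_wpM2r.
have etV : et * V Z1 <= h * (et * D2 * J Z1) + C2 * h ^+ 2.
  apply: (@le_trans _ _ (et * (h * D2 * J Z1 + C2 * h ^+ 2))); first by rewrite ler_wpM2l// ltW.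
  rewrite mulrDr lerD//; first by rewrite le_eqVlt; apply/orP; left; apply/eqP; ring.
  by rewrite ler_piMl// mulr_ge0 ?sqr_ge0.
have GV : G * V Z2 <= h * (G * D2 * J Z2) + G * C2 * h ^+ 2.
  apply: (@le_trans _ _ (G * (h * D2 * J Z2 + C2 * h ^+ 2))); first by rewrite ler_wpM2l.
  by rewrite le_eqVlt; apply/orP; left; apply/eqP; ring.
have hh : h * ((C1 + C2 + C3 + G * C2) * h + 2 * (et * D2 * J Z1) + (G * D2 + I) * J Z2) <=
    h * eps.
  by rewrite ler_wpM2l ?(ltW h0)// (le_trans (lerD (lerD hC hJ1) hJ2))// three_quarters_le.
have hcpJ' : `|h * ((cp - I) * J Z1)| <= h * (et * D2 * J Z1).
  by rewrite normrM (gtr0_norm h0) ler_wpM2l// ltW.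
rewrite -/I SE -/N -/(J Z).
have -> : S0 - (S Z1 + S Z2) - (N + h * (Phi l - I) * J Z) =
  (S0 - (N + h * Phi l * J Z)) - (S Z1 - Q) - (Q - h * cp * J Z1) -
  h * ((cp - I) * J Z1) - (S Z2 - h * I * J Z2).
  by rewrite JE; ring.
have hIJ2 : 0 <= h * I * J Z2 by rewrite !mulr_ge0// ltW.
have hGDJ2 : 0 <= h * (G * D2 * J Z2) by rewrite !mulr_ge0// ltW.
have GC20 : 0 <= G * C2 * h ^+ 2 by rewrite mulr_ge0 ?sqr_ge0// mulr_ge0.
have hEt : 0 <= h * (et * D2 * J Z1) by rewrite !mulr_ge0// ltW.
apply: (error_sum_le _ _ _ _ _ _ _ _ _ _ _ _ _ _ _ eS0 SQ etV eQ hcpJ' S20 GV) => //.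
apply: le_trans (_ : h * eps <= _); last by rewrite mulrC.
by apply: le_trans hh; rewrite le_eqVlt; apply/orP; left; apply/eqP; ring.
Qed.

End one_step.

(** * Products of ramps along a grid *)

Lemma bounded_nondecreasing_union {d} {T : measurableType d} {R : realType}
    (Q : {measure set T -> \bar R}) (F : nat -> set T) (c : \bar R) :
  (forall n, measurable (F n)) -> nondecreasing_seq F ->
  (forall n, Q (F n) <= c)%E -> (Q (\bigcup_n F n) <= c)%E.
Proof.
move=> mF ndF Fc.
have := nondecreasing_cvg_mu (mu := Q) mF (bigcup_measurable (fun n _ => mF n)) ndF.
by move=> /cvg_lim <- //; apply: lime_le; [|exact: nearW] => //;
  apply: ereal_nondecreasing_is_cvgn => m n mn; apply: le_measure; rewrite ?inE//;
  apply/subsetPset; exact: ndF.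
Qed.

Lemma lower_drift_step {R : realType} (c c' j q : R) :
  `|c' - (c + j)| <= q -> forall e k : R, 0 <= j -> e - k * q <= c -> e - (k + 1) * q <= c'.
Proof. by rewrite ler_norml => h e k; rewrite mulrDl; lra. Qed.

Lemma upper_drift_step {R : realType} (c c' j q : R) :
  `|c' - (c + j)| <= q -> forall e k : R, j <= 0 -> c <= e + k * q -> c' <= e + (k + 1) * q.
Proof. by rewrite ler_norml => h e k; rewrite mulrDl; lra. Qed.

Section chain.
Context {R : realType} {alpha beta : R} { pi : {measure set R -> \bar R}}.
Context (htriple : is_branching_triple alpha beta pi) (halpha : 0 <= alpha).
Local Notation Phi := (branching_mechanism alpha beta pi).
Context {d : measure_display} {Omega : measurableType d}.
Context {X : R -> Omega -> R} {P : R -> probability Omega R}.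
Context (hM : is_rcll_markov X P).
Context {v : R -> R -> R} (hv : is_cumulant_semigroup Phi v).
Context (hE : forall x t lambda : R, 0 <= x -> 0 <= t -> 0 <= lambda ->
      'E_(P x)[fun w => expR (- (lambda * X t w))]%E =
      (expR (- (x * v t lambda)))%:E).

Lemma mean_expRN (x t l : R) : 0 <= x -> 0 <= t -> 0 <= l ->
  \int[P x]_w expR (- (l * X t w)) = expR (- (x * v t l)).
Proof. by move=> x0 t0 l0; have := hE x t l x0 t0 l0; rewrite unlock /Rintegral => ->. Qed.

Section ramp_chain.
Context (l : R) (l0 : 0 < l) (a b : R) (ab : a < b) (b1 : b < 1).

Definition ramp_prod (T : R) (n k : nat) (w : Omega) : R :=
  \prod_(j < k) (1 - ramp a b (expR (- grid_increment (X ^~ w) T n j))).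

Lemma ramp_prod01 T n k w : 0 <= ramp_prod T n k w <= 1.
Proof.
have h j : 0 <= 1 - ramp a b (expR (- grid_increment (X ^~ w) T n j)) <= 1.
  by have := ramp01 a b (expR (- grid_increment (X ^~ w) T n j)); lra.
rewrite /ramp_prod; apply/andP; split.
  by apply: prodr_ge0 => j _; have /andP[] := h j.
by apply: prodr_ile1 => j _; exact: h.
Qed.

Lemma ramp_prodS T n k w : ramp_prod T n k.+1 w = ramp_prod T n k w *
  (1 - ramp a b (expR (- grid_increment (X ^~ w) T n k))).
Proof. by rewrite /ramp_prod big_ord_recr. Qed.

Lemma grid_mono (T : R) n j k : 0 <= T -> (j <= k)%N -> grid T n j <= grid T n k.
Proof. by move=> T0 jk; rewrite /grid ler_wpM2r// ler_wpM2l// ler_nat. Qed.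

Lemma history_ramp_prod T n k : 0 <= T ->
  history_weight (X := X) (grid T n k) (ramp_prod T n k).
Proof.
move=> T0; split; last exact: ramp_prod01.
elim: k => [|k IH].
  rewrite (_ : ramp_prod T n 0 = cst 1)//.
  by apply/funext => w; rewrite /ramp_prod big_ord0.
rewrite (funext (ramp_prodS T n k)); apply: measurable_funM.
  by apply: history_type_le IH; exact: grid_mono.
apply: measurable_funB => //; apply: (measurableT_comp (measurable_ramp a b)).
apply: measurableT_comp => //; apply: measurableT_comp => //.
by apply: measurable_funB; apply: measurable_history_X; rewrite grid_ge0//= ?lexx// grid_mono.
Qed.

Definition chain_mean (x T : R) (n k : nat) : R :=
  \int[P x]_w (ramp_prod T n k w * expR (- (l * X (grid T n k) w))).

Lemma chain_mean0 (x T : R) n : 0 <= x -> 0 <= T -> chain_mean x T n 0 = expR (- (x * l)).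
Proof.
move=> x0 T0; rewrite /chain_mean grid0.
under eq_Rintegral do rewrite /ramp_prod big_ord0 mul1r.
rewrite mean_expRN ?(ltW l0)//; congr (expR (- (x * _))).
apply/eqP; rewrite eq_le (cumulant_le htriple halpha hv) ?(ltW l0)//=.
by have := cumulant_ge htriple halpha hv 0 l (ltW l0) (lexx 0); rewrite mul0r subr0.
Qed.

Let kappa := Phi l - ramp_integral (pi := pi) l a b.

(** The error per step is a small multiple of the mesh, uniformly in [k]. [J] is left unspecified,
    as only the sign of [kappa * J] matters afterwards. *)
Lemma chain_mean_step (eps x T : R) : 0 < eps -> 0 <= x -> 0 < T ->
  \forall n \near \oo, forall k, exists2 J, 0 <= J &
   `|chain_mean x T n k.+1 - (chain_mean x T n k + kappa * J)| <= eps * (T / n.+1%:R).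
Proof.
move=> e0 x0 T0.
have [delta d0 hd] := one_step htriple halpha hM hv hE l l0 a b ab b1 eps e0.
near=> n => k.
have h0 : 0 < T / n.+1%:R by rewrite divr_gt0.
have hT : 0 < T / n.+1%:R <= delta.
  by rewrite h0/= ltW//; near: n; exact: mesh_small (ltW T0) d0.
have hZ := history_ramp_prod T n k (ltW T0).
have g0 : 0 <= grid T n k by rewrite grid_ge0// ltW.
have := hd _ x _ _ hT x0 g0 hZ.
set J := \int[P x]_w (_ * (X _ w * _)) => hJ.
exists (T / n.+1%:R * J).
  rewrite mulr_ge0 ?(ltW h0)//; apply: Rintegral_ge0 => w _.
  have /andP[z0 _] := ramp_prod01 T n k w.
  by rewrite mulr_ge0// mulr_ge0 ?expR_ge0 ?(mk_ge0 hM).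
rewrite mulrCA mulrA; move: hJ; congr (`|_ - _| <= _).
rewrite /chain_mean; apply: eq_Rintegral => w _.
by rewrite ramp_prodS /grid_increment gridS mulrAC.
Unshelve. all: by end_near. Qed.

Lemma chain_mean_lower (eps x T : R) : 0 < eps -> 0 <= x -> 0 < T -> 0 <= kappa ->
  \forall n \near \oo, expR (- (x * l)) - eps <= chain_mean x T n n.+1.
Proof.
(* With [eps / T] per unit of time, the n + 1 steps accumulate an error of exactly [eps]. *)
move=> e0 x0 T0 k0; have eT : 0 < eps / T by rewrite divr_gt0.
apply: filterS (chain_mean_step _ x T eT x0 T0) => n hn.
have h k : expR (- (x * l)) - k%:R * (eps / n.+1%:R) <= chain_mean x T n k.
  elim: k => [|k IH]; first by rewrite mul0r subr0 chain_mean0// ltW.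
  have [J J0] := hn k.
  rewrite (_ : eps / T * (T / n.+1%:R) = eps / n.+1%:R); last by rewrite mulrA divfK// gt_eqF.
  by move=> /lower_drift_step; rewrite -[k.+1%:R]natr1; apply => //; rewrite mulr_ge0.
by have := h n.+1; rewrite mulrCA divff// mulr1.
Qed.

Lemma chain_mean_upper (eps x T : R) : 0 < eps -> 0 <= x -> 0 < T -> kappa <= 0 ->
  \forall n \near \oo, chain_mean x T n n.+1 <= expR (- (x * l)) + eps.
Proof.
move=> e0 x0 T0 k0; have eT : 0 < eps / T by rewrite divr_gt0.
apply: filterS (chain_mean_step _ x T eT x0 T0) => n hn.
have h k : chain_mean x T n k <= expR (- (x * l)) + k%:R * (eps / n.+1%:R).
  elim: k => [|k IH]; first by rewrite mul0r addr0 chain_mean0// ltW.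
  have [J J0] := hn k.
  rewrite (_ : eps / T * (T / n.+1%:R) = eps / n.+1%:R); last by rewrite mulrA divfK// gt_eqF.
  by move=> /upper_drift_step; rewrite -[k.+1%:R]natr1; apply => //; rewrite mulr_le0_ge0.
by have := h n.+1; rewrite mulrCA divff// mulr1.
Qed.

Lemma measurable_ramp_prod T n k : 0 <= T -> measurable_fun setT (ramp_prod T n k).
Proof. by move=> T0; exact: (measurable_weight hM _ _ (history_ramp_prod T n k T0)). Qed.

End ramp_chain.

Let mX := measurable_X hM.
Let rX := mk_rcll hM.

(** * From the chain to the law of the largest jump *)

Lemma prob_indic (Q : probability Omega R) (A : set Omega) : measurable A ->
  \int[Q]_w (\1_A w : R) = fine (Q A).
Proof. by move=> mA; rewrite /Rintegral integral_indic// setIT. Qed.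

Lemma expRN_levels (r1 r2 : R) : 0 < r1 -> r1 < r2 ->
  expR (- r2) < expR (- r1) /\ expR (- r1) < 1.
Proof. by move=> r10 r12; rewrite ltr_expR ltrN2 r12 expR_lt1 oppr_lt0. Qed.

(** An increment above [r2] makes one factor of the product vanish; everywhere the integrand is at
    most 1. *)
Lemma chain_mean_grid_event (l x T r1 r2 : R) n : 0 < l -> 0 <= T -> 0 < r1 -> r1 < r2 ->
  chain_mean l (expR (- r2)) (expR (- r1)) x T n n.+1 <=
    1 - fine (P x (grid_event (X := X) T r2 n)).
Proof.
move=> l0 T0 r10 r12; have [ab b1] := expRN_levels r1 r2 r10 r12.
have mC := measurable_grid_event mX T r2 n T0.
rewrite -prob_indic// -[X in X - _](prob_Rintegral_cst (P x)) -RintegralB//.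
- apply: le_Rintegral => //.
  + apply: (prob_integrable _ _ 1).
      apply: measurable_funM; last by apply: (measurable_expRN_X hM); exact: grid_ge0.
      exact: measurable_ramp_prod.
    move=> w; apply: (weight_exp_le1 hM l l0 _ _ w (grid_ge0 _ _ _ T0)).
    exact: history_ramp_prod.
  + apply: (prob_integrable _ _ 1); first exact: measurable_funB.
    move=> w; rewrite indicE; case: (w \in _) => /=; rewrite ?subrr ?subr0 ?normr0 ?normr1 ?ler01//.
  + move=> w _; have /andP[z0 z1] := ramp_prod01 (expR (- r2)) (expR (- r1)) T n n.+1 w.
    rewrite indicE; have [|_] /= := boolP (w \in _); last first.
      rewrite subr0 mulr_ile1 ?expR_ge0// expR_le1 oppr_le0 mulr_ge0 ?(ltW l0)//.
      by apply: (mk_ge0 hM); exact: grid_ge0.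
    rewrite inE => -[k kn rk]; rewrite subrr.
    suff -> : ramp_prod (expR (- r2)) (expR (- r1)) T n n.+1 w = 0 by rewrite mul0r.
    rewrite /ramp_prod (bigD1 (Ordinal kn))//= ramp1// ?subrr ?mul0r//.
    by rewrite ler_expR lerN2 ltW.
- by apply: (prob_integrable _ _ 1) => // w; rewrite normr1.
- apply: (prob_integrable _ _ 1) => // w; rewrite indicE.
  by case: (w \in _); rewrite ?normr0 ?normr1 ?ler01.
Qed.

(** If no increment exceeds [r1], the product is 1 and the integrand is e^{-l X_T}; its defect from
    1 is paid by the last term. *)
Lemma chain_mean_no_jump (l x T r1 r2 : R) n : 0 < l -> 0 <= x -> 0 <= T -> 0 < r1 -> r1 < r2 ->
  fine (P x (~` grid_event (X := X) T r1 n)) <=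
  chain_mean l (expR (- r2)) (expR (- r1)) x T n n.+1 + (1 - expR (- (x * v T l))).
Proof.
move=> l0 x0 T0 r10 r12; have [ab b1] := expRN_levels r1 r2 r10 r12.
have mC := measurable_grid_event mX T r1 n T0.
have mE : measurable_fun setT (fun w => expR (- (l * X T w))).
  exact: (measurable_expRN_X hM).
have E01 w : 0 <= expR (- (l * X T w)) <= 1.
  by rewrite expR_ge0 expR_le1 oppr_le0 mulr_ge0 ?(ltW l0) ?(mk_ge0 hM).
have iE : (P x).-integrable setT (EFin \o (fun w => expR (- (l * X T w)))).
  by apply: (prob_integrable _ _ 1) => // w; rewrite ger0_norm; have /andP[] := E01 w.
have i1 : (P x).-integrable setT (EFin \o (fun w : Omega => 1 : R)).
  by apply: (prob_integrable _ _ 1) => // w; rewrite normr1.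
have mr : measurable_fun setT (fun w => ramp_prod (expR (- r2)) (expR (- r1)) T n n.+1 w *
    expR (- (l * X (grid T n n.+1) w))).
  apply: measurable_funM; last by apply: (measurable_expRN_X hM); exact: grid_ge0.
  exact: measurable_ramp_prod.
have ir : (P x).-integrable setT (EFin \o (fun w => ramp_prod (expR (- r2)) (expR (- r1)) T n n.+1 w *
    expR (- (l * X (grid T n n.+1) w)))).
  apply: (prob_integrable _ _ 1) => // w.
  apply: (weight_exp_le1 hM l l0 _ _ w (grid_ge0 _ _ _ T0)).
  exact: history_ramp_prod.
have iB : (P x).-integrable setT (EFin \o (fun w => 1 - expR (- (l * X T w)))).
  by have := integrableB measurableT i1 iE; apply: eq_integrable.
rewrite -prob_indic; last exact: measurableC.
rewrite -mean_expRN ?(ltW l0)// -[X in (X - _)](prob_Rintegral_cst (P x)) -RintegralB//.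
rewrite /chain_mean -RintegralD//; apply: le_Rintegral => //.
- apply: (prob_integrable _ _ 1); first by apply: measurable_indic; exact: measurableC.
  by move=> w; rewrite indicE; case: (w \in _); rewrite ?normr0 ?normr1 ?ler01.
- by have := integrableD measurableT ir iB; apply: eq_integrable.
- move=> w _; rewrite grid_max; have /andP[z0 z1] := ramp_prod01 (expR (- r2)) (expR (- r1)) T n n.+1 w.
  have /andP[e0 e1] := E01 w.
  rewrite indicE; have [|_] /= := boolP (w \in _); last by rewrite addr_ge0 ?mulr_ge0 ?subr_ge0.
  rewrite inE /= => nC; suff -> : ramp_prod (expR (- r2)) (expR (- r1)) T n n.+1 w = 1.
    by rewrite mul1r; lra.
  rewrite /ramp_prod big1// => k _; rewrite ramp0 ?subr0// ler_expR lerN2.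
  by rewrite leNgt; apply/negP => h; apply: nC; exists k.
Qed.

Local Notation jump_above r := [set w | (r%:E < sup_jump (X ^~ w))%E].

Lemma jump_above_upper (l x r1 r2 : R) : 0 < l -> 0 <= x -> 0 < r1 -> r1 < r2 ->
  ramp_integral (pi := pi) l (expR (- r2)) (expR (- r1)) <= Phi l ->
  (P x (jump_above r2) <= (1 - expR (- (x * l)))%:E)%E.
Proof.
move=> l0 x0 r10 r12 hle; have [ab b1] := expRN_levels r1 r2 r10 r12.
have r20 : 0 <= r2 by rewrite ltW// (lt_trans r10).
rewrite (sup_jump_gtE (X := X)); apply: bounded_nondecreasing_union => [m|m n mn|[|m]].
- exact: (measurable_jump_event mX rX).
- by apply/subsetPset; apply: le_jump_event; rewrite ler_nat.
- rewrite (_ : jump_event _ _ = set0) ?measure0 ?lee_fin ?subr_ge0 ?expR_le1 ?oppr_le0 ?mulr_ge0 ?(ltW l0)//.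
  by rewrite -subset0 => w [s /andP[s0 s1]]; have := lt_le_trans s0 s1; rewrite ltxx.
set T : R := m.+1%:R; have T0 : 0 < T by rewrite ltr0n.
apply/lee_addgt0Pr => eps e0; rewrite -EFinD.
have kap : 0 <= Phi l - ramp_integral (pi := pi) l (expR (- r2)) (expR (- r1)).
  by rewrite subr_ge0.
have [N _ hN] := chain_mean_lower l l0 _ _ ab b1 eps x T e0 x0 T0 kap.
(* A jump above [r2] is seen by all fine grids, so the event lies in an increasing union of the
   [F M], each contained in the event of a single grid as fine as desired. *)
pose F M := \bigcap_(n in [set n | (M <= n)%N]) grid_event (X := X) T r2 n.
have mF M : measurable (F M).
  apply: bigcap_measurable => [|n _]; first by exists M => /=.
  by apply: measurable_grid_event => //; exact: ltW.
apply: (@le_trans _ _ (P x (\bigcup_M F M))).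
  apply: le_measure; rewrite ?inE//.
  - by apply: (measurable_jump_event mX rX) => //; exact: ltW.
  - exact: bigcup_measurable.
  - move=> w [s sT rs]; have [M _ hM'] := big_jump_grid _ _ _ _ (rX w) sT rs.
    by exists M => // n /= Mn; exact: hM'.
apply: bounded_nondecreasing_union => // [m' n mn|M].
  by apply/subsetPset => w hw k /= nk; apply: hw => /=; exact: leq_trans nk.
apply: (@le_trans _ _ (P x (grid_event (X := X) T r2 (maxn M N)))).
  apply: le_measure; rewrite ?inE//.
    by apply: measurable_grid_event => //; exact: ltW.
  by move=> w hw; apply: hw => /=; exact: leq_maxl.
rewrite -(@fineK _ (P x _)) ?fin_num_measure//; last first.
  by apply: measurable_grid_event => //; exact: ltW.
rewrite lee_fin; have := hN (maxn M N) (leq_maxr _ _).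
have := chain_mean_grid_event l x T r1 r2 (maxn M N) l0 (ltW T0) r10 r12.
lra.
Qed.

Lemma jump_above_lower (l x r0 r1 r2 : R) : pi setT <> 0%E -> 0 < l -> 0 <= x ->
  0 <= r0 -> r0 < r1 -> r1 < r2 ->
  Phi l <= ramp_integral (pi := pi) l (expR (- r2)) (expR (- r1)) ->
  (P x (~` jump_above r0) <= (expR (- (x * l)))%:E)%E.
Proof.
move=> hpi l0 x0 r00 r01 r12 hle; have r10 := le_lt_trans r00 r01.
have [ab b1] := expRN_levels r1 r2 r10 r12.
have kap : Phi l - ramp_integral (pi := pi) l (expR (- r2)) (expR (- r1)) <= 0.
  by rewrite subr_le0.
apply/lee_addgt0Pr => eps e0; rewrite -EFinD.
have e2 : 0 < eps / 2 by rewrite divr_gt0.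
(* Since 1 - e^{-x v} <= x v, this bound on v_T(l) makes the defect of e^{-l X_T} at most eps / 2;
   [x + 1] avoids dividing by zero. *)
have dl0 : 0 < eps / 2 / (x + 1) by rewrite divr_gt0// ltr_wpDl.
have [T T1 vT] := cumulant_arbitrarily_small htriple halpha hv l _ 1 hpi (ltW l0) dl0 ler01.
have T0 : 0 < T := lt_le_trans ltr01 T1.
have hv1 : 1 - expR (- (x * v T l)) <= eps / 2.
  have := expR_ge1Dx (- (x * v T l)).
  have : x * v T l <= x * (eps / 2 / (x + 1)) by rewrite ler_wpM2l// ltW.
  have : x * (eps / 2 / (x + 1)) <= eps / 2.
    by rewrite mulrA ler_pdivrMr ?ltr_wpDl// mulrC ler_wpM2l ?lerDl// ltW.
  lra.
have [N _ hN] := chain_mean_upper l l0 _ _ ab b1 (eps / 2) x T e2 x0 T0 kap.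
pose F M := \bigcap_(n in [set n | (M <= n)%N]) ~` grid_event (X := X) T r1 n.
have mG n : measurable (~` grid_event (X := X) T r1 n).
  by apply: measurableC; apply: measurable_grid_event => //; exact: ltW.
have mF M : measurable (F M).
  by apply: bigcap_measurable => [|n _//]; exists M => /=.
apply: (@le_trans _ _ (P x (\bigcup_M F M))).
  apply: le_measure; rewrite ?inE//.
  - by apply: measurableC; exact: (measurable_sup_jump_gt mX rX).
  - exact: bigcup_measurable.
  - move=> w /= hw.
    have jr s : 0 < s <= T -> jump (X ^~ w) s < r1.
      move=> /andP[s0 _]; rewrite -lte_fin; apply: (@le_lt_trans _ _ (sup_jump (X ^~ w))).
        by apply: ereal_sup_ubound; exists s => //=; rewrite in_itv/= s0.
      apply: (@le_lt_trans _ _ r0%:E); last by rewrite lte_fin.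
      by rewrite leNgt; apply/negP.
    have [M _ hM'] := small_jumps_grid _ _ _ (rX w) r10 (ltW T0) jr.
    exists M => // n /= Mn [k kn]; apply/negP; rewrite -leNgt ltW//.
    exact: hM'.
apply: bounded_nondecreasing_union => // [m' n mn|M].
  by apply/subsetPset => w hw k /= nk; apply: hw => /=; exact: leq_trans nk.
apply: (@le_trans _ _ (P x (~` grid_event (X := X) T r1 (maxn M N)))).
  apply: le_measure; rewrite ?inE//.
  by move=> w hw; apply: hw => /=; exact: leq_maxl.
rewrite -(@fineK _ (P x _)) ?fin_num_measure// lee_fin.
have := hN (maxn M N) (leq_maxr _ _).
have := chain_mean_no_jump l x T r1 r2 (maxn M N) l0 x0 (ltW T0) r10 r12.
lra.
Qed.

Lemma ramp_integral_le_tail (l r1 r2 : R) : 0 < l -> 0 < r1 -> r1 < r2 ->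
  ramp_integral (pi := pi) l (expR (- r2)) (expR (- r1)) <= levy_tail (pi := pi) r1 l.
Proof.
move=> l0 r10 r12; have [ab b1] := expRN_levels r1 r2 r10 r12.
apply: le_Rintegral => //.
- exact: (ramp_integrable htriple _ l0 _ _ ab b1).
- by apply: (expRN_indic_integrable htriple _ r1) => //; exact: ltW.
- move=> t _; rewrite ler_wpM2l ?expR_ge0// indic_itv_oy; case: (ltP r1 t) => h /=.
    by have /andP[] := ramp01 (expR (- r2)) (expR (- r1)) (expR (- t)).
  by rewrite ramp0// ler_expR lerN2.
Qed.

Lemma ramp_integral_ge_tail (l r1 r2 : R) : 0 < l -> 0 < r1 -> r1 < r2 ->
  levy_tail (pi := pi) r2 l <= ramp_integral (pi := pi) l (expR (- r2)) (expR (- r1)).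
Proof.
move=> l0 r10 r12; have [ab b1] := expRN_levels r1 r2 r10 r12.
apply: le_Rintegral => //.
- apply: (expRN_indic_integrable htriple _ r2) => //; last exact: ltW.
  exact: lt_trans r12.
- exact: (ramp_integrable htriple _ l0 _ _ ab b1).
- move=> t _; rewrite ler_wpM2l ?expR_ge0// indic_itv_oy; case: (ltP r2 t) => h /=.
    by rewrite ramp1// ler_expR lerN2 ltW.
  by have /andP[] := ramp01 (expR (- r2)) (expR (- r1)) (expR (- t)).
Qed.

(** The width of the ramp costs nothing here: [jump_above r] is the increasing union of the events
    at r + 1/(n+1), each bounded with a ramp starting at [r]. *)
Lemma sup_jump_law_upper (l x r : R) : 0 < l -> 0 <= x -> 0 < r ->
  levy_tail (pi := pi) r l <= Phi l ->
  (P x (jump_above r) <= (1 - expR (- (x * l)))%:E)%E.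
Proof.
move=> l0 x0 r0 hr.
rewrite (_ : jump_above r = \bigcup_n jump_above (r + n.+1%:R^-1)); last first.
  rewrite (sup_jump_gtE (X := X)); apply/seteqP; split => w.
    move=> [m _ [s sm rs]].
    have j0 : 0 < jump (X ^~ w) s - r by rewrite subr_gt0.
    exists (Num.truncn (jump (X ^~ w) s - r)^-1) => //=.
    apply: (@lt_le_trans _ _ (jump (X ^~ w) s)%:E).
      by rewrite lte_fin -ltrBrDl invf_plt ?posrE// truncnS_gt.
    by apply: ereal_sup_ubound; exists s => //=; rewrite in_itv/= andbT; case/andP: sm.
  move=> [n _ /= h]; suff : jump_above r w by rewrite (sup_jump_gtE (X := X)).
  by rewrite /=; apply: lt_trans h; rewrite lte_fin ltrDl invr_gt0.
apply: bounded_nondecreasing_union => [n|m n mn|n].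
- by apply: (measurable_sup_jump_gt mX rX); rewrite addr_ge0 ?invr_ge0// ltW.
- apply/subsetPset => w /=; apply: le_lt_trans; rewrite lee_fin lerD2l.
  by rewrite lef_pV2 ?posrE ?ltr0n// ler_nat.
- have rn : r < r + n.+1%:R^-1 by rewrite ltrDl invr_gt0.
  apply: (jump_above_upper l x r) => //; apply: le_trans hr.
  exact: ramp_integral_le_tail.
Qed.

(** A gap [r0 < r] remains, giving room for the ramp; [jump_exponent_root] closes it by right
    continuity of the tail. *)
Lemma sup_jump_law_lower (l x r0 r : R) : pi setT <> 0%E -> 0 < l -> 0 <= x ->
  0 <= r0 -> r0 < r -> Phi l <= levy_tail (pi := pi) r l ->
  (P x (~` jump_above r0) <= (expR (- (x * l)))%:E)%E.
Proof.
move=> hpi l0 x0 r00 r0r hr; pose r1 := (r0 + r) / 2.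
have r01 : r0 < r1 by rewrite /r1; lra.
have r1r : r1 < r by rewrite /r1; lra.
apply: (jump_above_lower l x r0 r1 r) => //; apply: (le_trans hr).
by apply: ramp_integral_ge_tail => //; exact: le_lt_trans r01.
Qed.

End chain.

(** * Null sets and half-open intervals *)

Section half_open_intervals.
Context {R : realType}.

(* Half-open intervals form a semiring of sets, so that the outer measure it generates bounds null sets
   by countable covers. *)
Definition ocitv_restriction (m : {measure set R -> \bar R}) (A : set (ocitv_type R)) : \bar R :=
  m A.

Lemma measurable_ocitv (A : set R) : ocitv A -> measurable A.
Proof. exact: sub_sigma_algebra. Qed.

Lemma ocitv_restriction0 m : ocitv_restriction m set0 = 0%E.
Proof. exact: measure0. Qed.

Lemma ocitv_restriction_ge0 m A : (0 <= ocitv_restriction m A)%E.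
Proof. exact: measure_ge0. Qed.

Lemma ocitv_restriction_semi_sigma_additive m : semi_sigma_additive (ocitv_restriction m).
Proof.
move=> F mF tF mUF.
apply: (@measure_semi_sigma_additive _ _ _ m F) => //.
- by move=> i; exact: (measurable_ocitv _ (mF i)).
- exact: (measurable_ocitv _ mUF).
Qed.

HB.instance Definition _ (m : {measure set R -> \bar R}) :=
  isMeasure.Build _ _ _ (ocitv_restriction m) (ocitv_restriction0 m)
    (ocitv_restriction_ge0 m) (@ocitv_restriction_semi_sigma_additive m).

Lemma ocitv_restriction_sigma_finite (m : {measure set R -> \bar R}) :
  (m setT < +oo)%E -> sigma_finite setT (ocitv_restriction m).
Proof.
move=> mT; exists (fun k : nat => `](- k%:R), k%:R]%classic).
  apply/esym; rewrite -subTset => x _ /=; exists (Num.bound `|x : R|); first by [].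
  have := archi_boundP (normr_ge0 (x : R)); rewrite /= in_itv/= ltr_norml => /andP[-> h].
  exact: ltW.
move=> k; split; first exact: is_ocitv.
apply: le_lt_trans mT; apply: (@le_measure _ _ _ m); rewrite ?inE//.
Qed.

(** By uniqueness of the extension, the outer measure built from half-open intervals agrees with [m]
    on Borel sets; a null set therefore has covers of arbitrarily small total mass. *)
Lemma ocitv_cover (m : {measure set R -> \bar R}) (A : set R) (eps : R) :
  (m setT < +oo)%E -> measurable A -> m A = 0%E -> 0 < eps ->
  exists F : nat -> set R, [/\ forall i, ocitv (F i),
    A `<=` \bigcup_i F i & (\sum_(0 <= i <oo) m (F i) <= eps%:E)%E].
Proof.
move=> mT mA A0 e0.
have : measure_extension (ocitv_restriction m) A = m A.
  have mid : measurable_fun (setT : set R) (id : R -> measurableTypeR R).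
    by move=> _ B mB; rewrite setTI preimage_id.
  exact: (measure_extension_unique (ocitv_restriction_sigma_finite m mT)
    (mu' := pushforward m (id : R -> measurableTypeR R))).
rewrite A0 /measure_extension /mu_ext => h.
have fin : ereal_inf [set (\sum_(0 <= k <oo) ocitv_restriction m (F k))%E
    | F in measurable_cover (A : set (ocitv_type R))] \is a fin_num by rewrite h.
have [_ [F [mF AF] <-]] := lb_ereal_inf_adherent e0 fin.
by rewrite h add0e => /ltW; exists F.
Qed.

(** No additivity argument is needed: the inequality is applied to each interval of a cover of total
    [m2]-mass at most eps / (C + 1), the summand 1 allowing C = 0. *)
Lemma null_of_le_ocitv (m1 m2 : {measure set R -> \bar R}) (C : R) :
  (m2 setT < +oo)%E -> 0 <= C ->
  (forall a b, m1 `]a, b]%classic <= C%:E * m2 `]a, b]%classic)%E ->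
  forall A, measurable A -> m2 A = 0%E -> m1 A = 0%E.
Proof.
move=> m2T C0 h A mA A0; apply/eqP; rewrite -measure_le0.
apply/lee_addgt0Pr => eps e0; rewrite add0e.
have C1 : 0 < C + 1 by rewrite ltr_wpDl.
have [F [mF AF sF]] := ocitv_cover m2 A (eps / (C + 1)) m2T mA A0 (divr_gt0 e0 C1).
apply: (@le_trans _ _ (\sum_(0 <= i <oo) m1 (F i))%E).
  by apply: measure_sigma_subadditive => // i; exact: measurable_ocitv.
apply: (@le_trans _ _ (\sum_(0 <= i <oo) (C%:E * m2 (F i)))%E).
  apply: lee_nneseries => [i _ _|i _]; first exact: measure_ge0.
  by have [[a b] _ <-] := mF i; exact: h.
rewrite nneseriesZl//.
apply: (@le_trans _ _ (C%:E * (eps / (C + 1))%:E)%E); first by rewrite lee_wpmul2l.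
rewrite -EFinM lee_fin mulrCA ler_piMr ?(ltW e0)// ler_pdivrMr// mul1r lerDl//.
Qed.

Lemma null_of_le_ocitv_within (m1 m2 : {measure set R -> \bar R}) (e r C : R) :
  (m2 `]e, r]%classic < +oo)%E -> 0 <= C ->
  (forall a b : R, e <= a -> a <= b -> b <= r ->
    (m1 `]a, b]%classic <= C%:E * m2 `]a, b]%classic)%E) ->
  forall A, measurable A -> m2 (A `&` `]e, r]) = 0%E -> m1 (A `&` `]e, r]) = 0%E.
Proof.
move=> m2T C0 h A mA A0.
have mI : measurable (`]e, r]%classic : set R) by exact: measurable_itv.
apply: (null_of_le_ocitv (mrestr m1 mI) (mrestr m2 mI) C) => //.
  by rewrite /= /mrestr setTI.
move=> a b; rewrite /= /mrestr.
have -> : `]a, b]%classic `&` `]e, r]%classic = `](Num.max a e), (Num.min b r)]%classic.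
  apply/seteqP; split => x /=; rewrite !in_itv/= gt_max le_min.
    by move=> [/andP[-> ->] /andP[-> ->]].
  by move=> /andP[/andP[-> ->] /andP[-> ->]].
have [ab|ba] := leP (Num.max a e) (Num.min b r).
  by apply: h => //; rewrite ?le_max ?ge_min lexx ?orbT.
by rewrite set_itv_ge ?measure0 ?mule0// bnd_simp -leNgt ltW.
Qed.

End half_open_intervals.

(** * The law of the largest jump *)

Section sup_jump_variable.
Context {R : realType} {d : measure_display} {Omega : measurableType d}.
Context {X : R -> Omega -> R}.
Context (mX : forall t, 0 <= t -> measurable_fun setT (X t)).
Context (rX : forall w, rcll (fun t => X t w)).

(* Nonpositive and infinite suprema are both sent to 0, hence out of the half-line considered. *)
Definition finite_sup_jump (w : Omega) : R := fine (maxe 0%E (sup_jump (X ^~ w))).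

Lemma measurable_finite_sup_jump : measurable_fun setT finite_sup_jump.
Proof.
apply: measurableT_comp => //.
move=> mT; apply: (measurability _ (ErealGenOInfty.measurableE R)) => // _ [_ [x ->] <-].
rewrite setTI; have [x0|x0] := leP 0 x.
  rewrite (_ : _ @^-1` _ = [set w | (x%:E < sup_jump (X ^~ w))%E]).
    exact: measurable_sup_jump_gt.
  apply/seteqP; split => w /=; rewrite in_itv/= andbT lt_max.
    by move=> /orP[|//]; rewrite lte_fin ltNge x0.
  by move=> ->; rewrite orbT.
rewrite (_ : _ @^-1` _ = setT)//.
by apply/seteqP; split => w //= _; rewrite in_itv/= andbT lt_max lte_fin x0.
Qed.

Lemma sup_jump_preimage (B : set R) : B `<=` `]0, +oo[ ->
  (fun w => sup_jump (X ^~ w)) @^-1` (EFin @` B) = finite_sup_jump @^-1` B.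
Proof.
move=> B0; apply/seteqP; split => w /=.
  move=> [b Bb]; rewrite /finite_sup_jump => <-.
  have := B0 b Bb; rewrite /= in_itv/= andbT => b0.
  by rewrite (max_idPr _)// lee_fin ltW.
rewrite /finite_sup_jump => Bw; exists (fine (maxe 0%E (sup_jump (X^~ w)))) => //.
have := B0 _ Bw; rewrite /= in_itv/= andbT.
have [] := leP 0%E (sup_jump (X ^~ w)); last by rewrite /= ltxx.
by case: (sup_jump _) => [r||] //=; rewrite ltxx.
Qed.

Lemma finite_sup_jump_itv (r r' : R) : 0 <= r -> r <= r' ->
  finite_sup_jump @^-1` `]r, r']%classic =
  [set w | (r%:E < sup_jump (X ^~ w))%E] `\` [set w | (r'%:E < sup_jump (X ^~ w))%E].
Proof.
move=> r0 rr'; rewrite -sup_jump_preimage; last first.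
  by move=> x /=; rewrite !in_itv/= andbT => /andP[rx _]; exact: le_lt_trans rx.
apply/seteqP; split => w /=.
  move=> [b]; rewrite /= in_itv/= => /andP[rb br'] <-; rewrite !lte_fin; split => //.
  by apply/negP; rewrite -leNgt.
move=> [+ /negP]; rewrite -leNgt.
case: (sup_jump _) => [b||] //=; rewrite lte_fin lee_fin => rb br'.
by exists b => //; rewrite /= in_itv/= rb.
Qed.

End sup_jump_variable.

Lemma upper_sign {R : realType} (f f' t t' a b e : R) :
  f' - f <= a -> t - t' <= b -> 0 <= e -> a + b + e <= f' - t' -> t <= f.
Proof. lra. Qed.

Lemma lower_sign {R : realType} (f f' t t' t'' a a' b c e : R) :
  f' - f <= a' -> a' <= a -> t - t' <= b -> t' - t'' <= c -> 0 <= e ->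
  c < (t - f) / 2 -> a + b + e <= (t - f) / 2 -> f' <= t''.
Proof. lra. Qed.

(** * The exponent of the largest jump as a root *)

Section comparison.
Context {R : realType} {alpha beta : R} { pi : {measure set R -> \bar R}}.
Context (htriple : is_branching_triple alpha beta pi) (halpha : 0 <= alpha).
Context (hpi : pi setT <> 0%E).
Local Notation Phi := (branching_mechanism alpha beta pi).
Local Notation L := (mechanism_lipschitz (alpha := alpha) (beta := beta) (pi := pi)).
Local Notation tail := (levy_tail (pi := pi)).
Context {d : measure_display} {Omega : measurableType d}.
Context {X : R -> Omega -> R} {P : R -> probability Omega R}.
Context (hM : is_rcll_markov X P).
Context {v : R -> R -> R} (hv : is_cumulant_semigroup Phi v).
Context (hE : forall x t lambda : R, 0 <= x -> 0 <= t -> 0 <= lambda ->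
      'E_(P x)[fun w => expR (- (lambda * X t w))]%E =
      (expR (- (x * v t lambda)))%:E).
Context (x : R) (x0 : 0 < x).

Let mX := measurable_X hM.
Let rX := mk_rcll hM.
Local Notation jump_above r := [set w | (r%:E < sup_jump (X ^~ w))%E].

Definition jump_above_prob (r : R) : R := fine (P x (jump_above r)).
Local Notation p := jump_above_prob.

Lemma measurable_jump_above r : 0 <= r -> measurable (jump_above r).
Proof. exact: (measurable_sup_jump_gt mX rX). Qed.

Lemma jump_above_probE r : 0 <= r -> P x (jump_above r) = (p r)%:E.
Proof. by move=> r0; rewrite /p fineK// fin_num_measure//; exact: measurable_jump_above. Qed.

Lemma jump_above_prob_mono r r' : 0 <= r -> r <= r' -> p r' <= p r.
Proof.
move=> r0 rr'; rewrite -lee_fin -!jump_above_probE// ?(le_trans r0)//.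
apply: le_measure; rewrite ?inE.
- by apply: measurable_jump_above; exact: le_trans rr'.
- exact: measurable_jump_above.
by move=> w /=; apply: le_lt_trans; rewrite lee_fin.
Qed.

Lemma jump_above_prob_upper l r : 0 < l -> 0 < r -> tail r l <= Phi l ->
  p r <= 1 - expR (- (x * l)).
Proof.
move=> l0 r0 h; rewrite -lee_fin -jump_above_probE ?(ltW r0)//.
exact: (sup_jump_law_upper htriple halpha hM hv hE l x r l0 (ltW x0) r0 h).
Qed.

Lemma jump_above_prob_lower l r0 r : 0 < l -> 0 <= r0 -> r0 < r -> Phi l <= tail r l ->
  1 - expR (- (x * l)) <= p r0.
Proof.
move=> l0 r00 rr h.
have := sup_jump_law_lower htriple halpha hM hv hE l x r0 r hpi l0 (ltW x0) r00 rr h.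
rewrite probability_setC; last exact: measurable_jump_above.
by rewrite jump_above_probE// -EFinB lee_fin; lra.
Qed.

(** What makes the logarithm in [jump_exponent] meaningful. [Phi] grows at least linearly while the
    tail is at most pi(r, oo), so some l satisfies the sign condition of the upper bound. *)
Lemma jump_above_prob_lt1 r : 0 < r -> p r < 1.
Proof.
move=> r0; pose c := fine (pi `]r, +oo[%classic).
have c0 : 0 <= c by exact: fine_ge0.
have Phi1 := branching_mechanism_gt0 htriple halpha 1 hpi ltr01.
pose l := 1 + c / Phi 1.
have l1 : 1 <= l by rewrite lerDl divr_ge0// ltW.
have l0 : 0 < l := lt_le_trans ltr01 l1.
apply: (@le_lt_trans _ _ (1 - expR (- (x * l)))); last by rewrite ltrBlDr ltrDl expR_gt0.
apply: jump_above_prob_upper => //.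
apply: (le_trans (levy_tail_set_le htriple r l r0 (ltW l0))).
have := branching_mechanism_superlinear htriple l 1.
rewrite ler01 l1 mul1r => /(_ isT); apply: le_trans.
by rewrite /l mulrDl mul1r divfK ?gt_eqF// -/c lerDr ltW.
Qed.

Definition jump_exponent (r : R) : R := - ln (1 - p r) / x.
Local Notation q := jump_exponent.

Lemma jump_exponentE r : 0 < r -> 1 - p r = expR (- (x * q r)).
Proof.
move=> r0; rewrite /q mulrCA divff ?gt_eqF// mulr1 opprK lnK// posrE subr_gt0.
exact: jump_above_prob_lt1.
Qed.

Lemma jump_exponent_ge0 r : 0 < r -> 0 <= q r.
Proof.
move=> r0; have := jump_exponentE r r0.
have p0 : 0 <= p r by exact: fine_ge0.
move=> h; have : expR (- (x * q r)) <= 1 by rewrite -h lerBlDr lerDl.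
by rewrite expR_le1 oppr_le0 pmulr_rge0.
Qed.

Lemma jump_exponent_mono r r' : 0 < r -> r <= r' -> q r' <= q r.
Proof.
move=> r0 rr'; have := jump_above_prob_mono r r' (ltW r0) rr'.
rewrite -(lerD2l 1) -lerN2 => h.
have : 1 - p r <= 1 - p r' by lra.
rewrite !jump_exponentE ?(lt_le_trans r0)// ler_expR lerN2.
by rewrite ler_pM2l.
Qed.

Lemma jump_exponent_upper l r : 0 < l -> 0 < r -> tail r l <= Phi l -> q r <= l.
Proof.
move=> l0 r0 /(jump_above_prob_upper l r l0 r0) h.
have : expR (- (x * l)) <= 1 - p r by lra.
by rewrite jump_exponentE// ler_expR lerN2 ler_pM2l.
Qed.

Lemma jump_exponent_lower l r0 r : 0 < l -> 0 < r0 -> r0 < r -> Phi l <= tail r l -> l <= q r0.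
Proof.
move=> l0 r00 rr /(jump_above_prob_lower l r0 r l0 (ltW r00) rr) h.
have : 1 - p r0 <= expR (- (x * l)) by lra.
by rewrite jump_exponentE// ler_expR lerN2 ler_pM2l.
Qed.

Lemma levy_right_small r (eta : R) : 0 < r -> 0 < eta ->
  exists2 r', r < r' & fine (pi `]r, r']%classic) < eta.
Proof.
move=> r0 eta0; pose F n := `]r, r + n.+1%:R^-1]%classic.
have sub n : F n `<=` `]r, +oo[ by move=> y /=; rewrite !in_itv/= andbT => /andP[].
have Ffin n : (pi (F n) < +oo)%E by apply: (levy_set_fin htriple r) => //; exact: measurable_itv.
have F0 : \bigcap_n F n = set0.
  rewrite -subset0 => y Fy; have := Fy 0 I; rewrite /F /= in_itv/= => /andP[ry _].
  have yr : 0 < y - r by rewrite subr_gt0.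
  have := Fy (Num.truncn (y - r)^-1) I; rewrite /F /= in_itv/= ry/= leNgt => /negP; apply.
  by rewrite -ltrBrDl invf_plt ?posrE// truncnS_gt.
have : pi (F n) @[n --> \oo] --> (0 : \bar R)%E.
  rewrite -(measure0 pi) -F0; apply: nonincreasing_cvg_mu => //.
  - by move=> n; exact: measurable_itv.
  - by apply: bigcap_measurable => // n _; exact: measurable_itv.
  - move=> m n mn; apply/subsetPset => y; rewrite /F /= !in_itv/= => /andP[-> h].
    by rewrite (le_trans h)// lerD2l lef_pV2 ?posrE ?ltr0n// ler_nat.
move=> /fine_cvgP[_ /cvgrPdist_lt/(_ _ eta0)[N _ /(_ N (leqnn N))]].
rewrite /= sub0r normrN ger0_norm ?fine_ge0// => h.
by exists (r + N.+1%:R^-1) => //; rewrite ltrDl invr_gt0.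
Qed.

Lemma mechanism_lipschitz_mono (a b : R) : 0 <= b -> b <= a -> L b <= L a.
Proof.
move=> b0 ba; have m0 := levy_moment_ge0 (pi := pi).
rewrite /mechanism_lipschitz lerD//.
  by rewrite lerD2l ler_wpM2l// mulr_ge0// (bt_beta_ge0 htriple).
by rewrite ler_wpM2r// ge_max !le_max lexx ba !orbT.
Qed.

Definition tail_lipschitz (r : R) : R := Num.max 1 r^-1 * levy_moment (pi := pi).

Lemma tail_lipschitz_ge0 r : 0 <= tail_lipschitz r.
Proof. by rewrite mulr_ge0 ?levy_moment_ge0// le_max ler01. Qed.

(** A strict inequality either way survives a small change of l, and then one of the sign criteria
    contradicts the value of q(r): l is moved below q(r) if [Phi] exceeds the tail there, above it
    if the tail exceeds [Phi]. *)
Lemma jump_exponent_root r : 0 < r -> Phi (q r) = tail r (q r).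
Proof.
move=> r0; have q0 := jump_exponent_ge0 r r0.
have K0 := tail_lipschitz_ge0 r.
apply/eqP; rewrite eq_le; apply/andP; split; rewrite leNgt; apply/negP => h.
  have L0 := mechanism_lipschitz_ge0 htriple halpha (q r) q0.
  have q_gt0 : 0 < q r.
    rewrite lt_neqAle q0 andbT; apply/negP => /eqP q00.
    by move: h; rewrite -q00 branching_mechanism0 ltNge levy_tail_ge0.
  pose g := Phi (q r) - tail r (q r); have g0 : 0 < g by rewrite subr_gt0.
  pose C := L (q r) + tail_lipschitz r + 1.
  have C0 : 0 < C by rewrite ltr_wpDl// addr_ge0.
  (* The second entry keeps the change of both functions below the gap [g], the first keeps l
     positive. *)
  pose l := Num.max (q r / 2) (q r - g / C).
  have lq : l < q r.
    by rewrite gt_max ltrBlDr ltrDl divr_gt0// andbT ltr_pdivrMr// ltr_pMr// ltr1n.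
  have l0 : 0 < l by rewrite lt_max divr_gt0.
  have lq' : 0 <= l <= q r by rewrite !ltW.
  have ql : C * (q r - l) <= g.
    rewrite mulrC -ler_pdivlMr// lerBlDr -lerBlDl le_max lexx orbT//.
  have /andP[_ h1] := branching_mechanism_lipschitz htriple halpha _ _ lq'.
  have /andP[_ h2] := levy_tail_lipschitz htriple r l (q r) r0 lq'.
  rewrite -/(tail_lipschitz r) in h2.
  have hC : C * (q r - l) = L (q r) * (q r - l) + tail_lipschitz r * (q r - l) + (q r - l).
    by rewrite /C; ring.
  suff /(jump_exponent_upper l r l0 r0) : tail r l <= Phi l by rewrite leNgt lq.
  by apply: (upper_sign _ _ _ _ _ _ (q r - l) h1 h2); rewrite ?subr_ge0 ?(ltW lq)// -hC.
have L0 := mechanism_lipschitz_ge0 htriple halpha (q r + 1) (addr_ge0 q0 ler01).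
pose g := tail r (q r) - Phi (q r); have g0 : 0 < g by rewrite subr_gt0.
pose C := L (q r + 1) + tail_lipschitz r + 1.
have C0 : 0 < C by rewrite ltr_wpDl// addr_ge0.
(* Half of the gap pays for moving l, the other half for moving r to r' as [jump_exponent_lower]
   requires; [eta <= 1] allows the Lipschitz constant at q(r) + 1. *)
pose eta := Num.min 1 (g / 2 / C).
have eta0 : 0 < eta by rewrite lt_min ltr01/= !divr_gt0.
have eta1 : eta <= 1 by rewrite ge_min lexx.
have Ceta : C * eta <= g / 2.
  by rewrite mulrC -ler_pdivlMr// ge_min lexx orbT.
pose l := q r + eta.
have ql : q r < l by rewrite ltrDl.
have l0 : 0 < l := le_lt_trans q0 ql.
have lq' : 0 <= q r <= l by rewrite q0 ltW.
have /andP[_ h1] := branching_mechanism_lipschitz htriple halpha _ _ lq'.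
have /andP[_ h2] := levy_tail_lipschitz htriple r (q r) l r0 lq'.
have hL : L l * (l - q r) <= L (q r + 1) * (l - q r).
  rewrite ler_wpM2r ?subr_ge0 ?(ltW ql)// mechanism_lipschitz_mono ?(ltW l0)//.
  by rewrite lerD2l.
rewrite -/(tail_lipschitz r) in h2.
have lqE : l - q r = eta by rewrite /l; ring.
rewrite lqE in h1 h2 hL.
have hC : C * eta = L (q r + 1) * eta + tail_lipschitz r * eta + eta by rewrite /C; ring.
have g2 : 0 < g / 2 by rewrite divr_gt0.
have [r' rr' hr'] := levy_right_small r (g / 2) r0 g2.
have /andP[_ h3] := levy_tail_sub_le htriple r r' l r0 (ltW rr') (ltW l0).
suff /(jump_exponent_lower l r r' l0 r0 rr') : Phi l <= tail r' l by rewrite leNgt ql.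
by apply: (lower_sign _ _ _ _ _ _ _ _ _ eta h1 hL h2 h3 (ltW eta0) hr'); rewrite -hC.
Qed.

End comparison.

Lemma exponential_gap_le {R : realType} (x q0 a b : R) : 0 < x -> b <= a -> a <= q0 ->
  a - b <= expR (x * q0) / x * (expR (- (x * b)) - expR (- (x * a))).
Proof.
move=> x0 ba aq; rewrite mulrAC ler_pdivlMr//.
rewrite -[leLHS]mul1r -(expRxMexpNx_1 (x * q0)) -mulrA ler_wpM2l ?expR_ge0//.
apply: (@le_trans _ _ (expR (- (x * a)) * ((a - b) * x))).
  by rewrite ler_wpM2r ?mulr_ge0 ?subr_ge0 ?(ltW x0)// ler_expR lerN2 ler_wpM2l// ltW.
have := expR_tangent (- (x * a)) (- (x * b)).
rewrite (_ : 1 + - (x * b) - - (x * a) = 1 + (a - b) * x); last by ring.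
by rewrite mulrDr mulr1 -lerBrDl.
Qed.

Lemma exponential_gap_ge {R : realType} (x a b : R) : 0 < x -> 0 <= b -> b <= a ->
  expR (- (x * b)) - expR (- (x * a)) <= x * (a - b).
Proof.
move=> x0 b0 ba; apply: (@le_trans _ _ (expR (- (x * b)) * (x * (a - b)))); last first.
  rewrite ler_piMl ?mulr_ge0 ?subr_ge0 ?(ltW x0)// expR_le1 oppr_le0.
  by rewrite mulr_ge0 ?(ltW x0).
have := expR_tangent (- (x * b)) (- (x * a)).
rewrite (_ : 1 + - (x * a) - - (x * b) = 1 - x * (a - b)); last by ring.
by rewrite mulrBr mulr1 lerBlDl lerBlDr addrC.
Qed.

Lemma gap_upper {R : realType} (f f' t t' t'' l k M y : R) :
  f = t -> f' = t' -> f - f' <= l * y -> t' - t'' <= k * y ->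
  (l + k) * y <= M * y -> t - t'' <= M * y.
Proof. move=> -> ->; rewrite mulrDl; lra. Qed.

Lemma gap_lower {R : realType} (f f' t t' t'' c : R) :
  f = t -> f' = t' -> 0 <= t' - t'' -> t - t'' <= c -> f - f' <= c.
Proof. move=> -> ->; lra. Qed.

Lemma slope_combine {R : realType} (b y c f g h : R) : 0 < b -> 0 <= y -> 0 <= c ->
  y * g <= b * (f - g) -> b * h <= c * g -> y * h <= c * (f - g).
Proof.
move=> b0 y0 c0 /(ler_wpM2l c0) h1 /(ler_wpM2l y0) h2.
rewrite -(ler_pM2l b0) mulrCA (le_trans h2)// mulrCA (le_trans h1)//.
by rewrite mulrCA.
Qed.

Lemma null_positive_half_line {R : realType} (m : {measure set R -> \bar R}) (A : set R) :
  measurable A -> (forall e r : R, 0 < e -> e < r -> m (A `&` `]e, r]%classic) = 0%E) ->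
  m (A `&` `]0, +oo[%classic) = 0%E.
Proof.
move=> mA h.
(* The shift by 2 in [n.+2] keeps the left end strictly below 1 and the right end strictly above
   it. *)
have sub : A `&` `]0, +oo[%classic `<=` \bigcup_n (A `&` `](n.+2%:R^-1 : R), n.+2%:R]%classic).
  move=> y [Ay /=]; rewrite in_itv/= andbT => y0.
  pose n := maxn (Num.truncn y) (Num.truncn y^-1).
  have yn : y < n.+2%:R.
    by rewrite (lt_le_trans (truncnS_gt y))// ler_nat ltnS leqW// leq_maxl.
  have y1n : y^-1 < n.+2%:R.
    by rewrite (lt_le_trans (truncnS_gt _))// ler_nat ltnS leqW// leq_maxr.
  exists n => //; split => //=; rewrite in_itv/= (ltW yn) andbT.
  by rewrite invf_plt ?posrE ?ltr0n.
apply: (negligibleP m _).1.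
  by apply: measurableI => //; exact: measurable_itv.
apply: negligibleS sub _; apply: negligible_bigcup => n; apply/negligibleP.
  by apply: measurableI => //; exact: measurable_itv.
apply: h; first by rewrite invr_gt0.
by rewrite (@lt_trans _ _ 1)// ?invf_lt1// ltr1n.
Qed.

(** * Mutual absolute continuity on the positive half-line *)

Section equivalence.
Context {R : realType} {alpha beta : R} { pi : {measure set R -> \bar R}}.
Context (htriple : is_branching_triple alpha beta pi) (halpha : 0 <= alpha).
Context (hpi : pi setT <> 0%E).
Local Notation Phi := (branching_mechanism alpha beta pi).
Local Notation L := (mechanism_lipschitz (alpha := alpha) (beta := beta) (pi := pi)).
Context {d : measure_display} {Omega : measurableType d}.
Context {X : R -> Omega -> R} {P : R -> probability Omega R}.
Context (hM : is_rcll_markov X P).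
Context {v : R -> R -> R} (hv : is_cumulant_semigroup Phi v).
Context (hE : forall x t lambda : R, 0 <= x -> 0 <= t -> 0 <= lambda ->
      'E_(P x)[fun w => expR (- (lambda * X t w))]%E =
      (expR (- (x * v t lambda)))%:E).
Context (x : R) (x0 : 0 < x).

Local Notation p := (jump_above_prob (X := X) (P := P) x).
Local Notation q := (jump_exponent (X := X) (P := P) x).
Let pE := jump_exponentE htriple halpha hpi hM hv hE x x0.
Let q_ge0 := jump_exponent_ge0 htriple halpha hpi hM hv hE x x0.
Let q_mono := jump_exponent_mono htriple halpha hpi hM hv hE x x0.
Let q_root := jump_exponent_root htriple halpha hpi hM hv hE x x0.

Context (mu : {measure set R -> \bar R}).
Hypothesis muE : forall a b : R, 0 <= a -> a <= b -> mu `]a, b]%classic = (p a - p b)%:E.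

Lemma levy_ocitv_fin (a b : R) : 0 < a -> pi `]a, b]%classic = (fine (pi `]a, b]%classic))%:E.
Proof.
move=> a0; rewrite fineK// ge0_fin_numE//; apply: (levy_set_fin htriple a) => //.
by move=> y /=; rewrite !in_itv/= andbT => /andP[].
Qed.

Lemma tail_lipschitz_mono (e b : R) : 0 < e -> e <= b ->
  tail_lipschitz (pi := pi) b <= tail_lipschitz (pi := pi) e.
Proof.
move=> e0 eb; rewrite ler_wpM2r ?levy_moment_ge0// ge_max !le_max lexx/=.
by rewrite lef_pV2 ?posrE ?eb ?orbT// (lt_le_trans e0).
Qed.

Lemma jump_above_prob_gap a b : 0 < a -> 0 < b ->
  p a - p b = expR (- (x * q b)) - expR (- (x * q a)).
Proof. by move=> a0 b0; rewrite -(pE a a0) -(pE b b0); ring. Qed.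

(** The mass pi(a, b] is controlled by T_a - T_b at q(a). Replacing T_a(q(a)) and T_b(q(b)) by the
    values of [Phi] turns this into increments of [Phi] and of T_b between q(b) and q(a), both
    Lipschitz. *)
Lemma levy_le_law (e r : R) : 0 < e -> exists2 C : R, 0 <= C &
  forall a b, e <= a -> a <= b -> b <= r -> fine (pi `]a, b]%classic) <= C * (p a - p b).
Proof.
move=> e0; set q0 := q e; have q00 : 0 <= q0 by exact: q_ge0.
pose M := L q0 + tail_lipschitz (pi := pi) e.
have M0 : 0 <= M.
  by rewrite addr_ge0 ?tail_lipschitz_ge0// (mechanism_lipschitz_ge0 htriple halpha).
(* The factors undo the weight e^{-q(a) b}, bound the Lipschitz constants on [0, q(e)], and pass
   from q(a) - q(b) to p(a) - p(b), all uniformly on []e, r]]. *)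
exists (expR (q0 * r) * (M * (expR (x * q0) / x))).
  by rewrite !mulr_ge0 ?expR_ge0 ?invr_ge0// ltW.
move=> a b ea ab br; have a0 := lt_le_trans e0 ea; have b0 := lt_le_trans a0 ab.
have r0 := lt_le_trans b0 br.
have B0 := q_ge0 b b0; have A0 := q_ge0 a a0.
have BA : q b <= q a by exact: q_mono.
have Aq : q a <= q0 by exact: q_mono.
have /andP[h1 _] := levy_tail_sub_le htriple a b (q a) a0 ab A0.
have BA' : 0 <= q b <= q a by rewrite B0.
have /andP[_ h2] := branching_mechanism_lipschitz htriple halpha _ _ BA'.
have /andP[_ h3] := levy_tail_lipschitz htriple b (q b) (q a) b0 BA'.
rewrite -/(tail_lipschitz b) in h3.
have AB0 : 0 <= q a - q b by rewrite subr_ge0.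
have h4 : (L (q a) + tail_lipschitz (pi := pi) b) * (q a - q b) <= M * (q a - q b).
  rewrite ler_wpM2r// lerD ?tail_lipschitz_mono ?(le_trans ea)//.
  exact: (mechanism_lipschitz_mono htriple).
have h5 := gap_upper _ _ _ _ _ _ _ _ _ (q_root a a0) (q_root b b0) h2 h3 h4.
have pi0 : 0 <= fine (pi `]a, b]%classic) by exact: fine_ge0.
have h6 : fine (pi `]a, b]%classic) <= expR (q0 * r) * (M * (q a - q b)).
  rewrite -[leLHS]mul1r -(expRxMexpNx_1 (q0 * r)) -mulrA ler_wpM2l ?expR_ge0//.
  apply: le_trans h5; apply: le_trans h1; rewrite ler_wpM2r// ler_expR lerN2.
  by rewrite ler_pM// ltW.
apply: (le_trans h6); rewrite -mulrA ler_wpM2l ?expR_ge0// -mulrA ler_wpM2l//.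
rewrite jump_above_prob_gap//; exact: exponential_gap_le.
Qed.

(** Convexity bounds q(a) - q(b) by a multiple of Phi(q(a)) - Phi(q(b)) = T_a(q(a)) - T_b(q(b)), and
    T_b(q(b)) >= T_b(q(a)) leaves at most pi(a, b]. The constant requires q(r) > 0 as a lower bound
    for all exponents involved. *)
Lemma law_le_levy (e r : R) : 0 < e -> 0 < r -> 0 < q r -> exists2 C : R, 0 <= C &
  forall a b, e <= a -> a <= b -> b <= r -> p a - p b <= C * fine (pi `]a, b]%classic).
Proof.
move=> e0 r0 dl0; set dl := q r in dl0 *.
have Phid := branching_mechanism_gt0 htriple halpha dl hpi dl0.
exists (x * (dl / Phi dl)); first by apply: (mulr_ge0 (ltW x0)); exact: (divr_ge0 (ltW dl0) (ltW Phid)).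
move=> a b ea ab br; have a0 := lt_le_trans e0 ea; have b0 := lt_le_trans a0 ab.
have B0 : 0 < q b by rewrite (lt_le_trans dl0)//; exact: q_mono.
have A0 := q_ge0 a a0.
have BA : q b <= q a by exact: q_mono.
have BA' : 0 <= q b <= q a by rewrite ltW.
have dB : 0 <= dl <= q b by rewrite ltW//=; exact: q_mono.
have AB0 : 0 <= q a - q b by rewrite subr_ge0.
have h1 := branching_mechanism_slope htriple _ _ BA'.
have h2 := branching_mechanism_superlinear htriple _ _ dB.
have h3 : (q a - q b) * Phi dl <= dl * (Phi (q a) - Phi (q b)) :=
  slope_combine _ _ _ _ _ _ B0 AB0 (ltW dl0) h1 h2.
have /andP[_ h4] := levy_tail_sub_le htriple a b (q a) a0 ab A0.
have /andP[h5 _] := levy_tail_lipschitz htriple b (q b) (q a) b0 BA'.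
have h6 := gap_lower _ _ _ _ _ _ (q_root a a0) (q_root b b0) h5 h4.
rewrite jump_above_prob_gap//.
apply: (le_trans (exponential_gap_ge _ _ _ x0 (ltW B0) BA)).
rewrite -mulrA ler_wpM2l ?(ltW x0)// mulrAC ler_pdivlMr// (le_trans h3)// ler_wpM2l ?(ltW dl0)//.
Qed.

Lemma levy_null_of_law_null (A : set R) : measurable A ->
  mu (A `&` `]0, +oo[%classic) = 0%E -> pi (A `&` `]0, +oo[%classic) = 0%E.
Proof.
move=> mA A0; apply: null_positive_half_line => // e r e0 er.
have [C C0 hC] := levy_le_law e r e0.
apply: (null_of_le_ocitv_within pi mu e r C) => //.
- by rewrite muE ?ltry// ltW.
- move=> a b ea ab br; rewrite levy_ocitv_fin ?(lt_le_trans e0)// muE//.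
    by rewrite -EFinM lee_fin hC.
  by rewrite (le_trans _ ea)// ltW.
- apply/eqP; rewrite -measure_le0 -A0; apply: le_measure; rewrite ?inE.
  + by apply: measurableI => //; exact: measurable_itv.
  + by apply: measurableI => //; exact: measurable_itv.
  + move=> y [Ay /=]; rewrite !in_itv/= => /andP[ey _]; split => //.
    by rewrite andbT (lt_trans e0).
Qed.

Lemma mu_half_line_le r : 0 < r -> (mu `]r, +oo[%classic <= (p r)%:E)%E.
Proof.
move=> r0; rewrite (_ : `]r, +oo[%classic = \bigcup_n `]r, r + n%:R]%classic).
  apply: bounded_nondecreasing_union => [n|m n mn|n].
  - exact: measurable_itv.
  - apply/subsetPset => y /=; rewrite !in_itv/= => /andP[-> h]/=.
    by rewrite (le_trans h)// lerD2l ler_nat.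
  - by rewrite muE ?(ltW r0)// ?lerDl// lee_fin lerBlDr lerDl fine_ge0.
apply/seteqP; split => y /=; rewrite in_itv/= andbT.
  move=> ry; exists (Num.truncn (y - r)).+1 => //=; rewrite in_itv/= ry/=.
  by rewrite -lerBlDl ltW// truncnS_gt.
by move=> [n _ /=]; rewrite in_itv/= => /andP[].
Qed.

(** The tail at [dl] is at most pi(r, oo), so q(r) <= dl; then p(r) = 1 - e^{-x q(r)} <= x q(r). *)
Lemma jump_exponent_small r (dl : R) : 0 < r -> 0 < dl ->
  fine (pi `]r, +oo[%classic) <= Phi dl -> p r <= x * dl.
Proof.
move=> r0 d0 h.
have qd : q r <= dl.
  apply: (jump_exponent_upper htriple halpha hpi hM hv hE x x0) => //.
  by apply: le_trans h; exact: (levy_tail_set_le htriple _ _ r0 (ltW d0)).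
have := pE r r0; have := expR_ge1Dx (- (x * q r)).
have : x * q r <= x * dl by rewrite ler_wpM2l// ltW.
lra.
Qed.

Lemma mu_null_beyond r : 0 < r -> pi `]r, +oo[%classic = 0%E -> mu `]r, +oo[%classic = 0%E.
Proof.
move=> r0 pr; apply/eqP; rewrite -measure_le0; apply/lee_addgt0Pr => eps e0; rewrite add0e.
apply: (le_trans (mu_half_line_le r r0)); rewrite lee_fin.
have dl0 : 0 < eps / x by rewrite divr_gt0.
rewrite -(divfK (lt0r_neq0 x0) eps) mulrC; apply: jump_exponent_small => //.
by rewrite pr (branching_mechanism_ge0 htriple halpha)// ltW.
Qed.

(** For q(r) = 0 the root equation would read 0 = Phi(0) = pi(r, oo). *)
Lemma jump_exponent_gt0 r : 0 < r -> pi `]r, +oo[%classic <> 0%E -> 0 < q r.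
Proof.
move=> r0 pr; rewrite lt_neqAle q_ge0// andbT; apply/negP => /eqP q0; apply: pr.
have := q_root r r0; rewrite -q0 branching_mechanism0 (levy_tail0 r r0) => h.
have fin : pi `]r, +oo[%classic \is a fin_num.
  by rewrite ge0_fin_numE//; apply: (levy_set_fin htriple r) => //; exact: measurable_itv.
by rewrite -(fineK fin) -h.
Qed.

Lemma mu_null_below (A : set R) (e r : R) : measurable A ->
  pi (A `&` `]0, +oo[%classic) = 0%E -> 0 < e -> e < r -> pi `]r, +oo[%classic <> 0%E ->
  mu (A `&` `]e, r]%classic) = 0%E.
Proof.
move=> mA A0 e0 er pr; have r0 := lt_trans e0 er.
have [C C0 hC] := law_le_levy e r e0 r0 (jump_exponent_gt0 r r0 pr).
apply: (null_of_le_ocitv_within mu pi e r C) => //.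
- by rewrite levy_ocitv_fin// ltry.
- move=> a b ea ab br; rewrite levy_ocitv_fin ?(lt_le_trans e0)// muE//.
    by rewrite -EFinM lee_fin hC.
  by rewrite (le_trans _ ea)// ltW.
- apply/eqP; rewrite -measure_le0 -A0; apply: le_measure; rewrite ?inE.
  + by apply: measurableI => //; exact: measurable_itv.
  + by apply: measurableI => //; exact: measurable_itv.
  + move=> y [Ay /=]; rewrite !in_itv/= => /andP[ey _]; split => //.
    by rewrite andbT (lt_trans e0).
Qed.

Lemma levy_left_small r (eta : R) : 0 < r -> 0 < eta -> pi `[r, +oo[%classic = 0%E ->
  exists2 r', 0 < r' < r & fine (pi `]r', +oo[%classic) < eta.
Proof.
move=> r0 eta0 pr; pose u n : R := r - r / n.+2%:R.
have u0 n : 0 < u n by rewrite subr_gt0 ltr_pdivrMr ?ltr0n// ltr_pMr// ltr1n.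
have ur n : u n < r by rewrite ltrBlDr ltrDl divr_gt0.
pose F n := `](u n), +oo[%classic.
have Ffin n : (pi (F n) < +oo)%E by apply: (levy_set_fin htriple (u n)) => //; exact: measurable_itv.
have F0 : \bigcap_n F n = `[r, +oo[%classic.
  apply/seteqP; split => y; last first.
    move=> /=; rewrite in_itv/= andbT => ry n _ /=; rewrite /F /= in_itv/= andbT.
    exact: lt_le_trans ry.
  move=> Fy; rewrite /= in_itv/= andbT leNgt; apply/negP => yr.
  have yr0 : 0 < r - y by rewrite subr_gt0.
  have := Fy (Num.truncn (r / (r - y))) I; rewrite /F /= in_itv/= andbT ltNge => /negP; apply.
  rewrite /u lerBrDr -lerBrDl ler_pdivrMr ?ltr0n// mulrC -ler_pdivrMr//.
  by rewrite (le_trans (ltW (truncnS_gt _)))// ler_nat.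
have : pi (F n) @[n --> \oo] --> (0 : \bar R)%E.
  rewrite -pr -F0; apply: nonincreasing_cvg_mu => //.
  - by move=> n; exact: measurable_itv.
  - by apply: bigcap_measurable => // n _; exact: measurable_itv.
  - move=> m n mn; apply/subsetPset => y; rewrite /F /= !in_itv/= !andbT; apply: le_lt_trans.
    by rewrite lerD2l lerN2 ler_wpM2l ?(ltW r0)// lef_pV2 ?posrE ?ltr0n// ler_nat.
move=> /fine_cvgP[_ /cvgrPdist_lt/(_ _ eta0)[N _ /(_ N (leqnn N))]].
rewrite /= sub0r normrN ger0_norm ?fine_ge0// => h.
by exists (u N); rewrite ?u0 ?ur.
Qed.

(* Used at the right end point r of the support of pi, where the comparison constant of [law_le_levy]
   blows up: pi having no atom at r, pi (r', oo) and hence q(r') tend to 0 as r' increases to r. *)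
Lemma mu_null_atom (A : set R) (r : R) : 0 < r ->
  pi (A `&` `]0, +oo[%classic) = 0%E -> measurable A ->
  pi `]r, +oo[%classic = 0%E -> mu (A `&` [set r]) = 0%E.
Proof.
move=> r0 A0 mA pr; have [Ar|Ar] := pselect (A r); last first.
  by rewrite (_ : _ `&` _ = set0) ?measure0// -subset0 => y [Ay /= yr]; apply: Ar; rewrite -yr.
(* As [r] belongs to [A], whose positive part is null, [pi] has no atom at [r]. *)
have pr' : pi `[r, +oo[%classic = 0%E.
  have /negligibleS : `[r, +oo[ `<=` (A `&` `]0, +oo[) `|` `]r, +oo[.
    move=> y; rewrite /= !in_itv/= !andbT le_eqVlt => /orP[/eqP<-|]; last by right.
    by left.
  have mA0 : measurable (A `&` `]0, +oo[%classic).
    by apply: measurableI => //; exact: measurable_itv.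
  move=> /(_ _ pi) h; apply/(negligibleP pi); first exact: measurable_itv.
  apply: h; apply: negligibleU; apply/negligibleP => //; exact: measurable_itv.
apply/eqP; rewrite -measure_le0; apply/lee_addgt0Pr => eps eps0; rewrite add0e.
have dl0 : 0 < eps / x by rewrite divr_gt0.
have Phid := branching_mechanism_gt0 htriple halpha (eps / x) hpi dl0.
have [r' /andP[r'0 rr'] h] := levy_left_small r _ r0 Phid pr'.
have le1 : (mu (A `&` [set r]) <= mu `]r', +oo[%classic)%E.
  apply: le_measure; rewrite ?inE; [exact: measurableI|exact: measurable_itv|].
  by move=> y [_ /= ->]; rewrite in_itv/= rr'.
apply: (le_trans le1); apply: (le_trans (mu_half_line_le r' r'0)); rewrite lee_fin.
rewrite -(divfK (lt0r_neq0 x0) eps) mulrC; apply: jump_exponent_small => //.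
exact: ltW.
Qed.

(** The infimum is attained, as []inf S, +oo[] is a countable union of null tails. Above [e], it
    plays the part of the right end point of the support. *)
Lemma levy_null_right_end (e : R) (S := [set s | e <= s /\ pi `]s, +oo[%classic = 0%E]) :
  S !=set0 -> pi `](inf S), +oo[%classic = 0%E.
Proof.
move=> S0; have Si : has_inf S by split => //; exists e => s [].
have sub : `](inf S), +oo[ `<=` \bigcup_n `](inf S + n.+1%:R^-1), +oo[%classic.
  move=> y; rewrite /= in_itv/= andbT -subr_gt0 => y0.
  exists (Num.truncn (y - inf S)^-1) => //=; rewrite in_itv/= andbT -ltrBrDl.
  by rewrite invf_plt ?posrE// truncnS_gt.
apply: (negligibleP pi _).1; first exact: measurable_itv.
apply: negligibleS sub _; apply: negligible_bigcup => n; apply/negligibleP.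
  exact: measurable_itv.
have n1 : 0 < n.+1%:R^-1 :> R by rewrite invr_gt0.
have [s [es ps] sn] := inf_adherent n1 Si.
apply/eqP; rewrite -measure_le0 -ps; apply: le_measure; rewrite ?inE; try exact: measurable_itv.
by move=> y; rewrite /= !in_itv/= !andbT; apply: lt_trans.
Qed.

Lemma law_null_of_levy_null (A : set R) : measurable A ->
  pi (A `&` `]0, +oo[%classic) = 0%E -> mu (A `&` `]0, +oo[%classic) = 0%E.
Proof.
move=> mA A0; apply: null_positive_half_line => // e r e0 er.
have [pr|/eqP pr] := eqVneq (pi `]r, +oo[%classic) 0%E; last exact: mu_null_below.
pose S := [set s | e <= s /\ pi `]s, +oo[%classic = 0%E].
have Sr : S r by split => //; exact: ltW.
have lbS : lbound S e by move=> s [].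
have prho : pi `](inf S), +oo[%classic = 0%E by apply: levy_null_right_end; exists r.
have erho : e <= inf S by apply: lb_le_inf => //; exists r.
have rho0 := lt_le_trans e0 erho.
have mI a b : measurable (A `&` `]a, b]%classic).
  by apply: measurableI => //; exact: measurable_itv.
(* Strictly before [inf S] the tails are charged and the interval comparison applies; [inf S] itself
   and what lies beyond it are handled separately. *)
have sub : A `&` `]e, r] `<=` ((\bigcup_n (A `&` `]e, inf S - n.+1%:R^-1]%classic)) `|`
    (A `&` [set inf S])) `|` `](inf S), +oo[%classic.
  move=> y [Ay]; rewrite /= in_itv/= => /andP[ey _].
  have [yS|yS|yS] := ltgtP y (inf S); [left; left| |by left; right].
    exists (Num.truncn (inf S - y)^-1) => //; split => //=; rewrite in_itv/= ey/=.
    by rewrite lerBrDr -lerBrDl ltW// invf_plt ?posrE ?subr_gt0// truncnS_gt.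
  by right; rewrite /= in_itv/= yS.
apply: (negligibleP mu (mI _ _)).1; apply: negligibleS sub _.
apply: negligibleU; [apply: negligibleU|].
- apply: negligible_bigcup => n; apply/negligibleP; first exact: mI.
  have [en|en] := ltP e (inf S - n.+1%:R^-1).
    apply: mu_null_below => // ps.
    have : inf S <= inf S - n.+1%:R^-1.
      by apply: ge_inf; [exists e|split => //; exact: ltW].
    by rewrite leNgt ltrBlDr ltrDl invr_gt0 ltr0n.
  by rewrite set_itv_ge ?setI0 ?measure0// bnd_simp -leNgt.
- apply/negligibleP; first exact: measurableI.
  exact: mu_null_atom.
- apply/negligibleP; first exact: measurable_itv.
  exact: mu_null_beyond.
Qed.

End equivalence.

Theorem theorem3p11 (R : realType) (alpha beta : R)
    (pi : {measure set R -> \bar R})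
    (d : measure_display) (Omega : measurableType d)
    (X : R -> Omega -> R) (P : R -> probability Omega R) (x : R)
    (htriple : is_branching_triple alpha beta pi)
    (hX : is_CB_process (branching_mechanism alpha beta pi) X P)
    (hpi : pi setT <> 0%E) (hx : 0 < x) (halpha : 0 <= alpha) :
  mrestr (sup_jump_law X (P x)) (measurable_itv `]0, +oo[) `<< pi /\
  pi `<< mrestr (sup_jump_law X (P x)) (measurable_itv `]0, +oo[).
Proof.
have [hM [v hv hE]] := hX.
pose mX := measurable_X hM; pose rX := mk_rcll hM.
have mN := measurable_finite_sup_jump mX rX.
(* The measure structure of the push-forward depends on the measurability of the map, hence the
   detour through a function of that proof. *)
pose pushed : {measure set R -> \bar R} := pushforward (P x) (finite_sup_jump (X := X)).
pose mu := pushed mN.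
have muE a b : 0 <= a -> a <= b -> mu `]a, b]%classic =
    (jump_above_prob (X := X) (P := P) x a - jump_above_prob (X := X) (P := P) x b)%:E.
  move=> a0 ab; have b0 := le_trans a0 ab.
  rewrite [LHS](_ : _ = P x (finite_sup_jump (X := X) @^-1` `]a, b]%classic))// (finite_sup_jump_itv (X := X) a b a0 ab).
  rewrite measureD; [|exact: (measurable_jump_above hM)..|
    by rewrite ltey_eq fin_num_measure//; exact: (measurable_jump_above hM)].
  rewrite setIidr; last first.
    by move=> w /=; apply: le_lt_trans; rewrite lee_fin.
  by rewrite EFinB; congr (_ - _)%E; exact: (jump_above_probE hM).
have lawE A : mrestr (sup_jump_law X (P x)) (measurable_itv `]0, +oo[) A =
    mu (A `&` `]0, +oo[%classic).
  rewrite /mrestr /sup_jump_law /pushforward sup_jump_preimage// => y [].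
(* [pi] does not charge the nonpositive half-line, so nothing is lost by testing it on the positive
   part of a set. *)
have piE (A : set R) : measurable A -> pi (A `&` `]0, +oo[%classic) = 0%E -> pi A = 0%E.
  move=> mA A0; apply: (negligibleP pi mA).1.
  have mA0 : measurable (A `&` `]0, +oo[%classic).
    by apply: measurableI => //; exact: measurable_itv.
  have : A `<=` (A `&` `]0, +oo[%classic) `|` `]-oo, 0]%classic.
    move=> y Ay; have [y0|y0] := ltP 0 y; [left; split => //|right]; by rewrite /= in_itv/= ?y0.
  move=> /negligibleS; apply; apply: negligibleU; apply/negligibleP => //.
  exact: bt_support htriple.
(* A null set is here a set whose measurable subsets all have measure zero, hence the subset [B] of
   [A]. *)
split => A A0 B mB BA.
  rewrite lawE; apply: (law_null_of_levy_null htriple halpha hpi hM hv hE x hx mu muE) => //.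
  apply: A0; first by apply: measurableI => //; exact: measurable_itv.
  by move=> y [/BA].
apply: piE => //; apply: (levy_null_of_law_null htriple halpha hpi hM hv hE x hx mu muE) => //.
by rewrite -lawE; exact: A0.
Qed.
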